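(* Let $H$ be a real Hilbert space, and let $A$ be a nonnegative self-adjoint (unbounded) linear operator on $H$ with dense domain $D(A)$. Assume that $A$ is coercive, namely $$\nu:=\inf\left\{\frac{\langle Ax,x\rangle}{|x|^{2}}:x\in D(A),\ x\neq 0\right\}>0.$$ Let $\gamma>0$, let $p\in[0,1]$, and let $(u_{0},u_{1})\in D(A)\times D(A^{1/2})$ satisfy $A^{1/2}u_{0}\neq 0$. Then there exists $\varepsilon_{0}>0$ such that for every $\varepsilon\in(0,\varepsilon_{0})$ the Cauchy problem $$\varepsilon u_{\varepsilon}''(t)+\frac{1}{(1+t)^{p}}u_{\varepsilon}'(t)+|A^{1/2}u_{\varepsilon}(t)|^{2\gamma}Au_{\varepsilon}(t)=0\quad\forall t\geq 0,\qquad u_{\varepsilon}(0)=u_{0},\quad u_{\varepsilon}'(0)=u_{1},$$ has a unique global solution $$u_{\varepsilon}\in C^{2}([0,+\infty);H)\cap C^{1}([0,+\infty);D(A^{1/2}))\cap C^{0}([0,+\infty);D(A)).$$ Moreover there exist positive constants $C_{1}$ and $C_{2}$, independent of $\varepsilon\in(0,\varepsilon_0)$, such that for every $\varepsilon\in(0,\varepsilon_0)$ and every $t\geq 0$ $$\frac{C_{1}}{(1+t)^{(p+1)/\gamma}}\leq|A^{1/2}u_{\varepsilon}(t)|^{2}\leq\frac{C_{2}}{(1+t)^{(p+1)/\gamma}},$$ $$\frac{C_{1}}{(1+t)^{(p+1)/\gamma}}\leq|Au_{\varepsilon}(t)|^{2}\leq\frac{C_{2}}{(1+t)^{(p+1)/\gamma}},$$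 $$|u_{\varepsilon}'(t)|^{2}\leq\frac{C_{2}}{(1+t)^{2+(p+1)/\gamma}}.$$
   Context: $|x|$ and $\langle x,y\rangle$ denote the norm and scalar product of the real Hilbert space $H$. Nonnegative means $\langle Ax,x\rangle\geq 0$ for every $x\in D(A)$; for $\alpha\geq 0$ the power $A^{\alpha}$ with domain $D(A^{\alpha})$ is defined by the spectral theory of self-adjoint operators. $D(A)$ and $D(A^{1/2})$ are endowed with their graph norms. Uniqueness is meant in the stated regularity class. *)

(* Defs.v *)
From HB Require Import structures.
From mathcomp Require Import all_boot all_order all_algebra.
From mathcomp Require Import all_classical all_reals all_analysis.
Set Implicit Arguments.
Unset Strict Implicit.
Unset Printing Implicit Defensive.
Import Order.TTheory GRing.Theory Num.Theory.
Import numFieldNormedType.Exports.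

Local Open Scope classical_set_scope.
Local Open Scope ring_scope.

(* A real Hilbert space is a complete normed module whose norm is induced by
   a symmetric positive definite form. *)
Definition hilbert_form (R : realType) (H : completeNormedModType R)
    (dot : {dot H for idfun}) : Prop :=
  forall x : H, dot x x = `|x| ^+ 2.

(* The values of [app] outside [dom] are irrelevant. *)
Record unbounded_operator (R : realType) (H : completeNormedModType R) := {
  dom : set H;
  app :> H -> H;
  dom0 : dom 0;
  domP : forall (a : R) (x y : H), dom x -> dom y -> dom (a *: x + y);
  appP : forall (a : R) (x y : H), dom x -> dom y ->
           app (a *: x + y) = a *: app x + app y
}.

Section Operators.
Variables (R : realType) (H : completeNormedModType R).
Variable dot : {dot H for idfun}.
Implicit Types A B : unbounded_operator H.

Definition adjoint_graph A (y z : H) : Prop :=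
  forall x, dom A x -> dot (A x) y = dot x z.

Definition self_adjoint A : Prop :=
  dense (dom A) /\
  forall y z, adjoint_graph A y z <-> dom A y /\ A y = z.

Definition nonnegative A : Prop :=
  forall x, dom A x -> 0 <= dot (A x) x.

Definition rayleigh_inf A : R :=
  inf [set dot (A x) x / `|x| ^+ 2 | x in [set x | dom A x /\ x != 0]].

(* Projection-valued measure on the Borel sets of R. Countable additivity is
   expressed by the fact that each S |-> <E(S) x, x> is a measure. *)
Record resolution_of_identity := {
  proj : set (measurableTypeR R) -> H -> H;
  spec_measure : H -> {measure set (measurableTypeR R) -> \bar R};
  proj_linear : forall S, measurable S ->
    forall (a : R) (x y : H), proj S (a *: x + y) = a *: proj S x + proj S y;
  proj_sym : forall S, measurable S ->
    forall x y : H, dot (proj S x) y = dot x (proj S y);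
  projI : forall S T, measurable S -> measurable T ->
    forall x : H, proj (S `&` T) x = proj S (proj T x);
  projT : forall x : H, proj setT x = x;
  spec_measureE : forall (x : H) S, measurable S ->
    spec_measure x S = (dot (proj S x) x)%:E
}.

(* B is the operator \int f dE, whose domain consists of the x with
   \int |f|^2 d<E x, x> < +oo, and <B x, z> = \int f d<E x, z>. The integral
   with respect to the signed measure <E x, z> is obtained by polarization. *)
Definition spectral_integral (E : resolution_of_identity) (f : R -> R) B :
    Prop :=
  (forall x, dom B x <->
     (\int[spec_measure E x]_l ((f l) ^+ 2)%:E < +oo)%E) /\
  (forall x z, dom B x -> dom B z ->
     dot (B x) z = 4^-1 * (\int[spec_measure E (x + z)]_l f l
                           - \int[spec_measure E (x - z)]_l f l)).

(* B is A^alpha, for A self-adjoint and nonnegative and alpha >= 0. The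
   resolution of identity of such an A vanishes on the negative half-line, where
   the values of powR are therefore irrelevant. *)
Definition is_power A (alpha : R) B : Prop :=
  exists E : resolution_of_identity,
    spectral_integral E id A /\ spectral_integral E (fun l => l `^ alpha) B.

End Operators.

Section Regularity.
Variables (R : realType) (H : completeNormedModType R).

Definition graph_norm (A : unbounded_operator H) (x : H) : R := `|x| + `|A x|.

(* Derivative of a function on [0, +oo[, one-sided at 0; meaningful only at
   t >= 0, where the limit is taken over s >= 0 with s != t. *)
Definition deriv_ge0 (u : R -> H) (t : R) : H :=
  lim ((s - t)^-1 *: (u s - u t) @[s --> within `[0, +oo[ (dnbhs t)]).

(* The class C^k([0, +oo[; X), for a subspace X of H endowed with a norm N
   stronger than that of H (so that the derivative in X, if it exists, is the
   one in H). *)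
Fixpoint class_C (k : nat) (X : set H) (N : H -> R) (u : R -> H) : Prop :=
  match k with
  | 0 => forall t, 0 <= t -> X (u t) /\
           N (u s - u t) @[s --> within `[0, +oo[ (nbhs t)] --> (0 : R)
  | k'.+1 =>
      (forall t, 0 <= t -> X (u t) /\ X (deriv_ge0 u t) /\
         N ((s - t)^-1 *: (u s - u t) - deriv_ge0 u t)
           @[s --> within `[0, +oo[ (dnbhs t)] --> (0 : R)) /\
      class_C k' X N (deriv_ge0 u)
  end.

Definition is_solution (A sqrtA : unbounded_operator H) (gamma p eps : R)
    (u0 u1 : H) (u : R -> H) : Prop :=
  [/\ class_C 2 setT (fun x => `|x|) u,
      class_C 1 (dom sqrtA) (graph_norm sqrtA) u,
      class_C 0 (dom A) (graph_norm A) u,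
      (forall t, 0 <= t ->
         eps *: deriv_ge0 (deriv_ge0 u) t
         + ((1 + t) `^ p)^-1 *: deriv_ge0 u t
         + (`|sqrtA (u t)| `^ (2 * gamma)) *: A (u t) = 0)
    & u 0 = u0 /\ deriv_ge0 u 0 = u1].

End Regularity.

(* Main.v *)
Require Import Defs.
From HB Require Import structures.
From mathcomp Require Import all_boot all_order all_algebra.
From mathcomp Require Import all_classical all_reals all_analysis.
From mathcomp Require Import measurable_realfun ring lra.
Import Order.TTheory GRing.Theory Num.Theory.
Import numFieldNormedType.Exports.
Local Open Scope classical_set_scope.
Local Open Scope ring_scope.
Set Implicit Arguments.
Unset Strict Implicit.

(** Write S for the square root of A, B = |S u|^2, N = |A u|^2, X = <A u, u'>,
    Y = |S u'|^2, Z = |u'|^2, q = (1 + t)^p, and let z = B^(-g) be the inverse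
    of the stiffness |S u|^(2 g), where g is the exponent gamma.

    Decay. The equation closes on these scalar functions, and rho = 2 g X / B is
    the relative rate of change of the stiffness. As long as eps |rho| q is
    small, the quantity eps z (Y B - X^2) / B^2 + N / B is nonincreasing, so that
    N / B = |A u|^2 / |S u|^2 stays bounded; coercivity bounds it from below. A
    barrier argument then bounds Z z^2 / (B q^2), which gives |rho| z = O(q).
    After the small correction by eps rho z q, the derivative of z lies
    between two positive multiples of q. Hence z grows like
    (1 + t)^(p + 1), the integral of q, which is the claimed two-sided decay of B; the bounds on
    |A u| and |u'| follow from those on N / B and Z z^2 / (B q^2). Since
    q <= 1 + t, the bound |rho| z = O(q) and the growth of z also give
    eps |rho| q = O(eps), so for small eps the smallness that was assumed improves itself, and a continuity argument
    removes it ([quotient_nonincreasing], [velocity_bound], [rate_bound],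
    [inverse_stiffness_lower], [inverse_stiffness_upper],
    [kirchhoff_a_priori]).

    Existence. Let P_n be the spectral projection on the part of the spectrum
    where S is below n. On the range of P_n the operator S is bounded and the
    equation is an ordinary differential equation, solved by Picard iteration
    once the stiffness is clamped between two positive bounds
    ([truncated_solution]). The decay estimates hold for the clamped
    equation too, with constants that do not depend on n, and they show that
    the clamp is never active ([galerkin_existence]). The energy
    eps |u'|^2 + c |S u|^2 of the difference of two approximations
    satisfies a Gronwall inequality ([galerkin_stability]). This is convergence in a
    norm that is too weak, but since all the P_k commute with the equation, the components
    above level k obey a linear equation, and their stronger norm is bounded,
    uniformly in n, by that of the same components of the data
    ([galerkin_tail]). The two facts together give convergence in the
    graph norms, locally uniformly in time ([limit_solution]).

    Uniqueness is the same Gronwall inequality for two arbitrary solutions: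
    one of them has |S u| > 0, and r^(2 g) is Lipschitz at such values
    ([uniqueness]).

    Spectral theory enters only through the properties collected in
    [sqrt_truncation]. On a slice of the spectrum where the symbol varies
    little, the operator is close to a scalar ([slice_estimate]); an identity
    between quadratic quantities that are additive over slices then follows by cutting the
    spectrum into thin slices ([halving]). In this way S^2 = A on the range of P_n
    is obtained without a functional calculus. *)

(** * Scalar calculus *)

Section ScalarCalculus.
Variable R : realType.
Implicit Types (f g : R -> R) (t : R).

Lemma drvD f g t df dg : is_derive t (1:R) f df -> is_derive t (1:R) g dg ->
  is_derive t (1:R) (fun s => f s + g s) (df + dg).
Proof. by move=> hf hg; exact: is_deriveD. Qed.

Lemma drvN f t df : is_derive t (1:R) f df ->
  is_derive t (1:R) (fun s => - f s) (- df).
Proof. by move=> hf; exact: is_deriveN. Qed.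

Lemma drvM f g t df dg : is_derive t (1:R) f df -> is_derive t (1:R) g dg ->
  is_derive t (1:R) (fun s => f s * g s) (f t * dg + g t * df).
Proof. by move=> hf hg; exact: is_deriveM. Qed.

Lemma drvC (a : R) t : is_derive t (1:R) (fun=> a) 0.
Proof. exact: is_derive_cst. Qed.

Lemma drvV f t df : f t != 0 -> is_derive t (1:R) f df ->
  is_derive t (1:R) (fun s => (f s)^-1) (- df / f t ^+ 2).
Proof.
move=> f0 hf; apply: is_derive_eq (is_deriveV f0 hf) _.
by rewrite /GRing.scale /= mulrC mulrN mulNr.
Qed.

Lemma drvX f n t df : is_derive t (1:R) f df ->
  is_derive t (1:R) (fun s => f s ^+ n) (n%:R * f t ^+ n.-1 * df).
Proof.
move=> hf; have -> : (fun s => f s ^+ n) = f ^+ n by apply/funext => s; rewrite exprfctE.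
exact: is_deriveX.
Qed.

Lemma drvpow f (a : R) t df : 0 < f t -> is_derive t (1:R) f df ->
  is_derive t (1:R) (fun s => f s `^ a) (a * f t `^ (a - 1) * df).
Proof.
move=> f0 hf.
exact: (@is_derive1_comp R (fun x => x `^ a) f t _ _ (is_derive1_powR a f0) hf).
Qed.

Lemma drv_cont (V : normedModType R) (f : R -> V) t df : is_derive t (1:R) f df -> {for t, continuous f}.
Proof.
move=> [hd _]; apply: differentiable_continuous; exact/derivable1_diffP.
Qed.

Lemma deriv_ge0_le f df a b : a <= b ->
  (forall t, a <= t <= b -> {for t, continuous f}) ->
  (forall t, a < t < b -> is_derive t (1:R) f (df t)) ->
  (forall t, a < t < b -> 0 <= df t) -> f a <= f b.
Proof.
rewrite le_eqVlt => /orP[/eqP -> //|ab] hc hd h0.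
have hw : {within `[a, b], continuous f}.
  apply: continuous_in_subspaceT => t; rewrite inE/= in_itv/= => tab; exact: hc.
have hd' t : t \in `]a, b[ -> is_derive t (1:R) f (df t).
  by rewrite in_itv => /hd.
have [t tab e] := MVT ab hd' hw.
rewrite -subr_ge0 e mulr_ge0 ?subr_ge0 ?(ltW ab)//.
by apply: h0; move: tab; rewrite in_itv.
Qed.

Lemma deriv_le0_ge f df a b : a <= b ->
  (forall t, a <= t <= b -> {for t, continuous f}) ->
  (forall t, a < t < b -> is_derive t (1:R) f (df t)) ->
  (forall t, a < t < b -> df t <= 0) -> f b <= f a.
Proof.
move=> ab hc hd h0; rewrite -lerN2.
apply: (@deriv_ge0_le (fun s => - f s) (fun s => - df s) a b) => // t tab.
- by apply: continuousN; exact: hc.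
- by apply: drvN; exact: hd.
- by rewrite oppr_ge0; exact: h0.
Qed.

(** The supremum of the times where f is nonpositive; by continuity the
    supremum is attained. *)
Lemma last_nonpos f a b : a <= b ->
  (forall t, a <= t <= b -> {for t, continuous f}) -> f a <= 0 -> 0 < f b ->
  exists2 s, a <= s < b & f s <= 0 /\ forall t, s < t <= b -> 0 < f t.
Proof.
move=> ab hc fa fb.
pose S := [set t | a <= t <= b /\ f t <= 0].
have Sa : S a by split=> //; rewrite lexx.
have hS : has_sup S by split; [exists a|exists b => t [/andP[]]].
pose s := sup S.
have as_ : a <= s by apply: sup_upper_bound.
have sb : s <= b by apply: sup_le_ub; [exists a|move=> t [/andP[]]].
have fs : f s <= 0.
  rewrite leNgt; apply/negP => fs.
  have /cvgrPdist_lt/(_ _ fs) := hc s (introT andP (conj as_ sb)).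
  move=> /nbhs_ballP[d /= d0 hd].
  have [t [/andP[at_ tb] ft] st] := sup_adherent d0 hS.
  have ts : t <= s by apply: sup_upper_bound => //; split=> //; apply/andP.
  have : ball s d t by rewrite /ball/= ger0_norm ?subr_ge0//; rewrite ltrBlDr addrC -ltrBlDr.
  move/hd => /=; rewrite ltr_norml => /andP[_]; lra.
exists s.
  rewrite as_ /= lt_neqAle sb andbT; apply/eqP => e; move: fs; rewrite e; lra.
split=> // t /andP[st tb]; rewrite ltNge; apply/negP => ft.
have : t <= s by apply: sup_upper_bound => //; split=> //; rewrite tb andbT (le_trans as_ (ltW st)).
by rewrite leNgt st.
Qed.

(** At the last time before T where f is not positive, f would have to increase
    to become positive at T, but it can only decrease while it is positive. *)
Lemma barrier f df T : 0 <= T ->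
  (forall t, 0 <= t <= T -> {for t, continuous f}) ->
  (forall t, 0 < t < T -> is_derive t (1:R) f (df t)) ->
  f 0 <= 0 -> (forall t, 0 < t < T -> 0 < f t -> df t <= 0) -> f T <= 0.
Proof.
move=> T0 hc hd f0 h; rewrite leNgt; apply/negP => fT.
have [s /andP[s0 sT] [fs ps]] := last_nonpos T0 hc f0 fT.
have : f T <= f s.
  apply: (@deriv_le0_ge f df) => [|t /andP[t1 t2]|t /andP[t1 t2]|t /andP[t1 t2]].
  - exact: ltW.
  - by apply: hc; rewrite t2 andbT (le_trans s0).
  - by apply: hd; rewrite t2 andbT (le_lt_trans s0).
  - apply: h; first by rewrite t2 andbT (le_lt_trans s0).
    by apply: ps; rewrite t1 ltW.
lra.
Qed.

(** A bound that holds strictly as soon as it holds non-strictly on the past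
    never fails: read backwards from a failure, the last good time is
    given by [last_nonpos]. *)
Lemma continuous_induction g : (forall t, 0 <= t -> {for t, continuous g}) ->
  0 <= g 0 ->
  (forall T, 0 <= T -> (forall s, 0 <= s <= T -> 0 <= g s) -> 0 < g T) ->
  forall t, 0 <= t -> 0 < g t.
Proof.
move=> hc g0 h t t0; rewrite ltNge; apply/negP => gt.
have h0 : 0 < g 0.
  by apply: h => // s; rewrite -eq_le => /eqP <-.
pose f s := g (t - s).
have fc s : 0 <= s <= t -> {for s, continuous f}.
  move=> /andP[s0 st]; apply: (@continuous_comp _ _ _ (fun s => t - s) g).
    by apply: continuousB; [exact: cst_continuous|exact: cvg_id].
  by apply: hc; rewrite subr_ge0.
have [||s /andP[s0 st] [fs ps]] := last_nonpos t0 fc.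
- by rewrite /f subr0.
- by rewrite /f subrr.
suff : 0 < g (t - s) by move: fs; rewrite /f; lra.
apply: h => [|r /andP[r0 rts]]; first by rewrite subr_ge0 ltW.
move: rts; rewrite le_eqVlt => /orP[/eqP ->|rts].
  have st0 : 0 < t - s by rewrite subr_gt0.
  rewrite leNgt; apply/negP => gs.
  have /cvgrPdist_lt := hc _ (ltW st0).
  move=> /(_ (- g (t - s))); rewrite oppr_gt0 => /(_ gs) /nbhs_ballP[d /= d0 hd].
  pose r' := Num.max 0 (t - s - d / 2).
  have r's : r' < t - s by rewrite /r' gt_max st0 gtrBl divr_gt0.
  have : ball (t - s) d r'.
    have : t - s - d / 2 <= r' by rewrite /r' le_max lexx orbT.
    by rewrite /ball/= gtr0_norm ?subr_gt0//; lra.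
  move/hd => /=; rewrite ltr_norml => /andP[+ _].
  have : 0 < g r'.
    have := ps (t - r'); rewrite /f subKr; apply.
    by rewrite ltrBrDr addrC -ltrBrDr r's gerBl /r' le_max lexx.
  lra.
rewrite ltW//; have := ps (t - r); rewrite /f subKr; apply.
by rewrite ltrBrDr addrC -ltrBrDr rts /= gerBl.
Qed.
End ScalarCalculus.

(** * Gronwall inequalities and derivatives of the scalar quantities *)

Section Gronwall.
Variable R : realType.

Lemma gronwall (E dE : R -> R) (K T : R) : 0 <= T ->
  (forall t, 0 <= t <= T -> {for t, continuous E}) ->
  (forall t, 0 < t < T -> is_derive t (1:R) E (dE t)) ->
  (forall t, 0 < t < T -> dE t <= K * E t) ->
  E T <= E 0 * expR (K * T).
Proof.
move=> T0 hc hd h.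
have hx t : is_derive t (1:R) (fun s => expR (- K * s)) (- K * expR (- K * t)).
  have h1 : is_derive t (1:R) (fun s : R => - K * s) (- K).
    by apply: is_derive_eq (drvM (drvC (- K) t) (is_derive_id t 1)) _; rewrite mulr1 mulr0 addr0.
  by apply: is_derive_eq (is_derive1_comp (is_derive_expR _) h1) _; rewrite mulrC.
have : E T * expR (- K * T) <= E 0 * expR (- K * 0).
  apply: (@deriv_le0_ge _ (fun s => E s * expR (- K * s))
    (fun t => E t * (- K * expR (- K * t)) + expR (- K * t) * dE t)) => // t tT.
  - apply: continuousM; [exact: hc|exact: drv_cont (hx t)].
  - exact: drvM (hd t tT) (hx t).
  - have := h _ tT; have : 0 < expR (- K * t) by exact: expR_gt0.
    by nra.
rewrite mulr0 expR0 mulr1 mulNr expRN -ler_pdivlMr ?invr_gt0 ?expR_gt0//.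
by rewrite invrK.
Qed.

(** For the energy eps e1 + c e2 of a second-order equation with variable
    stiffness c: the products c x cancel, and what remains is bounded by the
    energy itself because c is bounded below and its derivative above. Here e1 and e2 are the
    squared norms of the velocity and of the displacement in the form domain, and 2 y, 2 x
    are their derivatives. *)
Lemma energy_gronwall (e1 e2 x y c dc : R -> R) (eps c0 K T : R) :
  0 <= T -> 0 < eps -> 0 < c0 -> 0 <= K ->
  (forall t, 0 <= t <= T -> {for t, continuous e1}) ->
  (forall t, 0 <= t <= T -> {for t, continuous e2}) ->
  (forall t, 0 <= t <= T -> {for t, continuous c}) ->
  (forall t, 0 < t < T -> is_derive t (1:R) e1 (2 * y t)) ->
  (forall t, 0 < t < T -> is_derive t (1:R) e2 (2 * x t)) ->
  (forall t, 0 < t < T -> is_derive t (1:R) c (dc t)) ->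
  (forall t, 0 <= e1 t) -> (forall t, 0 <= e2 t) ->
  (forall t, 0 < t < T -> c0 <= c t) ->
  (forall t, 0 < t < T -> dc t <= K) ->
  (forall t, 0 < t < T -> eps * y t <= - (c t * x t) + K * (e1 t + e2 t)) ->
  eps * e1 T + c T * e2 T <=
    (eps * e1 0 + c 0 * e2 0) * expR ((2 * K / eps + 3 * K / c0) * T).
Proof.
move=> T0 eps0 c00 K0 c1 c2 cc d1 d2 dcc e1p e2p cp dcK h.
apply: (@gronwall (fun t => eps * e1 t + c t * e2 t)
  (fun t => eps * (2 * y t) + (c t * (2 * x t) + e2 t * dc t))) => // t tT.
- apply: continuousD; apply: continuousM; [exact: cst_continuous|exact: c1|exact: cc|exact: c2].
- apply: is_derive_eq (drvD (drvM (drvC eps t) (d1 t tT)) (drvM (dcc t tT) (d2 t tT))) _.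
  ring.
- have H1 := h t tT; have H2 := dcK t tT; have H3 := cp t tT.
  have p1 := e1p t; have p2 := e2p t.
  have q1 : 0 <= 2 * K / eps by rewrite divr_ge0 ?(ltW eps0)// mulr_ge0.
  have q2 : 0 <= 3 * K / c0 by rewrite divr_ge0 ?(ltW c00)// mulr_ge0.
  have q3 : 2 * K * e1 t <= (2 * K / eps + 3 * K / c0) * (eps * e1 t).
    have -> : 2 * K * e1 t = 2 * K / eps * (eps * e1 t) by field; rewrite gt_eqF.
    rewrite [leRHS]mulrDl lerDl.
    by rewrite mulr_ge0// mulr_ge0// ltW.
  have q4 : 3 * K * e2 t <= (2 * K / eps + 3 * K / c0) * (c t * e2 t).
    apply: (@le_trans _ _ ((3 * K / c0) * (c0 * e2 t))).
      rewrite le_eqVlt; apply/orP; left; apply/eqP; field.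
      by rewrite gt_eqF.
    rewrite [leRHS]mulrDl -[leLHS]add0r; apply: lerD.
      by rewrite mulr_ge0// mulr_ge0// (le_trans (ltW c00)).
    by rewrite ler_wpM2l// ler_wpM2r.
  have q5 : e2 t * dc t <= e2 t * K by rewrite ler_wpM2l.
  rewrite mulrDr.
  lra.
Qed.

Definition stability_constant (eps c0 c1 K T : R) :=
  (eps + c1) * (eps^-1 + c0^-1) * expR ((2 * K / eps + 3 * K / c0) * T).

Lemma stability_constant_ge0 (eps c0 c1 K T : R) : 0 < eps -> 0 < c0 -> 0 <= c1 ->
  0 <= stability_constant eps c0 c1 K T.
Proof.
move=> eps0 c00 c10; rewrite !mulr_ge0 ?expR_ge0 ?addr_ge0 ?invr_ge0 ?c10 ?(ltW eps0) ?(ltW c00)//.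
Qed.

(** The form in which the energy inequality is applied, to differences of approximations, to
    their high components and to differences of solutions: the constant
    depends only on the bounds of the coefficients. *)
Lemma energy_stability (e1 e2 x y c dc : R -> R) (eps c0 c1 K t T : R) :
  0 <= t -> t <= T -> 0 < eps -> 0 < c0 -> 0 <= K ->
  (forall s, 0 <= s <= t -> {for s, continuous e1}) ->
  (forall s, 0 <= s <= t -> {for s, continuous e2}) ->
  (forall s, 0 <= s <= t -> {for s, continuous c}) ->
  (forall s, 0 < s < t -> is_derive s (1:R) e1 (2 * y s)) ->
  (forall s, 0 < s < t -> is_derive s (1:R) e2 (2 * x s)) ->
  (forall s, 0 < s < t -> is_derive s (1:R) c (dc s)) ->
  (forall s, 0 <= e1 s) -> (forall s, 0 <= e2 s) ->
  (forall s, 0 <= s <= t -> c0 <= c s <= c1) ->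
  (forall s, 0 < s < t -> dc s <= K) ->
  (forall s, 0 < s < t -> eps * y s <= - (c s * x s) + K * (e1 s + e2 s)) ->
  e1 t <= stability_constant eps c0 c1 K T * (e1 0 + e2 0) /\
  e2 t <= stability_constant eps c0 c1 K T * (e1 0 + e2 0).
Proof.
move=> t0 tT eps0 c00 K0 h1 h2 h3 h4 h5 h6 e1p e2p hc dcK h.
have {}h1 := energy_gronwall t0 eps0 c00 K0 h1 h2 h3 h4 h5 h6 e1p e2p
  (fun s st => (andP (hc s (andb_true_intro (conj (ltW (andP st).1) (ltW (andP st).2))))).1) dcK h.
have tt : 0 <= t <= t by rewrite t0 lexx.
have z0 : (0:R) <= 0 <= t by rewrite lexx.
have /andP[ct _] := hc t tt; have /andP[cz0 cz] := hc 0 z0.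
have c10 : 0 < c1 := lt_le_trans c00 (le_trans cz0 cz).
set E := expR _ in h1.
have EE : E <= expR ((2 * K / eps + 3 * K / c0) * T).
  by rewrite ler_expR ler_wpM2l// addr_ge0// divr_ge0 ?(ltW eps0) ?(ltW c00)// mulr_ge0.
have E0 : 0 <= E by exact: expR_ge0.
move: (e1p t) (e2p t) (e1p 0) (e2p 0) => p1 p2 p3 p4.
rewrite /stability_constant; set F := expR _ in EE *.
move: (e1 t) (e2 t) (e1 0) (e2 0) (c t) (c 0) p1 p2 p3 p4 ct cz0 cz h1 => a b a0 b0 ct cz p1 p2 p3 p4 q1 q0 q2 h1.
pose N := (eps + c1) * F * (a0 + b0).
have st : eps * a0 + cz * b0 <= (eps + c1) * (a0 + b0).
  rewrite mulrDr; apply: lerD; rewrite ler_wpM2r// ?lerDl ?(ltW c10)//.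
  by apply: le_trans q2 _; rewrite lerDr ltW.
have main : eps * a + c0 * b <= N.
  apply: (@le_trans _ _ (eps * a + ct * b)); first by rewrite lerD2l ler_wpM2r.
  apply: le_trans h1 _; rewrite /N mulrAC; apply: ler_pM => //.
  by rewrite addr_ge0// mulr_ge0// ?(ltW eps0)// (le_trans (ltW c00)).
have -> : (eps + c1) * (eps^-1 + c0^-1) * F * (a0 + b0) = N / eps + N / c0 by rewrite /N; ring.
have N0 : 0 <= N by apply: le_trans main; rewrite addr_ge0// mulr_ge0// ltW.
have m1 : a <= N / eps.
  by rewrite ler_pdivlMr// mulrC; apply: le_trans main; rewrite lerDl mulr_ge0// ltW.
have m2 : b <= N / c0.
  by rewrite ler_pdivlMr// mulrC; apply: le_trans main; rewrite lerDr mulr_ge0// ltW.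
split.
  by rewrite -[leLHS]addr0; apply: lerD m1 _; rewrite divr_ge0// ltW.
by rewrite -[leLHS]add0r; apply: lerD _ m2; rewrite divr_ge0// ltW.
Qed.
End Gronwall.

(** Computes the derivative of an explicit expression from the rules above; the result is
    compared with the expected one by [field]. *)
Ltac drv := cbv beta; first
  [ eassumption | eapply drvC
  | eapply drvX; drv
  | eapply drvV; [assumption | drv]
  | eapply drvN; drv
  | eapply drvM; [drv | drv]
  | eapply drvD; [drv | drv] ].

Section Identities.
Variables (R : realType) (B X N Y Z W z q : R -> R) (e g dq t : R).
Hypotheses (e0 : e != 0) (g0 : g != 0) (B0 : B t != 0) (z0 : z t != 0) (q0 : q t != 0).
Hypothesis hB : is_derive t (1:R) B (2 * X t).
Hypothesis hX : is_derive t (1:R) X ((e * Y t - X t / q t - N t / z t) / e).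
Hypothesis hN : is_derive t (1:R) N (2 * W t).
Hypothesis hY : is_derive t (1:R) Y (- (2 / e) * (Y t / q t + W t / z t)).
Hypothesis hZ : is_derive t (1:R) Z (- (2 / e) * (Z t / q t + X t / z t)).
Hypothesis hz : is_derive t (1:R) z (- (2 * g * X t / B t) * z t).
Hypothesis hq : is_derive t (1:R) q dq.

Let rho := 2 * g * X t / B t.

(** This identity and the two that follow carry the decay estimate. Here the terms with W
    cancel between the two summands, and the fraction
    (Y B - X^2) / B^2 is the defect in the Cauchy-Schwarz inequality. *)
Lemma deriv_quotient :
  is_derive t (1:R) (fun s => e * (z s * ((Y s * B s - X s ^+ 2) * (B s ^+ 2)^-1)) + N s * (B s)^-1)
  (- (z t * ((Y t * B t - X t ^+ 2) / B t ^+ 2) * (2 / q t + e * (1 + 2 / g) * rho))).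
Proof.
have B20 : B t ^+ 2 != 0 by rewrite expf_neq0.
eapply is_derive_eq; [drv|].
rewrite /rho; field.
by rewrite e0 g0 B0 z0 q0.
Qed.

(** The quotient Z z^2 / (B q^2) is damped at the rate 2 / (eps q), which dominates all its other
    terms except the forcing X z / (B q). *)
Lemma deriv_velocity :
  is_derive t (1:R) (fun s => Z s * (z s ^+ 2 * (B s * q s ^+ 2)^-1))
  (e^-1 * ((Z t * z t ^+ 2 / (B t * q t ^+ 2)) * (- 2 / q t - e * (2 + g^-1) * rho - 2 * e * dq / q t)
    - 2 * (X t * z t / (B t * q t)) / q t)).
Proof.
have B20 : B t * q t ^+ 2 != 0 by rewrite mulf_neq0// expf_neq0.
eapply is_derive_eq; [drv|].
rewrite /rho; field.
by rewrite e0 g0 B0 q0 z0.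
Qed.

(** Without the correction eps rho z q the derivative of z is - rho z, whose
    sign and size are not visible; the correction replaces it by 2 g q N / B up to
    terms that the two quantities above control. *)
Lemma deriv_phi :
  is_derive t (1:R) (fun s => z s - e * (2 * g * (X s * (B s)^-1 * (z s * q s))))
  (2 * g * (N t / B t) * q t
   - 2 * g * e * ((Y t * B t - X t ^+ 2) / B t ^+ 2) * z t * q t
   + e * rho ^+ 2 * z t * q t * (1 + (2 * g)^-1) - e * rho * z t * dq).
Proof.
eapply is_derive_eq; [drv|].
rewrite /rho; field.
by rewrite e0 g0 B0 q0 z0.
Qed.
End Identities.

(** * Growth of the inverse stiffness *)

Section Region.
Variables (R : realType) (B X N Y Z W z q dq : R -> R) (e g p nu d T : R).
Hypotheses (e0 : 0 < e) (g0 : 0 < g) (nu0 : 0 < nu) (T0 : 0 <= T).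
Hypotheses (p0 : 0 <= p) (p1 : p <= 1).
Hypotheses (d0 : 0 < d) (dg : d * (2 + 2 / g) <= 1).
Hypothesis hB : forall t, 0 <= t <= T -> is_derive t (1:R) B (2 * X t).
Hypothesis hX : forall t, 0 <= t <= T ->
  is_derive t (1:R) X ((e * Y t - X t / q t - N t / z t) / e).
Hypothesis hN : forall t, 0 <= t <= T -> is_derive t (1:R) N (2 * W t).
Hypothesis hY : forall t, 0 <= t <= T ->
  is_derive t (1:R) Y (- (2 / e) * (Y t / q t + W t / z t)).
Hypothesis hZ : forall t, 0 <= t <= T ->
  is_derive t (1:R) Z (- (2 / e) * (Z t / q t + X t / z t)).
Hypothesis hz : forall t, 0 <= t <= T ->
  is_derive t (1:R) z (- (2 * g * X t / B t) * z t).
Hypothesis hq : forall t, 0 <= t <= T -> is_derive t (1:R) q (dq t).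
Hypotheses (B0 : forall t, 0 <= t <= T -> 0 < B t)
  (z0 : forall t, 0 <= t <= T -> 0 < z t).
Hypotheses (q1 : forall t, 0 <= t <= T -> 1 <= q t)
  (qt : forall t, 0 <= t <= T -> q t <= 1 + t)
  (dq0 : forall t, 0 <= t <= T -> 0 <= dq t)
  (dqE : forall t, 0 <= t <= T -> dq t * (1 + t) = p * q t) (q01 : q 0 = 1).
Hypotheses (Z0 : forall t, 0 <= t <= T -> 0 <= Z t)
  (XNZ : forall t, 0 <= t <= T -> X t ^+ 2 <= N t * Z t)
  (XBY : forall t, 0 <= t <= T -> X t ^+ 2 <= B t * Y t)
  (NB : forall t, 0 <= t <= T -> nu * B t <= N t).
Hypothesis small : forall t, 0 <= t <= T -> e * (2 * g * `|X t|) * q t <= d * B t.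

Let T00 : (0 : R) <= 0 <= T.
Proof. by apply/andP; split. Qed.

Let rho t := 2 * g * X t / B t.
Let V t := (Y t * B t - X t ^+ 2) / B t ^+ 2.
Let P t := e * (z t * V t) + N t / B t.

Let q0 t : 0 <= t <= T -> 0 < q t.
Proof. by move=> /q1; exact: lt_le_trans. Qed.

Let V0 t : 0 <= t <= T -> 0 <= V t.
Proof.
move=> tT; rewrite /V divr_ge0 ?exprn_ge0 ?(ltW (B0 tT))//.
by rewrite subr_ge0 mulrC XBY.
Qed.

Let dq1 t : 0 <= t <= T -> dq t <= 1.
Proof.
move=> tT; have t1 : 0 < 1 + t by case/andP: tT; lra.
rewrite -(ler_pM2r t1) dqE// mul1r (le_trans _ (qt tT))//.
by rewrite ger_pMl// q0.
Qed.

Let rho_small t : 0 <= t <= T -> `|e * rho t| * q t <= d.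
Proof.
move=> tT; have B1 := B0 tT.
have g2 : 0 < 2 * g by rewrite mulr_gt0.
have -> : e * rho t = e * (2 * g * X t) / B t by rewrite /rho mulrA.
rewrite normrM normfV (gtr0_norm B1) mulrAC ler_pdivrMr//.
rewrite normrM (gtr0_norm e0) normrM (gtr0_norm g2).
exact: small.
Qed.

Let rho_le k t : 0 <= t <= T -> 0 <= k -> k * d <= 1 -> e * k * rho t <= (q t)^-1 /\ - (q t)^-1 <= e * k * rho t.
Proof.
move=> tT k0 kd; have qp := q0 tT.
have : `|e * k * rho t| <= (q t)^-1.
  rewrite -[leRHS]mul1r ler_pdivlMr//.
  rewrite (mulrC e) -mulrA normrM (ger0_norm k0) -mulrA.
  by apply: le_trans kd; rewrite ler_wpM2l// rho_small.
by rewrite ler_norml => /andP[].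
Qed.

Let k1 : 0 <= 1 + 2 / g /\ (1 + 2 / g) * d <= 1.
Proof.
have ig : 0 < g^-1 by rewrite invr_gt0.
split; first by rewrite addr_ge0// divr_ge0// ltW.
by apply: le_trans dg; rewrite mulrC ler_pM2l//; lra.
Qed.

Let k2 : 0 <= 2 + g^-1 /\ (2 + g^-1) * d <= 1.
Proof.
have ig : 0 < g^-1 by rewrite invr_gt0.
split; first by rewrite addr_ge0// ltW.
by apply: le_trans dg; rewrite mulrC ler_pM2l//; lra.
Qed.

Let k3 : 2 * d <= 1.
Proof.
have ig : 0 < g^-1 by rewrite invr_gt0.
by apply: le_trans dg; rewrite mulrC ler_pM2l//; lra.
Qed.

Let zV0 t : 0 <= t <= T -> 0 <= z t * V t.
Proof. by move=> tT; exact: mulr_ge0 (ltW (z0 tT)) (V0 tT). Qed.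

Let dP t := - (z t * V t * (2 / q t + e * (1 + 2 / g) * rho t)).

Let hP t : 0 <= t <= T -> is_derive t (1:R) P (dP t).
Proof.
move=> tT; exact: (deriv_quotient (lt0r_neq0 e0) (lt0r_neq0 g0) (lt0r_neq0 (B0 tT))
  (lt0r_neq0 (z0 tT)) (lt0r_neq0 (q0 tT)) (hB tT) (hX tT) (hN tT) (hY tT) (hz tT)).
Qed.

Let dP_le t : 0 <= t <= T -> dP t <= - (z t * V t / q t).
Proof.
move=> tT; have [_] := rho_le tT k1.1 k1.2.
rewrite /dP lerN2 => h; rewrite (ler_wpM2l (zV0 tT))//; lra.
Qed.

(** Where eps |rho| q is small, the term 2 / q in its derivative wins over eps rho. *)
Lemma quotient_nonincreasing t : 0 <= t <= T -> P t <= P 0.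
Proof.
move=> /andP[t0 tT]; apply: (deriv_le0_ge (df := dP)) => // s.
- move=> /andP[s0 st]; have sT : 0 <= s <= T by rewrite s0 (le_trans st).
  exact: drv_cont (hP sT).
- move=> /andP[s0 st]; have sT : 0 <= s <= T by rewrite ltW// (le_trans (ltW st)).
  exact: hP.
- move=> /andP[s0 st]; have sT : 0 <= s <= T by rewrite ltW// (le_trans (ltW st)).
  apply: le_trans (dP_le sT) _; rewrite oppr_le0.
  exact: divr_ge0 (zV0 sT) (ltW (q0 sT)).
Qed.

Variable P0 : R.
Hypothesis PP0 : P 0 <= P0.

Lemma NB_bound t : 0 <= t <= T -> N t / B t <= P0.
Proof.
move=> tT; apply: le_trans PP0; apply: le_trans (quotient_nonincreasing tT).
by rewrite /P lerDr; exact: mulr_ge0 (ltW e0) (zV0 tT).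
Qed.

Let P0_ge0 : 0 < P0.
Proof.
apply: lt_le_trans (NB_bound T00); apply: lt_le_trans nu0 _.
by rewrite ler_pdivlMr ?B0// NB.
Qed.

Variable M : R.
Hypotheses (M4 : 4 * P0 <= M) (M0 : Z 0 * (z 0 ^+ 2) / B 0 <= M).

Let Q t := Z t * (z t ^+ 2 * (B t * q t ^+ 2)^-1).

Let drift_sq t : 0 <= t <= T -> (X t * z t / (B t * q t)) ^+ 2 <= P0 * Q t.
Proof.
move=> tT; have B1 := B0 tT; have q2 := q0 tT.
have -> : (X t * z t / (B t * q t)) ^+ 2 = X t ^+ 2 * (z t ^+ 2 * (B t * q t ^+ 2)^-1 / B t).
  by field; rewrite !gt_eqF.
apply: (@le_trans _ _ (N t / B t * Q t)).
  have -> : N t / B t * Q t = N t * Z t * (z t ^+ 2 * (B t * q t ^+ 2)^-1 / B t).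
    by rewrite /Q; field; rewrite !gt_eqF.
  by rewrite ler_wpM2r ?XNZ// divr_ge0 ?(ltW B1)// divr_ge0 ?sqr_ge0// mulr_ge0 ?sqr_ge0// ltW.
rewrite ler_wpM2r ?NB_bound// /Q mulr_ge0 ?Z0// divr_ge0 ?sqr_ge0// mulr_ge0 ?sqr_ge0//.
exact: ltW.
Qed.

(** If Q exceeds M >= 4 P0, the forcing X z / (B q), whose square is at most P0 Q, is at
    most Q / 2, and the damping makes Q decrease. *)
Lemma velocity_bound t : 0 <= t <= T -> Q t <= M.
Proof.
move=> /andP[t0 tT].
have sub s : 0 < s < t -> 0 <= s <= T.
  by move=> /andP[s0 st]; rewrite ltW// (le_trans (ltW st)).
have hQ s : 0 <= s <= T -> is_derive s (1:R) Q _ := fun sT => 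
  deriv_velocity (lt0r_neq0 e0) (lt0r_neq0 g0) (lt0r_neq0 (B0 sT)) (lt0r_neq0 (z0 sT))
    (lt0r_neq0 (q0 sT)) (hB sT) (hZ sT) (hz sT) (hq sT).
rewrite -subr_le0.
apply: (barrier (f := fun s => Q s - M) t0).
- move=> s /andP[s0 st]; have sT : 0 <= s <= T by rewrite s0 (le_trans st).
  exact: drv_cont (drvD (hQ s sT) (drvC (- M) s)).
- by move=> s /sub sT; exact: drvD (hQ s sT) (drvC (- M) s).
- by rewrite subr_le0 /Q q01 expr1n mulr1 mulrA.
- move=> s /sub sT; rewrite subr_gt0 addr0 => MQ.
  have Qp : 4 * P0 <= Q s by apply: le_trans M4 (ltW MQ).
  (* the square of the forcing is at most P0 Q, hence at most (Q / 2)^2 *)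
  have drift : `|X s * z s / (B s * q s)| <= Q s / 2.
    rewrite -(@ler_pXn2r _ 2)// ?nnegrE ?divr_ge0 ?normr_ge0//; last by move: P0_ge0; lra.
    rewrite real_normK ?num_real//; apply: le_trans (drift_sq sT) _.
    by rewrite exprMn; move: P0_ge0; nra.
  rewrite ler_pdivrMl// mulr0 /Q -[in X in X * (_ - _ - _)]mulrA -/(Q s).
  have [_ h2] := rho_le sT k2.1 k2.2.
  move: drift; rewrite ler_norml => /andP[dr _].
  have qi : 0 < (q s)^-1 by rewrite invr_gt0 q0.
  have dqs := dq0 sT.
  have Qs : 0 < Q s by move: P0_ge0; lra.
  have h3 : 0 <= 2 * e * dq s / q s by rewrite !mulr_ge0 ?(ltW e0)// ltW.
  apply: (@le_trans _ _ (Q s * (- (q s)^-1) + Q s * (q s)^-1)); last by rewrite mulrN addNr.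
  apply: lerD.
    by rewrite ler_pM2l//; move: h2; rewrite /rho; lra.
  have -> : - (2 * (X s * z s / (B s * q s)) / q s) = (- (2 * (X s * z s / (B s * q s)))) / q s by rewrite mulNr.
  by rewrite ler_pM2r//; lra.
Qed.

Let Kr := 2 * g * (P0 + M).

Let M_gt0 : 0 < M.
Proof. by move: P0_ge0 M4; lra. Qed.

Let Kr0 : 0 < Kr.
Proof. by rewrite /Kr mulr_gt0 ?mulr_gt0// addr_gt0. Qed.

(** The square of X z / (B q) is at most P0 Q, and Q is bounded. *)
Lemma rate_bound t : 0 <= t <= T -> `|rho t| * z t <= Kr * q t.
Proof.
move=> tT; have B1 := B0 tT; have q2 := q0 tT; have z1 := z0 tT.
have g2 : 0 < 2 * g by rewrite mulr_gt0.
have h : `|X t * z t / (B t * q t)| <= P0 + M.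
  rewrite -(@ler_pXn2r _ 2)// ?nnegrE ?normr_ge0//; last by rewrite addr_ge0// ltW.
  rewrite real_normK ?num_real//; apply: le_trans (drift_sq tT) _.
  apply: (@le_trans _ _ (P0 * M)); first by rewrite ler_pM2l// velocity_bound.
  by move: P0_ge0 M_gt0; nra.
have -> : `|rho t| * z t = 2 * g * `|X t * z t / (B t * q t)| * q t.
  rewrite -[X in _ * X = _](gtr0_norm z1) -normrM.
  have -> : rho t * z t = 2 * g * (X t * z t / (B t * q t)) * q t.
    by rewrite /rho; field; rewrite !gt_eqF.
  by rewrite normrM (gtr0_norm q2) normrM (gtr0_norm g2).
by rewrite ler_pM2r// /Kr ler_pM2l.
Qed.

Let Phi t := z t - e * (2 * g * (X t * (B t)^-1 * (z t * q t))).
Let dPhi t := 2 * g * (N t / B t) * q t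
   - 2 * g * e * V t * z t * q t
   + e * rho t ^+ 2 * z t * q t * (1 + (2 * g)^-1) - e * rho t * z t * dq t.

Let hPhi t : 0 <= t <= T -> is_derive t (1:R) Phi (dPhi t).
Proof.
move=> tT; exact: (deriv_phi (lt0r_neq0 e0) (lt0r_neq0 g0) (lt0r_neq0 (B0 tT))
  (lt0r_neq0 (z0 tT)) (lt0r_neq0 (q0 tT)) (hB tT) (hX tT) (hz tT) (hq tT)).
Qed.

Let Phi_near t : 0 <= t <= T -> `|z t - Phi t| <= d * z t.
Proof.
move=> tT.
have -> : z t - Phi t = (e * rho t * q t) * z t.
  by rewrite /Phi /rho; field; rewrite gt_eqF// B0.
rewrite normrM (gtr0_norm (z0 tT)) ler_pM2r ?z0//.
by rewrite normrM (gtr0_norm (q0 tT)) rho_small.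
Qed.

Let rate_dq t : 0 <= t <= T -> `|e * rho t * z t * dq t| <= e * Kr * q t.
Proof.
move=> tT; have -> : e * rho t * z t * dq t = e * (rho t * z t * dq t) by rewrite !mulrA.
rewrite -[leRHS]mulrA normrM (gtr0_norm e0) ler_pM2l// 2!normrM.
rewrite (gtr0_norm (z0 tT)) (ger0_norm (dq0 tT)).
apply: (@le_trans _ _ (Kr * q t * 1)); last by rewrite mulr1.
exact: ler_pM (mulr_ge0 (normr_ge0 _) (ltW (z0 tT))) (dq0 tT) (rate_bound tT) (dq1 tT).
Qed.

Let hw t : 0 <= t <= T -> is_derive t (1:R) (fun s => (1 + s) * q s) ((1 + p) * q t).
Proof.
move=> tT.
apply: is_derive_eq (drvM (drvD (drvC 1 t) (is_derive_id t 1)) (hq tT)) _ => /=.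
by rewrite [X in X + _]mulrC dqE//; ring.
Qed.

Variables (zlo zhi kap K2 : R).
Hypotheses (zl : zlo <= z 0) (zh : z 0 <= zhi).
Hypotheses (e1 : e * (Kr + 4 * g * P0) <= g * nu) (e2 : e * (Kr + 2 * g * P0) <= zlo / 2) (e3 : e <= 1).
Hypotheses (kap1 : 3 * kap <= zlo) (kap2 : 3 * kap <= g * nu).
Hypothesis K2E : 2 * g * P0 + Kr * (1 + (2 * g)^-1) + Kr <= K2.

Let gi0 : 0 <= 1 + (2 * g)^-1.
Proof. by rewrite addr_ge0// invr_ge0 mulr_ge0// ltW. Qed.

(** The function Phi = z - eps rho z q is within d z of z. Subtracting in
    addition a multiple of eps P q^2 absorbs the term of its derivative that has the wrong sign, and
    leaves a derivative of at least g nu q, which has to be compared with that of (1 + t) q. *)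
Lemma inverse_stiffness_lower t : 0 <= t <= T -> kap * ((1 + t) * q t) <= z t.
Proof.
move=> /[dup] tT /andP[t0 t1].
(* the derivative of P q^2 is at most - z V q + 2 P0 q, which absorbs the term - 2 g e V z q *)
pose Psi s := Phi s - 2 * g * e * (P s * q s ^+ 2).
have hPsi s : 0 <= s <= T -> is_derive s (1:R) (fun s => Psi s - g * nu / 2 * ((1 + s) * q s)) _ := fun sT =>
  drvD (drvD (hPhi sT) (drvN (drvM (drvC (2 * g * e) s) (drvM (hP sT) (drvX 2 (hq sT))))))
    (drvN (drvM (drvC (g * nu / 2) s) (hw sT))).
have sub s : 0 < s < t -> 0 <= s <= T.
  by move=> /andP[s0 st]; rewrite ltW// (le_trans (ltW st)).
have mon : Psi 0 - g * nu / 2 * ((1 + 0) * q 0) <= Psi t - g * nu / 2 * ((1 + t) * q t).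
  apply: (deriv_ge0_le (f := fun s => Psi s - g * nu / 2 * ((1 + s) * q s)) t0) => [s /andP[s0 st]|s /sub sT|s /sub sT].
  - have sT : 0 <= s <= T by rewrite s0 (le_trans st).
    exact: drv_cont (hPsi s sT).
  - exact: hPsi.
  - cbv beta; rewrite !mulr0 !addr0.
    have H1 := dP_le sT; have H2 := rate_dq sT; have qs := q0 sT.
    have H3 : nu <= N s / B s by rewrite ler_pdivlMr ?B0// NB.
    have H4 := dq1 sT; have H5 := quotient_nonincreasing sT.
    have H6 := dq0 sT.
    have P1 : 0 <= P s.
      apply: addr_ge0 (mulr_ge0 (ltW e0) (zV0 sT)) _.
      by apply: le_trans H3; rewrite ltW.
    have H7 : P s * dq s <= P0.
      by apply: le_trans (le_trans H5 PP0); rewrite -[leRHS]mulr1 ler_wpM2l.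
    have H8 : dP s * q s ^+ 2 <= - (V s * z s * q s).
      have -> : - (V s * z s * q s) = - (z s * V s / q s) * q s ^+ 2.
        by field; rewrite gt_eqF.
      by rewrite ler_wpM2r// sqr_ge0.
    have H9 : 0 <= e * rho s ^+ 2 * z s * q s * (1 + (2 * g)^-1).
      apply: mulr_ge0 gi0; apply: mulr_ge0 (ltW qs).
      by apply: mulr_ge0 (ltW (z0 sT)); rewrite mulr_ge0 ?sqr_ge0// ltW.
    move: H2; rewrite ler_norml => /andP[_ H2].
    have ge0 : 0 < g * e by rewrite mulr_gt0.
    have gq : 0 < g * e * q s by rewrite mulr_gt0.
    have H10 : 2 * g * e * (dP s * q s ^+ 2) <= - (2 * g * e * V s * z s * q s).
      have -> : - (2 * g * e * V s * z s * q s) = 2 * g * e * - (V s * z s * q s) by ring.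
      by rewrite ler_wpM2l// -mulrA mulr_ge0// ltW.
    have H11 : 4 * (g * e * q s) * (P s * dq s) <= 4 * (g * e * q s) * P0.
      by rewrite ler_wpM2l// mulr_ge0// ltW.
    have H12 : 2 * g * q s * nu <= 2 * g * (N s / B s) * q s.
      rewrite mulrAC ler_wpM2r ?(ltW qs)// ler_wpM2l// mulr_ge0// ltW//.
    have H13 : e * (Kr + 4 * g * P0) * q s <= g * nu * q s by rewrite ler_wpM2r// ltW.
    have H14 : (g * nu * q s) * p <= g * nu * q s * 1.
      by rewrite ler_wpM2l// !mulr_ge0// ltW.
    rewrite /dPhi expr1.
    lra.
have Psi0 : zlo / 2 <= Psi 0.
  rewrite /Psi q01 expr1n mulr1.
  have H : e * (rho 0 * z 0) <= e * Kr.
    rewrite ler_wpM2l ?(ltW e0)//.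
    apply: le_trans (_ : `|rho 0| * z 0 <= _); first by rewrite ler_wpM2r ?ler_norm// ltW// z0.
    by have := rate_bound T00; rewrite q01 mulr1.
  have -> : Phi 0 = z 0 - e * (rho 0 * z 0).
    by rewrite /Phi /rho q01; field; rewrite gt_eqF// B0.
  have H' : 2 * g * e * P 0 <= 2 * g * e * P0 by rewrite ler_wpM2l// !mulr_ge0// ltW.
  have A : e * (rho 0 * z 0) + 2 * g * e * P 0 <= zlo / 2.
    apply: le_trans (lerD H H') _; apply: le_trans e2.
    by rewrite le_eqVlt; apply/orP; left; apply/eqP; ring.
  by move: A zl; move: (e * (rho 0 * z 0)) (2 * g * e * P 0) (z 0) => a b c; lra.
have H1 : Psi t <= Phi t.
  rewrite /Psi gerBl; apply: mulr_ge0; first by rewrite !mulr_ge0// ltW.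
  apply: mulr_ge0 (sqr_ge0 _).
  apply: addr_ge0 (mulr_ge0 (ltW e0) (zV0 tT)) _; apply: ltW.
  by apply: lt_le_trans nu0 _; rewrite ler_pdivlMr ?B0// NB.
have := Phi_near tT; rewrite ler_norml => /andP[H2 _].
have H3 : d * z t * 2 <= z t by have := z0 tT; move: k3; nra.
have H4 : 1 <= (1 + t) * q t by have := q1 tT; nra.
have H5 : 3 * kap * ((1 + t) * q t - 1) <= g * nu * ((1 + t) * q t - 1).
  by rewrite ler_wpM2r ?subr_ge0.
rewrite q01 addr0 mulr1 in mon.
move: mon Psi0 H1 H2 H3 H4 H5 kap1.
move: (Psi 0) (Psi t) (Phi t) (z t) ((1 + t) * q t) => a b c y w.
lra.
Qed.

(** Here the negative term of the derivative of Phi can be dropped, and N / B <= P0 bounds the rest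
    by K2 q. *)
Lemma inverse_stiffness_upper t : 0 <= t <= T -> z t <= (4 * zhi + 2 * K2) * ((1 + t) * q t).
Proof.
move=> /[dup] tT /andP[t0 t1].
have K20 : 0 <= K2.
  apply: le_trans K2E; apply: addr_ge0 (ltW Kr0).
  by apply: addr_ge0 (mulr_ge0 (ltW Kr0) gi0); rewrite !mulr_ge0// ltW.
have hf s : 0 <= s <= T -> is_derive s (1:R) (fun s => Phi s - K2 * ((1 + s) * q s)) _ := fun sT =>
  drvD (hPhi sT) (drvN (drvM (drvC K2 s) (hw sT))).
have sub s : 0 < s < t -> 0 <= s <= T.
  by move=> /andP[s0 st]; rewrite ltW// (le_trans (ltW st)).
have mon : Phi t - K2 * ((1 + t) * q t) <= Phi 0 - K2 * ((1 + 0) * q 0).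
  apply: (deriv_le0_ge (f := fun s => Phi s - K2 * ((1 + s) * q s)) t0) => [s /andP[s0 st]|s /sub sT|s /sub sT].
  - have sT : 0 <= s <= T by rewrite s0 (le_trans st).
    exact: drv_cont (hf s sT).
  - exact: hf.
  - cbv beta; rewrite !mulr0 !addr0 /dPhi.
    have := rate_dq sT; rewrite ler_norml => /andP[H2 _].
    have qs := q0 sT.
    have H3 : 2 * g * (N s / B s) * q s <= 2 * g * P0 * q s.
      by rewrite ler_wpM2r ?(ltW qs)// ler_wpM2l ?NB_bound// mulr_ge0// ltW.
    have H4 : e * rho s ^+ 2 * z s * q s <= Kr * q s.
      have -> : e * rho s ^+ 2 * z s * q s = (e * rho s) * q s * (rho s * z s) by ring.
      apply: le_trans (ler_norm _) _; rewrite normrM.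
      rewrite -[leRHS]mul1r ler_pM//.
        rewrite normrM (gtr0_norm qs); apply: le_trans (rho_small sT) _.
        by move: k3 d0; lra.
      by rewrite normrM (gtr0_norm (z0 sT)) rate_bound.
    have H5 : e * rho s ^+ 2 * z s * q s * (1 + (2 * g)^-1) <= Kr * q s * (1 + (2 * g)^-1).
      by rewrite (ler_wpM2r gi0).
    have H6 : e * Kr * q s <= Kr * q s.
      by rewrite ler_wpM2r ?(ltW qs)// ger_pMl.
    have H7 : 0 <= 2 * g * e * V s * z s * q s.
      have -> : 2 * g * e * V s * z s * q s = 2 * g * e * (z s * V s) * q s by ring.
      by apply: mulr_ge0 (ltW qs); apply: mulr_ge0 (zV0 sT); rewrite !mulr_ge0// ltW.
    have H8 : (2 * g * P0 + Kr * (1 + (2 * g)^-1) + Kr) * q s <= K2 * q s.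
      by rewrite ler_wpM2r ?(ltW qs).
    have H9 : 0 <= K2 * (p * q s) by rewrite !mulr_ge0// ltW.
    lra.
have H3 : d * z t * 2 <= z t by have := z0 tT; move: k3; nra.
have H30 : d * z 0 * 2 <= z 0 by have := z0 T00; move: k3; nra.
have := Phi_near tT; rewrite ler_norml => /andP[_ H2].
have := Phi_near T00; rewrite ler_norml => /andP[H20 _].
have H4 : 1 <= (1 + t) * q t by have := q1 tT; nra.
have z00 := z0 T00.
rewrite q01 addr0 mulr1 in mon.
move: mon zh z00 H2 H20 H3 H30 H4 K20.
move: (Phi 0) (Phi t) (z 0) (z t) ((1 + t) * q t) => a b c y w.
nra.
Qed.
End Region.

(** * A priori estimates *)

Section Weights.
Variables (R : realType) (p : R).
Hypotheses (p0 : 0 <= p) (p1 : p <= 1).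
Implicit Types t : R.

Lemma drag_ge1 t : 0 <= t -> 1 <= (1 + t) `^ p.
Proof.
move=> t0; rewrite -[leLHS](powRr0 (1 + t)); apply: ler_powR => //; lra.
Qed.

Lemma drag_le t : 0 <= t -> (1 + t) `^ p <= 1 + t.
Proof. by move=> t0; apply: ler1_powR => //; lra. Qed.

Lemma drag0 : (1 + 0 : R) `^ p = 1.
Proof. by rewrite addr0 powR1. Qed.

Lemma deriv_drag t : 0 <= t ->
  is_derive t (1:R) (fun s => (1 + s) `^ p) (p * (1 + t) `^ (p - 1)).
Proof.
move=> t0; have t1 : 0 < 1 + t by lra.
apply: is_derive_eq (drvpow p t1 (drvD (drvC 1 t) (is_derive_id t 1))) _.
by rewrite add0r mulr1.
Qed.

Lemma drag_derivE t : 0 <= t ->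
  p * (1 + t) `^ (p - 1) * (1 + t) = p * (1 + t) `^ p.
Proof.
move=> t0; have t1 : 0 < 1 + t by lra.
rewrite -mulrA; congr (_ * _).
by rewrite powRB ?(gt_eqF t1) ?implybT// powRr1 ?divfK ?gt_eqF// ltW.
Qed.

Lemma weightE g t : 0 < g -> 0 <= t ->
  (1 + t) `^ ((p + 1) / g) = ((1 + t) * (1 + t) `^ p) `^ g^-1.
Proof.
move=> g0 t0; have t1 : 0 < 1 + t by lra.
rewrite powRrM; congr (_ `^ _).
by rewrite powRD ?(gt_eqF t1) ?implybT// powRr1 ?(ltW t1)// mulrC.
Qed.

Lemma weight_ge1 g t : 0 < g -> 0 <= t -> 1 <= (1 + t) `^ ((p + 1) / g).
Proof.
move=> g0 t0; rewrite -[leLHS](powRr0 (1 + t)); apply: ler_powR; first lra.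
exact: divr_ge0 (addr_ge0 p0 ler01) (ltW g0).
Qed.

(** The weight (1 + t)^((p+1)/g) of B corresponds to the weight (1 + t) q of z. *)
Lemma weighted_powE g t b : 0 < g -> 0 <= t -> 0 <= b ->
  b * (1 + t) `^ ((p + 1) / g) = (b `^ g * ((1 + t) * (1 + t) `^ p)) `^ g^-1.
Proof.
move=> g0 t0 b0; rewrite weightE// [RHS]powRM ?powR_ge0//; last first.
  by rewrite mulr_ge0 ?powR_ge0//; lra.
by rewrite -powRrM divff ?gt_eqF// powRr1.
Qed.
End Weights.

(** The scalar quantities attached to a solution of the equation with
    stiffness c: for an operator S with square A, they are B = |S u|^2, X = <A u, u'>,
    N = |A u|^2, Y = |S u'|^2, Z = |u'|^2 and W = <A u, A u'>. The stiffness is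
    kept abstract because the approximate equation has a clamped one. *)
Record kirchhoff_energies (R : realType) (p nu e : R) (B X N Y Z W c : R -> R) :
    Prop := {
  stretch_deriv : forall t : R, 0 <= t -> is_derive t (1:R) B (2 * X t);
  power_deriv : forall t : R, 0 <= t ->
    is_derive t (1:R) X ((e * Y t - X t / (1 + t) `^ p - c t * N t) / e);
  bending_deriv : forall t : R, 0 <= t -> is_derive t (1:R) N (2 * W t);
  kinetic1_deriv : forall t : R, 0 <= t ->
    is_derive t (1:R) Y (- (2 / e) * (Y t / (1 + t) `^ p + c t * W t));
  kinetic_deriv : forall t : R, 0 <= t ->
    is_derive t (1:R) Z (- (2 / e) * (Z t / (1 + t) `^ p + c t * X t));
  kinetic_ge0 : forall t : R, 0 <= t -> 0 <= Z t;
  power_bending : forall t : R, 0 <= t -> X t ^+ 2 <= N t * Z t;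
  power_stretch : forall t : R, 0 <= t -> X t ^+ 2 <= B t * Y t;
  bending_coercive : forall t : R, 0 <= t -> nu * B t <= N t
}.

Section Apriori.
Variables (R : realType) (g p nu Blo Bhi Y0 N0 Z0 : R).
Hypotheses (g0 : 0 < g) (p0 : 0 <= p) (p1 : p <= 1) (nu0 : 0 < nu).
Hypotheses (Blo0 : 0 < Blo) (Blohi : Blo <= Bhi).
Hypotheses (Y00 : 0 <= Y0) (N00 : 0 <= N0) (Z00 : 0 <= Z0).

Let zlo := (Bhi `^ g)^-1.
Let zhi := (Blo `^ g)^-1.
Let P0 := (zhi * Y0 + N0) / Blo.
Let M := 4 * P0 + Z0 * zhi ^+ 2 / Blo.
Let d := (2 + 2 / g)^-1.
Let Kr := 2 * g * (P0 + M).
(* harmonic, so as to be below both zlo / 3 and g nu / 3 *)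
Let kap := (zlo^-1 + (g * nu)^-1)^-1 / 3.
Let K2 := 2 * g * P0 + Kr * (1 + (2 * g)^-1) + Kr.
Let K := 4 * zhi + 2 * K2.
Let C1 := K^-1 `^ g^-1.
Let C2 := kap^-1 `^ g^-1.
(* each summand enforces one of the five smallness conditions of e0_terms *)
Let e0 := (1 + (Kr + 4 * g * P0) / (g * nu) + (Kr + 2 * g * P0) / (zlo / 2)
  + Kr / (kap * (d / 2)) + 2 * g * (N0 + Z0) / (d * Blo))^-1.

Let Bhi0 : 0 < Bhi. Proof. exact: lt_le_trans Blohi. Qed.
Let zlo0 : 0 < zlo. Proof. by rewrite invr_gt0 powR_gt0. Qed.
Let zhi0 : 0 < zhi. Proof. by rewrite invr_gt0 powR_gt0. Qed.
Let P00 : 0 <= P0.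
Proof. exact: divr_ge0 (addr_ge0 (mulr_ge0 (ltW zhi0) Y00) N00) (ltW Blo0). Qed.
Let M0 : 0 <= M.
Proof.
apply: addr_ge0; first exact: mulr_ge0.
exact: divr_ge0 (mulr_ge0 Z00 (sqr_ge0 _)) (ltW Blo0).
Qed.
Let d0 : 0 < d.
Proof. rewrite invr_gt0; have := divr_gt0 (ltr0n R 2 : _) g0. lra. Qed.
Let Kr0 : 0 <= Kr.
Proof. exact: mulr_ge0 (mulr_ge0 (ler0n _ _) (ltW g0)) (addr_ge0 P00 M0). Qed.
Let gnu : 0 < g * nu. Proof. exact: mulr_gt0. Qed.
Let kap0 : 0 < kap.
Proof.
have a : 0 < zlo^-1 by rewrite invr_gt0.
have b : 0 < (g * nu)^-1 by rewrite invr_gt0.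
by apply: divr_gt0; rewrite ?ltr0n// invr_gt0 addr_gt0.
Qed.
Let kap1 : 3 * kap <= zlo.
Proof.
have a : 0 < zlo^-1 by rewrite invr_gt0.
have b : 0 < (g * nu)^-1 by rewrite invr_gt0.
rewrite /kap mulrC divfK// -[leRHS]invrK lef_pV2 ?posrE ?addr_gt0//.
by rewrite lerDl ltW.
Qed.
Let kap2 : 3 * kap <= g * nu.
Proof.
have a : 0 < zlo^-1 by rewrite invr_gt0.
have b : 0 < (g * nu)^-1 by rewrite invr_gt0.
rewrite /kap mulrC divfK// -[leRHS]invrK lef_pV2 ?posrE ?addr_gt0//.
by rewrite lerDr ltW.
Qed.
Let K20 : 0 <= K2.
Proof.
apply: addr_ge0 Kr0; apply: addr_ge0.
  exact: mulr_ge0 (mulr_ge0 (ler0n _ _) (ltW g0)) P00.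
by apply: mulr_ge0 Kr0 _; rewrite addr_ge0// invr_ge0 mulr_ge0// ltW.
Qed.
Let K0 : 0 < K.
Proof. by apply: ltr_wpDr; [exact: mulr_ge0|exact: mulr_gt0]. Qed.
Let C10 : 0 < C1. Proof. by rewrite powR_gt0// invr_gt0. Qed.
Let C20 : 0 < C2. Proof. by rewrite powR_gt0// invr_gt0. Qed.

Let e0_summands : [/\ 0 <= (Kr + 4 * g * P0) / (g * nu),
  0 <= (Kr + 2 * g * P0) / (zlo / 2), 0 <= Kr / (kap * (d / 2))
  & 0 <= 2 * g * (N0 + Z0) / (d * Blo)].
Proof.
have g20 : 0 <= 2 * g by rewrite mulr_ge0// ltW.
have g40 : 0 <= 4 * g by rewrite mulr_ge0// ltW.
split.
- exact: divr_ge0 (addr_ge0 Kr0 (mulr_ge0 g40 P00)) (ltW gnu).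
- by apply: divr_ge0 (addr_ge0 Kr0 (mulr_ge0 g20 P00)) _; rewrite divr_ge0 ?(ltW zlo0).
- by apply: divr_ge0 Kr0 _; rewrite mulr_ge0 ?(ltW kap0)// divr_ge0 ?(ltW d0).
- exact: divr_ge0 (mulr_ge0 g20 (addr_ge0 N00 Z00)) (mulr_ge0 (ltW d0) (ltW Blo0)).
Qed.

Let e0_gt0 : 0 < e0.
Proof.
have [a1 a2 a3 a4] := e0_summands.
by rewrite invr_gt0; do 4! (apply: ltr_wpDr => //).
Qed.

Let e0_terms e : 0 < e -> e < e0 ->
  [/\ e <= 1, e * (Kr + 4 * g * P0) <= g * nu,
      e * (Kr + 2 * g * P0) <= zlo / 2, e * Kr <= kap * (d / 2)
    & e * (2 * g * (N0 + Z0)) <= d * Blo].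
Proof.
move=> e0p; have [a1 a2 a3 a4] := e0_summands.
have z2 : 0 < zlo / 2 by rewrite divr_gt0.
have kd : 0 < kap * (d / 2) by rewrite mulr_gt0// divr_gt0.
have dB : 0 < d * Blo by exact: mulr_gt0.
rewrite -[X in X < _]invrK ltf_pV2 ?posrE ?invr_gt0//; last first.
  by do 4! (apply: ltr_wpDr => //).
move=> /ltW h.
have key a b : 0 < b -> a / b <= e^-1 -> e * a <= b.
  by move=> b0; rewrite ler_pdivrMr// mulrC ler_pdivlMr// mulrC.
split; last 4 first.
- by apply: key => //; lra.
- by apply: key => //; lra.
- by apply: key => //; lra.
- by apply: key => //; lra.
by rewrite -[e]mulr1; apply: key => //; rewrite divr1; lra.
Qed.

Section Trajectory.
Implicit Types t T : R.
Variables (e : R) (B X N Y Z W c : R -> R).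
Hypotheses (e_gt0 : 0 < e) (e_lt : e < e0).
Let q t : R := (1 + t) `^ p.
Let w t : R := (1 + t) `^ ((p + 1) / g).
Hypothesis hB : forall t, 0 <= t -> is_derive t (1:R) B (2 * X t).
Hypothesis hX : forall t, 0 <= t ->
  is_derive t (1:R) X ((e * Y t - X t / q t - c t * N t) / e).
Hypothesis hN : forall t, 0 <= t -> is_derive t (1:R) N (2 * W t).
Hypothesis hY : forall t, 0 <= t ->
  is_derive t (1:R) Y (- (2 / e) * (Y t / q t + c t * W t)).
Hypothesis hZ : forall t, 0 <= t ->
  is_derive t (1:R) Z (- (2 / e) * (Z t / q t + c t * X t)).
Hypotheses (Zp : forall t, 0 <= t -> 0 <= Z t)
  (XNZ : forall t, 0 <= t -> X t ^+ 2 <= N t * Z t)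
  (XBY : forall t, 0 <= t -> X t ^+ 2 <= B t * Y t)
  (NB : forall t, 0 <= t -> nu * B t <= N t).
Hypotheses (Bl : Blo <= B 0) (Bh : B 0 <= Bhi) (Yi : Y 0 <= Y0) (Ni : N 0 <= N0)
  (Zi : Z 0 <= Z0).
Hypothesis cE : forall t, 0 <= t -> C1 / 2 <= B t * w t -> B t <= 2 * C2 ->
  c t = B t `^ g.

Let w0 t : 0 <= t -> 0 < w t.
Proof. by move=> t0; apply: powR_gt0; lra. Qed.

Let w1 t : 0 <= t -> 1 <= w t.
Proof. by move=> t0; exact: weight_ge1. Qed.

Let good T := forall t, 0 <= t <= T ->
  [/\ C1 / 2 <= B t * w t, B t <= 2 * C2 & e * (2 * g * `|X t|) * q t <= d * B t].

Let initial_z : zlo <= B 0 `^ (- g) <= zhi.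
Proof.
have B00 : 0 < B 0 by exact: lt_le_trans Bl.
rewrite powRN !lef_pV2 ?posrE ?powR_gt0//.
have pw := ge0_ler_powR (ltW g0).
by apply/andP; split; apply: pw => //; rewrite nnegrE ltW.
Qed.

Let good_estimates T : 0 <= T -> good T ->
  [/\ C1 <= B T * w T, B T * w T <= C2, N T <= P0 * B T,
      Z T * (1 + T) ^+ 2 <= M / kap ^+ 2 * B T
    & e * (2 * g * `|X T|) * q T <= d / 2 * B T].
Proof.
move=> T0 hgood.
pose z t := B t `^ (- g).
have Bp t : 0 <= t <= T -> 0 < B t.
  move=> /[dup] /andP[t0 _] /hgood[+ _ _].
  rewrite -(ltr_pM2r (w0 t0)) mul0r; apply: lt_le_trans.
  by rewrite divr_gt0.
have zp t : 0 <= t <= T -> 0 < z t by move=> /Bp; exact: powR_gt0.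
have zV t : (z t)^-1 = B t `^ g by rewrite /z powRN invrK.
have cz t : 0 <= t <= T -> c t = (z t)^-1.
  by move=> /[dup] /andP[t0 _] /hgood[? ? _]; rewrite zV cE.
have hz t : 0 <= t <= T -> is_derive t (1:R) z (- (2 * g * X t / B t) * z t).
  move=> /[dup] tT /andP[t0 _]; apply: is_derive_eq (drvpow (- g) (Bp _ tT) (hB t0)) _.
  rewrite powRB ?(gt_eqF (Bp _ tT)) ?implybT// powRr1 ?(ltW (Bp _ tT))//.
  by rewrite -/(z t); field; rewrite gt_eqF ?Bp.
have pos t : 0 <= t <= T -> 0 <= t by case/andP.
have [e1 e2 e3 e4 _] := e0_terms e_gt0 e_lt.
have dg : d * (2 + 2 / g) <= 1.
  by rewrite mulVf// gt_eqF// -invr_gt0.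
have hX' t : 0 <= t <= T -> is_derive t (1:R) X ((e * Y t - X t / q t - N t / z t) / e).
  by move=> tT; rewrite (mulrC (N t)) -cz//; exact: hX (pos _ tT).
have hY' t : 0 <= t <= T -> is_derive t (1:R) Y (- (2 / e) * (Y t / q t + W t / z t)).
  by move=> tT; rewrite (mulrC (W t)) -cz//; exact: hY (pos _ tT).
have hZ' t : 0 <= t <= T -> is_derive t (1:R) Z (- (2 / e) * (Z t / q t + X t / z t)).
  by move=> tT; rewrite (mulrC (X t)) -cz//; exact: hZ (pos _ tT).
have hB' t (tT : 0 <= t <= T) := hB (pos _ tT).
have hN' t (tT : 0 <= t <= T) := hN (pos _ tT).
have hq' t (tT : 0 <= t <= T) := deriv_drag p (pos _ tT).
have q1' t (tT : 0 <= t <= T) := drag_ge1 p0 (pos _ tT).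
have qt' t (tT : 0 <= t <= T) := drag_le p1 (pos _ tT).
have dqE t (tT : 0 <= t <= T) := drag_derivE p (pos _ tT).
have dq0 t : 0 <= t <= T -> 0 <= p * (1 + t) `^ (p - 1).
  by move=> _; rewrite mulr_ge0// powR_ge0.
have Zp' t (tT : 0 <= t <= T) := Zp (pos _ tT).
have XNZ' t (tT : 0 <= t <= T) := XNZ (pos _ tT).
have XBY' t (tT : 0 <= t <= T) := XBY (pos _ tT).
have NB' t (tT : 0 <= t <= T) := NB (pos _ tT).
have small t : 0 <= t <= T -> e * (2 * g * `|X t|) * q t <= d * B t by case/hgood.
have /andP[zl zh] := initial_z.
have T00 : (0 : R) <= 0 <= T by apply/andP; split.
have TT : 0 <= T <= T by apply/andP; split.
have B00 : 0 < B 0 by exact: Bp.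
have PP0 : e * (z 0 * ((Y 0 * B 0 - X 0 ^+ 2) / B 0 ^+ 2)) + N 0 / B 0 <= P0.
  rewrite /P0 [leRHS]mulrDl; apply: lerD; last first.
    apply: ler_pM => //; rewrite ?invr_ge0 ?(ltW B00) ?lef_pV2 ?posrE//.
    exact: le_trans (mulr_ge0 (ltW nu0) (ltW B00)) (NB' _ T00).
  have V1 : (Y 0 * B 0 - X 0 ^+ 2) / B 0 ^+ 2 <= Y0 / Blo.
    apply: (@le_trans _ _ (Y 0 / B 0)).
      rewrite ler_pdivrMr ?exprn_gt0//.
      have -> : Y 0 / B 0 * B 0 ^+ 2 = Y 0 * B 0 by field; rewrite gt_eqF.
      by rewrite gerBl sqr_ge0.
    apply: ler_pM => //; rewrite ?invr_ge0 ?(ltW B00) ?lef_pV2 ?posrE//.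
    rewrite -(ler_pM2l B00) mulr0; exact: le_trans (sqr_ge0 _) (XBY' _ T00).
  have V0 : 0 <= (Y 0 * B 0 - X 0 ^+ 2) / B 0 ^+ 2.
    by rewrite divr_ge0 ?sqr_ge0// subr_ge0 mulrC XBY'.
  rewrite -mulrA -[leRHS]mul1r ler_pM ?(ltW e_gt0)//.
    exact: mulr_ge0 (ltW (zp _ T00)) V0.
  exact: ler_pM (ltW (zp _ T00)) V0 zh V1.
have M4 : 4 * P0 <= M.
  rewrite lerDl; exact: divr_ge0 (mulr_ge0 Z00 (sqr_ge0 _)) (ltW Blo0).
have MM : Z 0 * z 0 ^+ 2 / B 0 <= M.
  apply: (@le_trans _ _ (Z0 * zhi ^+ 2 / Blo)); last by rewrite lerDr mulr_ge0.
  have zz : z 0 ^+ 2 <= zhi ^+ 2 by rewrite ler_pXn2r ?nnegrE ?(ltW zhi0) ?(ltW (zp _ T00)).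
  apply: ler_pM; rewrite ?invr_ge0 ?(ltW B00) ?lef_pV2 ?posrE//.
    by rewrite mulr_ge0 ?Zp' ?sqr_ge0.
  by rewrite ler_pM ?Zp' ?sqr_ge0.
have K2E : 2 * g * P0 + Kr * (1 + (2 * g)^-1) + Kr <= K2 by [].
have lower := inverse_stiffness_lower e_gt0 g0 nu0 T0 p1 d0 dg hB' hX' hN' hY' hZ' hz
  hq' Bp zp q1' qt' dq0 dqE (drag0 p) Zp' XNZ' XBY' NB' small PP0 M4 MM zl e2 e3 kap1 kap2.
have upper := inverse_stiffness_upper e_gt0 g0 nu0 T0 p0 p1 d0 dg hB' hX' hN' hY' hZ' hz
  hq' Bp zp q1' qt' dq0 dqE (drag0 p) Zp' XNZ' XBY' NB' small PP0 M4 MM zh e1 K2E.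
have rate := rate_bound e_gt0 g0 nu0 T0 d0 dg hB' hX' hN' hY' hZ' hz
  hq' Bp zp q1' dq0 (drag0 p) Zp' XNZ' XBY' NB' small PP0 M4 MM.
have vel := velocity_bound e_gt0 g0 nu0 T0 d0 dg hB' hX' hN' hY' hZ' hz
  hq' Bp zp q1' dq0 (drag0 p) Zp' XNZ' XBY' NB' small PP0 M4 MM.
have NBb := NB_bound e_gt0 g0 d0 dg hB' hX' hN' hY' hz
  Bp zp q1' XBY' small PP0.
move: (lower _ TT) (upper _ TT) (rate _ TT) (vel _ TT) (NBb _ TT).
rewrite -/(q T) -/K => lowT upT rateT velT NBT.
have BT := Bp _ TT; have zT := zp _ TT.
have qT : 0 < q T by exact: lt_le_trans (q1' _ TT).
have T1 : 0 < 1 + T by lra.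
have zE : B T `^ g = (z T)^-1 by rewrite zV.
have sT : 0 < (1 + T) * q T by rewrite mulr_gt0.
have pw := ge0_ler_powR (_ : 0 <= g^-1); rewrite invr_ge0 ltW// in pw.
have wE : B T * w T = ((1 + T) * q T / z T) `^ g^-1.
  by rewrite /w weighted_powE ?(ltW BT)// zE mulrC.
have szn : (1 + T) * q T / z T \in Num.nneg by rewrite nnegrE divr_ge0 ?ltW.
have Kn : K^-1 \in Num.nneg by rewrite nnegrE invr_ge0 ltW.
have kapn : kap^-1 \in Num.nneg by rewrite nnegrE invr_ge0 ltW.
split.
- rewrite wE; apply: pw => //.
  by rewrite ler_pdivlMr// ler_pdivrMl.
- rewrite wE; apply: pw => //.
  by rewrite ler_pdivrMr// ler_pdivlMl.
- by move: NBT; rewrite ler_pdivrMr.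
- have h : Z T * z T ^+ 2 <= M * B T * q T ^+ 2.
    have -> : Z T * z T ^+ 2 = Z T * (z T ^+ 2 / (B T * q T ^+ 2)) * (B T * q T ^+ 2).
      by field; rewrite !gt_eqF.
    by rewrite -[leRHS]mulrA ler_pM2r// mulr_gt0// exprn_gt0.
  have h2 : (kap * ((1 + T) * q T)) ^+ 2 <= z T ^+ 2.
    by rewrite ler_pXn2r ?nnegrE ?(ltW zT)// mulr_ge0 ?(ltW kap0)// ltW.
  rewrite mulrAC ler_pdivlMr ?exprn_gt0// -(@ler_pM2r _ (q T ^+ 2)) ?exprn_gt0//.
  apply: le_trans h.
  have -> : Z T * (1 + T) ^+ 2 * kap ^+ 2 * q T ^+ 2 = Z T * (kap * ((1 + T) * q T)) ^+ 2 by ring.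
  by rewrite ler_wpM2l// Zp.
- rewrite -(ler_pM2r zT).
  have rE : `|2 * g * X T / B T| * B T = 2 * g * `|X T|.
    have g2 : 0 < 2 * g by exact: mulr_gt0.
    by rewrite normrM normfV (gtr0_norm BT) divfK ?gt_eqF// normrM (gtr0_norm g2).
  rewrite -rE.
  have -> : e * (`|2 * g * X T / B T| * B T) * q T * z T =
    e * (`|2 * g * X T / B T| * z T) * (B T * q T) by ring.
  apply: (@le_trans _ _ (e * (Kr * q T) * (B T * q T))).
    by rewrite ler_pM2r ?mulr_gt0// ler_pM2l.
  have -> : e * (Kr * q T) * (B T * q T) = e * Kr * (q T ^+ 2 * B T) by ring.
  apply: (@le_trans _ _ (kap * (d / 2) * (q T ^+ 2 * B T))).
    by rewrite ler_pM2r// mulr_gt0 ?exprn_gt0.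
  have -> : kap * (d / 2) * (q T ^+ 2 * B T) = d / 2 * B T * (kap * (q T * q T)) by ring.
  have d2 : 0 < d / 2 by rewrite divr_gt0.
  rewrite ler_pM2l ?mulr_gt0//; apply: le_trans lowT.
  by rewrite ler_pM2l// ler_pM2r// drag_le.
Qed.

(** On an interval where eps |rho| q <= d and B is within a factor 2 of its final bounds, the
    estimates hold with room to spare; [continuous_induction] then removes the restriction. *)
Lemma a_priori_estimates t : 0 <= t ->
  [/\ C1 <= B t * w t /\ B t * w t <= C2, N t <= P0 * B t,
      Z t * (1 + t) ^+ 2 <= M / kap ^+ 2 * B t,
      e * (2 * g * `|X t|) * q t <= d * B t & c t = B t `^ g].
Proof.
move=> t0.
have [e1 e2 e3 e4 e5] := e0_terms e_gt0 e_lt.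
pose gap (s : R) : R := Num.min (Num.min (B s * w s - C1 / 2) (2 * C2 - B s))
  (d * B s - e * (2 * g * `|X s|) * q s).
have gapE s : (0 <= gap s) = [&& C1 / 2 <= B s * w s, B s <= 2 * C2 &
    e * (2 * g * `|X s|) * q s <= d * B s].
  by rewrite /gap !le_min !subr_ge0 andbA.
have cont_gap (s : R) : 0 <= s -> {for s, continuous gap}.
  move=> s0; have s1 : 0 < 1 + s by lra.
  have cB := drv_cont (hB s0); have cX := drv_cont (hX s0).
  have cq (a : R) : {for s, continuous (fun r : R => (1 + r) `^ a)}.
    exact: drv_cont (drvpow a s1 (drvD (drvC 1 s) (is_derive_id s 1))).
  apply: continuous_min; first apply: continuous_min.
  - apply: continuousB; last exact: cst_continuous.
    by apply: continuousM => //; exact: cq.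
  - by apply: continuousB => //; exact: cst_continuous.
  - apply: continuousB; first by apply: continuousM => //; exact: cst_continuous.
    apply: continuousM; last exact: cq.
    apply: continuousM; first exact: cst_continuous.
    apply: continuousM; first exact: cst_continuous.
    exact: continuous_comp cX (@norm_continuous _ _ _).
have gap_pos (s : R) : 0 <= s -> 0 < gap s.
  apply: continuous_induction => [//||T T0 hT].
    have w01 : w 0 = 1 by rewrite /w addr0 powR1.
    have rt b : 0 < b -> (b `^ g) `^ g^-1 = b.
      by move=> b0; rewrite -powRrM divff ?gt_eqF// powRr1// ltW.
    have pw := ge0_ler_powR (_ : 0 <= g^-1); rewrite invr_ge0 ltW// in pw.
    rewrite gapE w01 mulr1 /q addr0 powR1 mulr1; apply/and3P; split.
    - apply: (@le_trans _ _ C1); first by rewrite ler_pdivrMr// ler_pMr// ler1n.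
      apply: le_trans Bl; rewrite -[leRHS]rt//.
      apply: pw; rewrite ?nnegrE ?invr_ge0 ?powR_ge0 ?(ltW K0)//.
      rewrite -[leRHS]invrK lef_pV2 ?posrE// -/zhi.
      have : 0 <= 2 * K2 by rewrite mulr_ge0.
      by rewrite /K; move: zhi0; lra.
    - apply: (le_trans Bh); apply: (@le_trans _ _ C2); last by rewrite ler_pMl// ler1n.
      rewrite -[leLHS]rt//; apply: pw; rewrite ?nnegrE ?invr_ge0 ?powR_ge0 ?(ltW kap0)//.
      rewrite -[leLHS]invrK lef_pV2 ?posrE// -/zlo.
      by apply: le_trans kap1; rewrite ler_pMl// ler1n.
    - apply: (@le_trans _ _ (d * Blo)); last by rewrite ler_pM2l.
      apply: le_trans e5; rewrite ler_pM2l// ler_pM2l ?mulr_gt0//.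
      rewrite -(@ler_pXn2r _ 2)// ?nnegrE ?normr_ge0 ?addr_ge0//.
      rewrite real_normK ?num_real//; apply: le_trans (XNZ (lexx 0)) _.
      have Np : 0 <= N 0.
        apply: le_trans (NB (lexx 0)).
        by rewrite mulr_ge0 ?(ltW nu0)// (le_trans (ltW Blo0)).
      have Zp0 := Zp (lexx 0).
      apply: (@le_trans _ _ (N0 * Z0)); first by rewrite ler_pM.
      by move: N00 Z00; nra.
  have hg : good T by move=> r /hT; rewrite gapE => /and3P[].
  have [h1 h2 h3 h4 h5] := good_estimates T0 hg.
  have BT : 0 < B T.
    by rewrite -(ltr_pM2r (w0 T0)) mul0r; exact: lt_le_trans h1.
  rewrite /gap !lt_min !subr_gt0; apply/andP; split; first (apply/andP; split).
  - by apply: lt_le_trans h1; rewrite ltr_pdivrMr// ltr_pMr// ltr1n.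
  - apply: (@le_lt_trans _ _ C2); last by rewrite ltr_pMl// ltr1n.
    by apply: le_trans h2; rewrite ler_peMr ?w1// ltW.
  - by apply: le_lt_trans h5 _; rewrite ltr_pM2r// ltr_pdivrMr// ltr_pMr// ltr1n.
have hg : good t.
  by move=> s /andP[s0 _]; have := ltW (gap_pos _ s0); rewrite gapE => /and3P[].
have [h1 h2 h3 h4 h5] := good_estimates t0 hg.
have tt : 0 <= t <= t by apply/andP.
have [k1 k2 k3] := hg t tt.
by split => //; exact: cE.
Qed.
End Trajectory.

(** The constants depend on bounds of the initial energies only, hence
    apply uniformly to all spectral truncations of the data. The stiffness is
    required to be B^g only where B is within a factor 2 of the final bounds, which
    leaves room for a clamp. *)
Lemma kirchhoff_a_priori :
  exists e0 C1 C2 C3 C4 d : R,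
  [/\ 0 < e0, 0 < C1, 0 < C2, 0 < C3 & 0 < C4] /\ 0 < d /\
  forall e, 0 < e -> e < e0 ->
  forall B X N Y Z W c : R -> R, kirchhoff_energies p nu e B X N Y Z W c ->
  [/\ Blo <= B 0, B 0 <= Bhi, Y 0 <= Y0, N 0 <= N0 & Z 0 <= Z0] ->
  (forall t : R, 0 <= t -> C1 / 2 <= B t * (1 + t) `^ ((p + 1) / g) ->
    B t <= 2 * C2 -> c t = B t `^ g) ->
  forall t : R, 0 <= t ->
  [/\ C1 <= B t * (1 + t) `^ ((p + 1) / g) /\
       B t * (1 + t) `^ ((p + 1) / g) <= C2, N t <= C3 * B t,
      Z t * (1 + t) ^+ 2 <= C4 * B t,
      e * (2 * g * `|X t|) <= d * B t & c t = B t `^ g].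
Proof.
have Mk : 0 <= M / kap ^+ 2 by exact: divr_ge0 M0 (sqr_ge0 _).
exists e0, C1, C2, (P0 + 1), (M / kap ^+ 2 + 1), d; split; first split => //.
- exact: ltr_wpDl P00 ltr01.
- exact: ltr_wpDl Mk ltr01.
split=> // e ep el B X N Y Z W c [h1 h2 h3 h4 h5 h6 h7 h8 h9] [i1 i2 i3 i4 i5] hc t t0.
have [[a1 a2] a3 a4 a5 a6] := a_priori_estimates ep el h1 h2 h3 h4 h5 h6 h7 h8 h9 i1 i2 i3 i4 i5 hc t0.
have Bt : 0 <= B t.
  have w0 : 0 < (1 + t) `^ ((p + 1) / g) by rewrite powR_gt0//; lra.
  by rewrite -(ler_pM2r w0) mul0r; apply: le_trans a1; rewrite ltW.
split => //.
- by apply: le_trans a3 _; rewrite ler_wpM2r// lerDl.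
- by apply: le_trans a4 _; rewrite ler_wpM2r// lerDl.
- apply: le_trans a5; rewrite ler_peMr ?drag_ge1//.
  by apply: mulr_ge0 (ltW ep) _; rewrite !mulr_ge0// ltW.
Qed.
End Apriori.

(** * Real Hilbert spaces *)

Section InnerProduct.
Variables (R : realType) (H : completeNormedModType R) (dot : {dot H for idfun}).
Hypothesis hdot : hilbert_form dot.
Implicit Types x y z : H.

Lemma dotDl x y z : dot (x + y) z = dot x z + dot y z.
Proof. exact: linearDl. Qed.
Lemma dotDr x y z : dot z (x + y) = dot z x + dot z y.
Proof. exact: linearDr. Qed.
Lemma dotNl x z : dot (- x) z = - dot x z.
Proof. exact: linearNl. Qed.
Lemma dotNr x z : dot z (- x) = - dot z x.
Proof. exact: linearNr. Qed.
Lemma dotBl x y z : dot (x - y) z = dot x z - dot y z.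
Proof. exact: linearBl. Qed.
Lemma dotBr x y z : dot z (x - y) = dot z x - dot z y.
Proof. exact: linearBr. Qed.
Lemma dotZl a x z : dot (a *: x) z = a * dot x z.
Proof. exact: linearZl_LR. Qed.
Lemma dotZr a x z : dot z (a *: x) = a * dot z x.
Proof. exact: linearZr. Qed.
Lemma dot0l z : dot 0 z = 0.
Proof. exact: linear0l. Qed.
Lemma dot0r z : dot z 0 = 0.
Proof. exact: linear0r. Qed.
Lemma dotC x y : dot x y = dot y x.
Proof. by rewrite hermC expr0 mul1r. Qed.

Definition dotE := (dotDl, dotDr, dotNl, dotNr, dotZl, dotZr).

Lemma normsqD x y : `|x + y| ^+ 2 = `|x| ^+ 2 + 2 * dot x y + `|y| ^+ 2.
Proof. rewrite -!hdot. rewrite !dotE (dotC y x); ring. Qed.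

Lemma dot_le_norm x y : `|dot x y| <= `|x| * `|y|.
Proof.
have [->|y0] := eqVneq y 0; first by rewrite dot0r !normr0 mulr0.
have yp : 0 < `|y| by rewrite normr_gt0.
rewrite -(@ler_pXn2r _ 2)// ?nnegrE ?mulr_ge0// real_normK ?num_real//.
have : 0 <= `|(`|y| ^+ 2) *: x - dot x y *: y| ^+ 2 by rewrite sqr_ge0.
rewrite -(hdot (_ - _)) !dotE (dotC y x) !hdot => h.
rewrite -subr_ge0 -(pmulr_rge0 _ (exprn_gt0 2 yp)); apply: le_trans h _.
by rewrite le_eqVlt; apply/orP; left; apply/eqP; ring.
Qed.

Lemma dot_sqr_le x y : dot x y ^+ 2 <= `|x| ^+ 2 * `|y| ^+ 2.
Proof.
rewrite -[leLHS]real_normK ?num_real// -exprMn ler_pXn2r ?nnegrE ?mulr_ge0//.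
exact: dot_le_norm.
Qed.

Lemma dot_ext x y : (forall z, dot x z = dot y z) -> x = y.
Proof.
move=> h; apply/eqP; rewrite -subr_eq0 -normr_eq0 -sqrf_eq0 -hdot.
by rewrite dotBl h subrr.
Qed.

Lemma cvg_dot (T : Type) (F : set_system T) (FF : Filter F) (f g : T -> H) a b :
  f x @[x --> F] --> a -> g x @[x --> F] --> b ->
  dot (f x) (g x) @[x --> F] --> dot a b.
Proof.
move=> fa gb.
have r0 : `|f x - a| * `|g x| + `|a| * `|g x - b| @[x --> F] --> (0 : R).
  rewrite -[X in _ --> X]addr0 -[X in _ --> X + _](mul0r `|b|) -[X in _ --> _ + X](mulr0 `|a|).
  apply: cvgD; apply: cvgM.
  - by rewrite -(normr0 H); apply: cvg_norm; rewrite -(subrr a); apply: cvgB => //; exact: cvg_cst.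
  - exact: cvg_norm.
  - exact: cvg_cst.
  - by rewrite -(normr0 H); apply: cvg_norm; rewrite -(subrr b); apply: cvgB => //; exact: cvg_cst.
apply/cvgrPdist_lt => e e0; have /cvgrPdist_lt /(_ e e0) := r0.
apply: filterS => x; rewrite sub0r normrN => h; apply: le_lt_trans h.
have -> : dot a b - dot (f x) (g x) = - (dot (f x - a) (g x) + dot a (g x - b)).
  by rewrite !dotE; ring.
rewrite normrN; apply: le_trans (ler_normD _ _) _; apply: le_trans (ler_norm _).
by apply: lerD; exact: dot_le_norm.
Qed.

Lemma deriv_dot (u v : R -> H) (t : R) du dv :
  is_derive t (1:R) u du -> is_derive t (1:R) v dv ->
  is_derive t (1:R) (fun s => dot (u s) (v s)) (dot du (v t) + dot (u t) dv).
Proof.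
move=> /[dup] hu [cu du'] /[dup] hv [cv dv'].
have cu0 : {for 0, continuous (fun h : R => u (h *: 1 + t))}.
  exact/differentiable_continuous/derivable1_diffP/(derivable1P _ _ _).1.
have key : h^-1 *: (((fun s => dot (u s) (v s)) \o shift t) (h *: (1:R)) - dot (u t) (v t))
   @[h --> 0^'] --> dot du (v t) + dot (u t) dv.
  have -> : (fun h : R => h^-1 *: (((fun s => dot (u s) (v s)) \o shift t) (h *: (1:R)) - dot (u t) (v t)))
    = (fun h : R => dot (h^-1 *: ((u \o shift t) (h *: (1:R)) - u t)) (v t)
       + dot (u (h *: 1 + t)) (h^-1 *: ((v \o shift t) (h *: (1:R)) - v t))).
    apply/funext => h /=; rewrite !dotE -mulrDr; congr (_ * _); ring.
  apply: cvgD; apply: cvg_dot.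
  - by rewrite -du'; exact: cu.
  - exact: cvg_cst.
  - move: cu0 => /continuous_withinNx; rewrite scale0r add0r; exact.
  - by rewrite -dv'; exact: cv.
split; first by apply/cvg_ex; eexists; exact: key.
by apply: cvg_lim key; exact: norm_hausdorff.
Qed.
End InnerProduct.

Section LittleO.
Variables (R : realType) (V : normedModType R).
Implicit Types (f : R -> V) (t s : R).

(** The difference-quotient-free form of differentiability, which also
    covers s = t and is easier to transport along bounded maps. *)
Lemma is_deriveP f t d : is_derive t (1:R) f d <->
  forall e : R, 0 < e -> exists2 r : R, 0 < r &
    forall s : R, `|s - t| < r -> `|f s - f t - (s - t) *: d| <= e * `|s - t|.
Proof.
split=> [[cf df] e e0|h].
  have : h^-1 *: ((f \o shift t) (h *: (1:R)) - f t) @[h --> 0^'] --> d by rewrite -df; exact: cf.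
  move=> /cvgrPdist_lt/(_ e e0) /nbhs_ballP[r /= r0 hr]; exists r => // s st.
  have [->|nst] := eqVneq s t; first by rewrite !subrr scale0r subr0 !normr0 mulr0.
  have st0 : s - t != 0 by rewrite subr_eq0.
  have := hr (s - t); rewrite /ball/= sub0r normrN => /(_ st st0).
  rewrite /= scaler1 subrK => /ltW hd.
  have -> : f s - f t - (s - t) *: d = - ((s - t) *: (d - (s - t)^-1 *: (f s - f t))).
    by rewrite scalerBr scalerA divff// scale1r opprB.
  by rewrite normrN normrZ mulrC ler_wpM2r.
have key : h^-1 *: ((f \o shift t) (h *: (1:R)) - f t) @[h --> 0^'] --> d.
  apply/cvgrPdist_le => e e0; have [r r0 hr] := h e e0.
  apply/nbhs_ballP; exists r => // s; rewrite /ball/= sub0r normrN => sr s0.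
  rewrite scaler1; have := hr (s + t); rewrite addrK => /(_ sr).
  have -> : f (s + t) - f t - s *: d = - (s *: (d - s^-1 *: (f (s + t) - f t))).
    by rewrite scalerBr scalerA divff// scale1r opprB.
  by rewrite normrN normrZ mulrC ler_pM2r// normr_gt0.
split; first by apply/cvg_ex; eexists; exact: key.
by apply: cvg_lim key; exact: norm_hausdorff.
Qed.
End LittleO.

(** * Locally uniform convergence on the half-line *)

Section LocallyUniform.
Variables (R : realType) (V : completeNormedModType R).
Implicit Types (f g : nat -> R -> V) (l : R -> V) (t s T : R).

(** Composing with this map turns continuity on the half-line into continuity
    on the whole line. *)
Definition nonneg_part t : R := Num.max t 0.

Lemma nonneg_part_ge0 t : 0 <= nonneg_part t.
Proof. by rewrite /nonneg_part le_max lexx orbT. Qed.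

Lemma nonneg_partE t : 0 <= t -> nonneg_part t = t.
Proof. by move=> t0; exact/max_idPl. Qed.

Lemma nonneg_part_continuous : continuous nonneg_part.
Proof. by move=> t; apply: continuous_max; [exact: cvg_id|exact: cst_continuous]. Qed.

Lemma cauchy_seq_cvg (x : nat -> V) :
  (forall e : R, 0 < e -> exists N, forall m n, (N <= m)%N -> (N <= n)%N -> `|x m - x n| <= e) ->
  exists a : V, x n @[n --> \oo] --> a.
Proof.
move=> h; apply/cvg_ex.
apply/cauchy_cvgP; apply/cauchyP => e e0.
have [N hN] := h (e / 2) (divr_gt0 e0 (ltr0n _ 2)).
exists (x N); exists N => // n /= Nn.
rewrite -ball_normE /=; apply: le_lt_trans (hN _ _ (leqnn N) Nn) _.
by rewrite ltr_pdivrMr// ltr_pMr// ltr1n.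
Qed.

Definition lu_cauchy f := forall T e, 0 < e -> exists N, forall m n,
  (N <= m)%N -> (N <= n)%N -> forall t, 0 <= t <= T -> `|f m t - f n t| <= e.

Definition lu_cvg f l := forall T e, 0 < e -> exists N, forall n,
  (N <= n)%N -> forall t, 0 <= t <= T -> `|f n t - l t| <= e.

Lemma lu_cvg_pointwise f l t : 0 <= t -> lu_cvg f l -> f n t @[n --> \oo] --> l t.
Proof.
move=> t0 h; apply/cvgrPdist_le => e e0; have [N hN] := h t e e0.
by exists N => // n /= Nn; rewrite distrC; apply: hN; rewrite // t0 lexx.
Qed.

Lemma lu_cauchy_cvg f : lu_cauchy f -> exists l, lu_cvg f l.
Proof.
move=> h.
have : forall t, exists a : V, 0 <= t -> f n t @[n --> \oo] --> a.
  move=> t; have [t0|_] := boolP (0 <= t); last by exists 0.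
  have [a ha] : exists a : V, f n t @[n --> \oo] --> a.
    apply: cauchy_seq_cvg => e e0; have [N hN] := h t e e0.
    by exists N => m n Nm Nn; apply: hN; rewrite // t0 lexx.
  by exists a.
move=> /choice[l hl]; exists l => T e e0.
have [N hN] := h T (e / 2) (divr_gt0 e0 (ltr0n _ 2)).
exists N => n Nn t /andP[t0 tT].
have /cvgrPdist_le /(_ _ (divr_gt0 e0 (ltr0n _ 2))) [M _ hM] := hl t t0.
have := hM (maxn M N) (leq_maxl _ _) => /= h1.
have h2 := hN n (maxn M N) Nn (leq_maxr _ _) t (introT andP (conj t0 tT)).
have -> : f n t - l t = (f n t - f (maxn M N) t) + (f (maxn M N) t - l t).
  by rewrite addrA subrK.
apply: le_trans (ler_normD _ _) _; rewrite distrC in h1.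
by rewrite [leRHS]splitr lerD.
Qed.

Lemma lu_cvg_continuous f l : (forall n, continuous (f n \o nonneg_part)) ->
  lu_cvg f l -> continuous (l \o nonneg_part).
Proof.
move=> hc h t; apply/cvgrPdist_lt => e e0.
have e3 : 0 < e / 3 by rewrite divr_gt0.
have [N hN] := h (`|t| + 1) _ e3.
have /cvgrPdist_lt /(_ _ e3) hf := hc N t.
have ht : \forall s \near t, `|s - t| < 1.
  by apply/nbhs_ballP; exists 1 => //= s; rewrite /ball/= distrC.
near=> s.
have b r : `|r - t| < 1 -> 0 <= nonneg_part r <= `|t| + 1.
  move=> rt; rewrite nonneg_part_ge0 ge_max addr_ge0// andbT.
  have : r <= `|r - t| + `|t|.
    by rewrite -{1}(subrK t r); apply: le_trans (ler_norm _) _; exact: ler_normD.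
  lra.
have h1 : `|f N (nonneg_part t) - f N (nonneg_part s)| < e / 3 by near: s.
have h2 : `|f N (nonneg_part t) - l (nonneg_part t)| <= e / 3.
  by apply: hN => //; apply: b; rewrite subrr normr0.
have h3 : `|f N (nonneg_part s) - l (nonneg_part s)| <= e / 3.
  by apply: hN => //; apply: b; near: s.
rewrite /=.
have -> : l (nonneg_part t) - l (nonneg_part s) =
  - (f N (nonneg_part t) - l (nonneg_part t)) + (f N (nonneg_part t) - f N (nonneg_part s))
  + (f N (nonneg_part s) - l (nonneg_part s)).
  by rewrite opprB !subrKA.
apply: le_lt_trans (ler_normD _ _) _.
have := ler_normD (- (f N (nonneg_part t) - l (nonneg_part t))) (f N (nonneg_part t) - f N (nonneg_part s)).
rewrite normrN; lra.
Unshelve. all: by end_near. Qed.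
End LocallyUniform.

Section MeanValue.
Variables (R : realType) (H : completeNormedModType R) (dot : {dot H for idfun}).
Hypothesis hdot : hilbert_form dot.

(** The mean value inequality, from the scalar case applied to the component of u along
    u b - u a. *)
Lemma norm_increment (u u' : R -> H) (g g' : R -> R) (a b : R) : a <= b ->
  (forall t, a <= t <= b -> {for t, continuous u}) ->
  (forall t, a <= t <= b -> {for t, continuous g}) ->
  (forall t, a < t < b -> is_derive t (1:R) u (u' t)) ->
  (forall t, a < t < b -> is_derive t (1:R) g (g' t)) ->
  (forall t, a < t < b -> `|u' t| <= g' t) ->
  `|u b - u a| <= g b - g a.
Proof.
move=> ab cu cg du dg h.
pose x := u b - u a.
have : `|x| * g a + - dot (u a) x <= `|x| * g b + - dot (u b) x.
  apply: (deriv_ge0_le (f := fun t => `|x| * g t + - dot (u t) x)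
    (df := fun t => (`|x| * g' t + g t * 0) + - (dot (u' t) x + dot (u t) 0))) => // t tab.
  - apply: continuousD; first by apply: continuousM; [exact: cst_continuous|exact: cg].
    apply: continuousN; apply: cvg_dot => //; [exact: cu|exact: cvg_cst].
  - have hx : is_derive t (1:R) (fun=> x) 0 by exact: is_derive_cst.
    exact: drvD (drvM (drvC `|x| t) (dg t tab)) (drvN (deriv_dot hdot (du t tab) hx)).
  - rewrite mulr0 addr0 dot0r addr0 subr_ge0.
    apply: le_trans (ler_norm _) _; apply: le_trans (dot_le_norm hdot _ _) _.
    by rewrite mulrC ler_wpM2l// h.
have [x0|x0] := eqVneq x 0.
  move=> _; rewrite -/x x0 normr0 subr_ge0.
  apply: (deriv_ge0_le (df := g')) => // t tab.
  exact: le_trans (h t tab).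
move=> h2; rewrite -(@ler_pM2l _ `|x|) ?normr_gt0// mulrBr.
have : dot x x = `|x| * `|x| by rewrite hdot expr2.
rewrite {1}/x dotBl -/x; move: h2; lra.
Qed.
End MeanValue.

(** * The Riesz representation theorem *)

Section Riesz.
Variables (R : realType) (H : completeNormedModType R) (dot : {dot H for idfun}).
Hypothesis hdot : hilbert_form dot.

(** The minimum of |x|^2 / 2 - L x: minimizing sequences are Cauchy by the
    parallelogram law, and the Euler equation at the minimum is L x = <w, x>. *)
Lemma riesz (L : H -> R) (C : R) :
  (forall (a : R) x y, L (a *: x + y) = a * L x + L y) ->
  (forall x, `|L x| <= C * `|x|) -> exists w, forall x, L x = dot w x.
Proof.
move=> Llin Lb.
have LD x y : L (x + y) = L x + L y by rewrite -[x]scale1r Llin mul1r scale1r.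
have L0 : L 0 = 0 by have := LD 0 0; rewrite addr0; lra.
have LZ a x : L (a *: x) = a * L x by rewrite -[_ *: _]addr0 Llin L0 addr0.
pose J x := `|x| ^+ 2 / 2 - L x.
have parallelogram x y : `|x - y| ^+ 2 = 4 * (J x + J y - 2 * J (2^-1 *: (x + y))).
  by rewrite /J LZ LD -!hdot !(dotE dot) (dotC dot y x); field.
have Jlow x : - (C ^+ 2 / 2) <= J x.
  rewrite /J; have := ler_norm (L x); have := Lb x; have := sqr_ge0 (`|x| - C); nra.
pose S := range J.
have hS : has_inf S.
  split; first by exists (J 0); exists 0.
  by exists (- (C ^+ 2 / 2)) => _ [x _ <-].
pose m := inf S.
have mJ x : m <= J x by apply: (ge_inf hS.2); exists x.
have /choice[x hx] : forall n : nat, exists x, J x < m + n.+1%:R^-1.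
  move=> n; have n0 : 0 < n.+1%:R^-1 :> R by rewrite invr_gt0.
  by have [_ [x _ <-] h] := inf_adherent n0 hS; exists x.
have [w xw] : exists w : H, x n @[n --> \oo] --> w.
  apply: cauchy_seq_cvg => e e0.
  have e2 : 0 < e ^+ 2 / 8 by rewrite divr_gt0 ?exprn_gt0.
  have [N _ hN] := near_infty_natSinv_lt (PosNum e2).
  exists N => i j Ni Nj.
  rewrite -(@ler_pXn2r _ 2)// ?nnegrE ?(ltW e0)// parallelogram.
  have := hN i Ni; have := hN j Nj; rewrite /= => h1 h2.
  have := hx i; have := hx j; have := mJ (2^-1 *: (x i + x j)).
  move: h1 h2; move: (e ^+ 2) (i.+1%:R^-1) (j.+1%:R^-1) => *; lra.
have JN : forall n : nat, J w <= J (x n) + (`|x n - w| * (`|w| + C)).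
  move=> n; have -> : J (x n) = J w + (dot w (x n - w) + `|x n - w| ^+ 2 / 2 - L (x n - w)).
    have xE : x n = w + (x n - w) by rewrite addrC subrK.
    move: (x n - w) xE => h ->.
    by rewrite /J (normsqD hdot) LD; field.
  have h1 := dot_le_norm hdot w (x n - w); have h2 := Lb (x n - w).
  have h3 := ler_norm (L (x n - w)); have h4 := ler_norm (- dot w (x n - w)).
  rewrite normrN in h4; have := sqr_ge0 `|x n - w|; lra.
have Jw : J w <= m.
  have lim0 : m + n.+1%:R^-1 + (`|x n - w| * (`|w| + C)) @[n --> \oo] --> m + 0 + 0 * (`|w| + C).
    apply: cvgD; first by apply: cvgD; [exact: cvg_cst|exact: cvg_harmonic].
    apply: cvgM; last exact: cvg_cst.
    by rewrite -(normr0 H); apply: cvg_norm; rewrite -(subrr w); apply: cvgB => //; exact: cvg_cst.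
  rewrite mul0r !addr0 in lim0.
  rewrite -(cvg_lim (@Rhausdorff R) lim0).
  apply: limr_ge; first by apply/cvg_ex; exists m.
  by near=> n; apply: le_trans (JN n) _; rewrite lerD2r ltW.
exists w => y.
pose a := dot w y - L y.
have h t : 0 <= t * a + t ^+ 2 * (`|y| ^+ 2 / 2).
  have := le_trans Jw (mJ (w + t *: y)).
  rewrite /J (normsqD hdot) LD LZ dotZr normrZ exprMn real_normK ?num_real// /a; lra.
apply/eqP; rewrite eq_sym -subr_eq0 -/a; apply/eqP.
pose c := `|y| ^+ 2 / 2 + 1.
have c0 : 0 < c by rewrite /c; have := sqr_ge0 `|y|; lra.
have := h (- a / (2 * c)).
have -> : - a / (2 * c) * a + (- a / (2 * c)) ^+ 2 * (`|y| ^+ 2 / 2) =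
  - (a ^+ 2 * ((2 * c)^-1 - (2 * c)^-1 ^+ 2 * (`|y| ^+ 2 / 2))) by ring.
rewrite oppr_ge0 => h0.
have k : 0 < (2 * c)^-1 - (2 * c)^-1 ^+ 2 * (`|y| ^+ 2 / 2).
  have -> : (2 * c)^-1 - (2 * c)^-1 ^+ 2 * (`|y| ^+ 2 / 2) =
     (2 * c)^-1 ^+ 2 * (2 * c - `|y| ^+ 2 / 2) by field; rewrite gt_eqF.
  apply: mulr_gt0; first by rewrite exprn_gt0// invr_gt0 mulr_gt0.
  by rewrite /c; have := sqr_ge0 `|y|; lra.
rewrite pmulr_lle0// in h0.
by apply/eqP; rewrite -sqrf_eq0 eq_le h0 sqr_ge0.
Unshelve. all: by end_near. Qed.
End Riesz.

(** * Antiderivatives of vector-valued functions *)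

Section Antiderivative.
Variable R : realType.

Lemma mvt_between (G g : R -> R) (s t : R) :
  (forall r, Num.min s t <= r <= Num.max s t -> is_derive r (1:R) G (g r)) ->
  exists2 r, Num.min s t <= r <= Num.max s t & G s - G t = g r * (s - t).
Proof.
wlog ts : s t / t <= s.
  move=> h hd; case/orP: (le_total t s) => [ts|st]; first exact: h.
  have [|r r1 r2] := h t s st; first by rewrite minC maxC.
  exists r; first by rewrite minC maxC.
  by rewrite -opprB r2 -mulrN opprB.
rewrite (min_idPr ts) (max_idPl ts) => hd.
have hd' r : r \in `]t, s[ -> is_derive r (1:R) G (g r).
  by rewrite in_itv => /andP[r1 r2]; apply: hd; rewrite !ltW.
have hw : {within `[t, s], continuous G}.
  apply: continuous_in_subspaceT => r; rewrite inE/= in_itv/= => /hd; exact: drv_cont.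
have [r] := MVT_segment ts hd' hw; rewrite in_itv => r1 r2.
by exists r.
Qed.

(** The base point -1 makes 0 an interior point, so that the derivative at 0
    is two-sided. *)
Lemma scalar_antiderivative (f : R -> R) : continuous f ->
  exists F : R -> R, F 0 = 0 /\ forall t : R, -1 < t -> is_derive t (1:R) F (f t).
Proof.
move=> cf.
pose F0 x := \int[lebesgue_measure]_(t in `[-1, x]) f t.
have d0 (t : R) : -1 < t -> is_derive t (1:R) F0 (f t).
  move=> t1.
  have tu : t < t + 1 by rewrite ltrDl.
  have int : lebesgue_measure.-integrable `[-1, t + 1] (EFin \o f).
    apply: continuous_compact_integrable; first exact: segment_compact.
    exact: continuous_subspaceT.
  have [h1 h2] := continuous_FTC1_closed tu int t1 (cf t).
  by split; [exact: h1|rewrite -derive1E; exact: h2].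
exists (fun x => F0 x - F0 0); split; first by rewrite subrr.
move=> t t1; apply: is_derive_eq (drvD (d0 t t1) (drvC _ t)) _.
by rewrite addr0.
Qed.

Variables (H : completeNormedModType R) (dot : {dot H for idfun}).
Hypothesis hdot : hilbert_form dot.

Lemma bounded_on_segment (f : R -> H) (a b : R) : continuous f ->
  exists M, forall t : R, a <= t <= b -> `|f t| <= M.
Proof.
move=> cf; have [ab|ba] := leP a b; last first.
  by exists 0 => t /andP[ta tb]; have := le_lt_trans (le_trans ta tb) ba; rewrite ltxx.
have [|c _ hc] := @EVT_max R (fun t => `|f t|) a b ab.
  apply: continuous_subspaceT => t; exact: (continuous_comp (cf t) (@norm_continuous _ _ _)).
by exists `|f c| => t tab; apply: hc; rewrite in_itv.
Qed.

(** The integral is taken weakly, against each vector, and represented by [riesz]. The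
    derivative exists in norm because the scalar mean value theorem is applied to the error
    itself as test vector. *)
Lemma antiderivative (f : R -> H) : continuous f ->
  exists F : R -> H, F 0 = 0 /\ forall t : R, 0 <= t -> is_derive t (1:R) F (f t).
Proof.
move=> cf.
have /choice[G hG] : forall x, exists F : R -> R, F 0 = 0 /\
    forall t : R, -1 < t -> is_derive t (1:R) F (dot (f t) x).
  move=> x; apply: (@scalar_antiderivative (fun t => dot (f t) x)) => t.
  by apply: cvg_dot => //; [exact: cf|exact: cvg_cst].
have between (s t : R) : -1 < s -> -1 < t -> forall r, Num.min s t <= r <= Num.max s t -> -1 < r.
  by move=> s1 t1 r /andP[h _]; apply: lt_le_trans h; rewrite lt_min s1.
have incr x (s t : R) : -1 < s -> -1 < t -> exists2 r, Num.min s t <= r <= Num.max s t &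
    G x s - G x t = dot (f r) x * (s - t).
  move=> s1 t1; apply: mvt_between => r hr.
  exact: (hG x).2 r (between s t s1 t1 r hr).
have Glin (t : R) : -1 < t -> forall (a : R) x y, G (a *: x + y) t = a * G x t + G y t.
  move=> t1 a x y.
  pose K s := G (a *: x + y) s - (a * G x s + G y s).
  have [r _] : exists2 r, Num.min t 0 <= r <= Num.max t 0 & K t - K 0 = 0 * (t - 0).
    apply: (@mvt_between K (fun=> 0)) => r hr.
    have r1 : -1 < r by apply: between hr => //; rewrite ltrN10.
    apply: is_derive_eq (drvD ((hG (a *: x + y)).2 r r1) (drvN (drvD (drvM (drvC a r) ((hG x).2 r r1)) ((hG y).2 r r1)))) _.
    by rewrite !dotE; ring.
  rewrite /K !(hG _).1; lra.
have Gb (t : R) : -1 < t -> exists C, forall x, `|G x t| <= C * `|x|.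
  move=> t1; have [M hM] := bounded_on_segment (Num.min t 0) (Num.max t 0) cf.
  exists (M * `|t|) => x.
  have [r hr] := incr x t 0 t1 (ltrN10 R).
  rewrite (hG x).1 !subr0 => ->.
  rewrite normrM mulrAC ler_wpM2r//; apply: le_trans (dot_le_norm hdot _ _) _.
  by rewrite ler_wpM2r// hM.
have /choice[F hF] : forall t : R, exists w, -1 < t -> forall x, G x t = dot w x.
  move=> t; have [t1|_] := boolP (-1 < t); last by exists 0.
  have [C hC] := Gb t t1.
  by have [w hw] := riesz hdot (Glin t t1) hC; exists w.
have N10 : -1 < 0 :> R by exact: ltrN10.
exists F; split.
  by apply: (dot_ext hdot) => z; rewrite -(hF 0)// (hG z).1 dot0l.
move=> t t0; apply/is_deriveP => e e0.
have t1 : -1 < t by exact: lt_le_trans t0.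
have /cvgrPdist_lt /(_ e e0) /nbhs_ballP[r /= r0 hr] := cf t.
exists (Num.min r 1); first by rewrite lt_min r0 ltr01.
move=> s; rewrite lt_min => /andP[sr s1'].
have s1 : -1 < s by move: s1'; rewrite ltr_norml => /andP[+ _]; lra.
pose y := F s - F t - (s - t) *: f t.
have [y0|y0] := eqVneq y 0; first by rewrite -/y y0 normr0 mulr_ge0// ltW.
have [x hx] := incr y s t s1 t1.
rewrite (hF s)// (hF t)// => hxe.
have yy : dot y y = dot (f x - f t) y * (s - t).
  transitivity (dot (F s - F t - (s - t) *: f t) y); first by [].
  by rewrite (dotBl dot (F s - F t)) (dotBl dot (F s)) dotZl hxe (dotBl dot (f x)); ring.
have xt : `|f x - f t| < e.
  rewrite distrC; apply: hr; rewrite -ball_normE /=.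
  apply: le_lt_trans sr; rewrite ler_norml lerBlDr lerBrDr.
  move: hx; rewrite ge_min le_max => /andP[/orP[a|a] /orP[b|b]];
    have := ler_norm (s - t); have := ler_norm (- (s - t)); rewrite normrN; lra.
rewrite -(@ler_pM2r _ `|y|) ?normr_gt0// -/y -expr2 -(hdot y) yy.
apply: le_trans (ler_norm _) _; rewrite normrM mulrAC.
rewrite ler_wpM2r//; apply: le_trans (dot_le_norm hdot _ _) _.
by rewrite ler_wpM2r// ltW.
Qed.
End Antiderivative.

(** * Second-order differential equations *)

Section Geometric.
Variables (R : realType) (V : completeNormedModType R).

(** Bounds by a geometric series with constants depending on T. *)
Lemma geometric_lu_cauchy (f : nat -> R -> V) :
  (forall T : R, exists C : R, forall n (t : R), 0 <= t <= T ->
    `|f n.+1 t - f n t| <= C * 2^-1 ^+ n) -> lu_cauchy f.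
Proof.
move=> h T e e0; have [C hC] := h T.
have tail n j (t : R) : 0 <= t <= T -> `|f (n + j)%N t - f n t| <= 2 * C * (2^-1 ^+ n - 2^-1 ^+ (n + j)).
  move=> tT; elim: j => [|j IH]; first by rewrite addn0 !subrr normr0 mulr0.
  rewrite -(subrKA (f (n + j)%N t)) addnS; apply: le_trans (ler_normD _ _) _.
  apply: le_trans (lerD (hC _ _ tT) IH) _.
  by rewrite le_eqVlt exprS; apply/orP; left; apply/eqP; field.
have hlim : 2 * C * 2^-1 ^+ n @[n --> \oo] --> 2 * C * 0.
  apply: cvgM; first exact: cvg_cst.
  by apply: cvg_expr; rewrite ger0_norm ?invr_ge0// invf_lt1// ltr1n.
rewrite mulr0 in hlim; have /cvgrPdist_le /(_ _ (divr_gt0 e0 (ltr0n _ 2))) [N _ hN] := hlim.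
exists N => m n Nm Nn t /[dup] tT /andP[t0 t1].
have C0 : 0 <= C by have := le_trans (normr_ge0 _) (hC 0%N _ tT); rewrite expr0 mulr1.
have b k : (N <= k)%N -> `|f k t - f N t| <= e / 2.
  move=> Nk; rewrite -(subnKC Nk); apply: le_trans (tail N (k - N)%N _ tT) _.
  have := hN N (leqnn N); rewrite /= sub0r normrN => h1.
  apply: le_trans (le_trans (ler_norm _) h1).
  by rewrite ler_wpM2l ?mulr_ge0// gerBl exprn_ge0// invr_ge0.
rewrite -(subrKA (f N t)) [leRHS]splitr; apply: le_trans (ler_normD _ _) _.
by apply: lerD; [exact: b|rewrite distrC; exact: b].
Qed.
End Geometric.

Section Picard.
Variables (R : realType) (H : completeNormedModType R) (dot : {dot H for idfun}).
Hypothesis hdot : hilbert_form dot.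
Variables (G : R -> H -> H -> H) (u0 v0 : H).
Implicit Types t T : R.
Hypothesis Gcont : forall u v : R -> H, continuous u -> continuous v ->
  continuous (fun t => G (nonneg_part t) (u t) (v t)).
Hypothesis Glip : forall T, exists2 L : R, 0 <= L & forall t, 0 <= t <= T ->
  forall x y x' y', `|G t x y - G t x' y'| <= L * (`|x - x'| + `|y - y'|).

(** The iterates contract by 1/2 in the norm weighted by exp(- K t), with K large compared to
    the Lipschitz constant on [0, T]. *)
Lemma picard : exists u v : R -> H, [/\ u 0 = u0, v 0 = v0,
  forall t, 0 <= t -> is_derive t (1:R) u (v t)
  & forall t, 0 <= t -> is_derive t (1:R) v (G t (u t) (v t))].
Proof.
have /choice[prim hprim] : forall f : R -> H, exists F : R -> H, continuous f ->
    F 0 = 0 /\ forall t, 0 <= t -> is_derive t (1:R) F (f t).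
  move=> f; have [cf|ncf] := pselect (continuous f); last by exists f.
  by have [F hF] := antiderivative hdot cf; exists F.
pose step (w : (R -> H) * (R -> H)) :=
  ((fun t => u0 + prim (w.2 \o @nonneg_part R) t),
   (fun t => v0 + prim (fun s => G (nonneg_part s) (w.1 (nonneg_part s)) (w.2 (nonneg_part s))) t)).
pose w n := iter n step ((fun=> u0), (fun=> v0)).
pose u n := (w n).1; pose v n := (w n).2.
have npE := @nonneg_partE R.
have cont_deriv (f f' : R -> H) (c : H) : (forall t, 0 <= t -> is_derive t (1:R) f (f' t)) ->
    continuous ((fun t => c + f t) \o @nonneg_part R).
  move=> hf t; apply: continuousD; first exact: cst_continuous.
  apply: (@continuous_comp _ _ _ (@nonneg_part R) f); first exact: nonneg_part_continuous.
  exact: drv_cont (hf _ (nonneg_part_ge0 t)).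
have cstep (w' : (R -> H) * (R -> H)) : continuous (w'.1 \o @nonneg_part R) ->
    continuous (w'.2 \o @nonneg_part R) ->
    continuous ((step w').1 \o @nonneg_part R) /\ continuous ((step w').2 \o @nonneg_part R).
  move=> c1 c2; split; first exact: cont_deriv (hprim _ c2).2.
  exact: cont_deriv (hprim _ (Gcont c1 c2)).2.
have cw n : continuous (u n \o @nonneg_part R) /\ continuous (v n \o @nonneg_part R).
  elim: n => [|n [c1 c2]]; last exact: cstep.
  by split=> t; exact: cst_continuous.
pose g n t := G t (u n t) (v n t).
have cg n : continuous (fun s => G (nonneg_part s) (u n (nonneg_part s)) (v n (nonneg_part s))).
  exact: Gcont (cw n).1 (cw n).2.
have u00 n : u n 0 = u0.
  by case: n => [//|n]; rewrite /u /w /= (hprim _ (cw n).2).1 addr0.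
have v00 n : v n 0 = v0.
  by case: n => [//|n]; rewrite /v /w /= (hprim _ (cg n)).1 addr0.
have du n t : 0 <= t -> is_derive t (1:R) (u n.+1) (v n t).
  move=> t0; apply: is_derive_eq (is_deriveD (is_derive_cst _ _ _) ((hprim _ (cw n).2).2 t t0)) _.
  by rewrite add0r /= npE.
have dv n t : 0 <= t -> is_derive t (1:R) (v n.+1) (g n t).
  move=> t0; apply: is_derive_eq (is_deriveD (is_derive_cst _ _ _) ((hprim _ (cg n)).2 t t0)) _.
  by rewrite add0r /= !npE.
have dexp (a b : R) t : is_derive t (1:R) (fun s => a * expR (b * s)) (a * b * expR (b * t)).
  have h1 : is_derive t (1:R) (fun s : R => b * s) b.
    by apply: is_derive_eq (drvM (drvC b t) (is_derive_id t 1)) _; rewrite mulr1 mulr0 addr0.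
  apply: is_derive_eq (drvM (drvC a t) (is_derive1_comp (is_derive_expR _) h1)) _.
  by rewrite /=; ring.
(* each iteration halves the distance in the norm weighted by exp (- K t) *)
have geometric T : exists M K, 0 <= M /\ forall n t, 0 <= t <= T ->
    `|u n.+1 t - u n t| <= M * 2^-1 ^+ n * expR (K * t) /\
    `|v n.+1 t - v n t| <= M * 2^-1 ^+ n * expR (K * t).
  have [L L0 hL] := Glip T.
  have b0 (f : R -> H) : continuous (f \o @nonneg_part R) -> exists2 M, 0 <= M & forall t, 0 <= t <= T -> `|f t| <= M.
    move=> cf; have [M hM] := bounded_on_segment 0 T cf.
    exists (Num.max M 0) => [|t /[dup] tT /andP[t0 _]]; first by rewrite le_max lexx orbT.
    by rewrite le_max; apply/orP; left; have := hM t tT; rewrite /= npE.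
  have [Mu Mu0 hMu] := b0 _ (cw 1%N).1; have [Mv Mv0 hMv] := b0 _ (cw 1%N).2.
  pose M := Mu + Mv + `|u0| + `|v0|.
  have M0 : 0 <= M by rewrite !addr_ge0.
  pose K := 2 + 4 * L.
  have K0 : 0 < K by rewrite /K; lra.
  exists M, K; split => // n; elim: n => [|n IH] t /[dup] tT /andP[t0 t1].
    have e1 : 1 <= expR (K * t).
      by apply: le_trans (expR_ge1Dx _); rewrite lerDl mulr_ge0// ltW.
    have := hMu t tT; have := hMv t tT => h1 h2.
    have k1 := ler_normB (u 1%N t) (u 0%N t); have k2 := ler_normB (v 1%N t) (v 0%N t).
    have Me : M <= M * 2^-1 ^+ 0 * expR (K * t) by rewrite expr0 mulr1 ler_peMr.
    split.
      apply: le_trans Me; apply: le_trans k1 _; rewrite /M /u /=; rewrite /u in h2.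
      have := normr_ge0 v0; lra.
    apply: le_trans Me; apply: le_trans k2 _; rewrite /M /v /=; rewrite /v in h1.
    have := normr_ge0 u0; lra.
  pose a := M * 2^-1 ^+ n.+1.
  have a0 : 0 <= a by rewrite mulr_ge0// exprn_ge0// invr_ge0.
  have aE : M * 2^-1 ^+ n = 2 * a by rewrite /a exprS; field.
  have gE : a * expR (K * t) - a * expR (K * 0) <= a * expR (K * t).
    by rewrite mulr0 expR0 gerBl mulr1.
  have cgg s : {for s, continuous (fun s => a * expR (K * s))} by exact: drv_cont (dexp a K s).
  have sub s : 0 < s < t -> 0 <= s /\ 0 <= s <= T.
    by move=> /andP[s0 st]; rewrite (ltW s0) (le_trans (ltW st)).
  split; apply: le_trans gE.
    rewrite -[X in `|X|](_ : (u n.+2 t - u n.+1 t) - (u n.+2 0 - u n.+1 0) = _); last first.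
      by rewrite !u00 subrr subr0.
    apply: (norm_increment hdot (u := fun s => u n.+2 s - u n.+1 s) (u' := fun s => v n.+1 s - v n s)
      (g := fun s => a * expR (K * s)) (g' := fun s => a * K * expR (K * s)) t0) => [s /andP[s0 _]|s _|s|s] //.
    - exact: drv_cont (is_deriveB (du n.+1 s s0) (du n s s0)).
    - by move=> /sub[s0 sT]; exact: is_deriveB (du n.+1 s s0) (du n s s0).
    - move=> /sub[s0 sT]; apply: le_trans (IH s sT).2 _.
      rewrite aE ler_wpM2r ?expR_ge0// mulrC ler_wpM2l// /K; lra.
  rewrite -[X in `|X|](_ : (v n.+2 t - v n.+1 t) - (v n.+2 0 - v n.+1 0) = _); last first.
    by rewrite !v00 subrr subr0.
  apply: (norm_increment hdot (u := fun s => v n.+2 s - v n.+1 s) (u' := fun s => g n.+1 s - g n s)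
      (g := fun s => a * expR (K * s)) (g' := fun s => a * K * expR (K * s)) t0) => [s /andP[s0 _]|s _|s|s] //.
  - exact: drv_cont (is_deriveB (dv n.+1 s s0) (dv n s s0)).
  - by move=> /sub[s0 sT]; exact: is_deriveB (dv n.+1 s s0) (dv n s s0).
  - move=> /sub[s0 sT]; apply: le_trans (hL s sT _ _ _ _) _.
    have [i1 i2] := IH s sT; rewrite aE in i1 i2.
    have ex := expR_gt0 (K * s).
    apply: (@le_trans _ _ (L * (4 * a * expR (K * s)))).
      by rewrite ler_wpM2l//; lra.
    rewrite /K; have : 0 <= a * expR (K * s) by rewrite mulr_ge0// ltW.
    nra.
have small T : exists C, forall n t, 0 <= t <= T ->
    `|u n.+1 t - u n t| <= C * 2^-1 ^+ n /\ `|v n.+1 t - v n t| <= C * 2^-1 ^+ n.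
  have [M [K [M0 h]]] := geometric T.
  exists (M * expR (`|K| * T)) => n t /[dup] tT /andP[t0 t1].
  have le : M * 2^-1 ^+ n * expR (K * t) <= M * expR (`|K| * T) * 2^-1 ^+ n.
    rewrite mulrAC ler_wpM2r ?exprn_ge0 ?invr_ge0// ler_wpM2l// ler_expR.
    apply: (@le_trans _ _ (`|K| * t)); first by rewrite ler_wpM2r// ler_norm.
    by rewrite ler_wpM2l.
  by have [h1 h2] := h n t tT; split; [exact: le_trans h1 le|exact: le_trans h2 le].
have [|ul hul] := @lu_cauchy_cvg _ _ u.
  apply: geometric_lu_cauchy => T; have [C hC] := small T.
  by exists C => n t tT; exact: (hC n t tT).1.
have [|vl hvl] := @lu_cauchy_cvg _ _ v.
  apply: geometric_lu_cauchy => T; have [C hC] := small T.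
  by exists C => n t tT; exact: (hC n t tT).2.
have cul := lu_cvg_continuous (fun n => (cw n).1) hul.
have cvl := lu_cvg_continuous (fun n => (cw n).2) hvl.
have cgl := Gcont cul cvl.
(* the limit solves the integral equation *)
have identify (f f' : nat -> R -> H) (F F' l : R -> H) (c : H) :
    (forall n, f n 0 = c) -> F 0 = c ->
    (forall n t, 0 <= t -> is_derive t (1:R) (f n.+1) (f' n t)) ->
    (forall t, 0 <= t -> is_derive t (1:R) F (F' t)) ->
    lu_cvg f l -> lu_cvg f' F' -> forall t, 0 <= t -> F t = l t.
  move=> f0 F0 df dF fl f'F' t t0.
  have h1 : f n t @[n --> \oo] --> l t by exact: lu_cvg_pointwise.
  have h2 : f n.+1 t @[n --> \oo] --> F t.
    apply/cvgrPdist_le => e e0.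
    have e1 : 0 < e / (t + 1) by rewrite divr_gt0//; lra.
    have [N hN] := f'F' t _ e1; exists N => // n /= Nn.
    rewrite distrC -[X in `|X|](_ : (f n.+1 t - F t) - (f n.+1 0 - F 0) = _); last first.
      by rewrite f0 F0 subrr subr0.
    apply: (@le_trans _ _ (e / (t + 1) * t - e / (t + 1) * 0)); last first.
      by rewrite mulr0 subr0 mulrAC ler_pdivrMr ?ler_pM2l//; lra.
    have dl s : is_derive s (1:R) (fun s : R => e / (t + 1) * s) (e / (t + 1)).
      by apply: is_derive_eq (drvM (drvC (e / (t + 1)) s) (is_derive_id s 1)) _; rewrite mulr1 mulr0 addr0.
    apply: (norm_increment hdot (u := fun s => f n.+1 s - F s) (u' := fun s => f' n s - F' s)
      (g := fun s => e / (t + 1) * s) (g' := fun=> e / (t + 1)) t0) => [s /andP[s0 _]|s _|s /andP[s0 _]|s /andP[s0 st]].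
    - exact: drv_cont (is_deriveB (df n s s0) (dF s s0)).
    - exact: drv_cont (dl s).
    - exact: is_deriveB (df n s (ltW s0)) (dF s (ltW s0)).
    - by apply: hN => //; rewrite !ltW.
  have h3 : f n.+1 t @[n --> \oo] --> l t.
    by have := h1; rewrite -(cvg_shiftS (fun n => f n t)).
  by rewrite -(cvg_lim (@norm_hausdorff _ _) h2) -(cvg_lim (@norm_hausdorff _ _) h3).
pose U t := u0 + prim (vl \o @nonneg_part R) t.
pose Vv t := v0 + prim (fun s => G (nonneg_part s) (ul (nonneg_part s)) (vl (nonneg_part s))) t.
have dU t : 0 <= t -> is_derive t (1:R) U (vl t).
  move=> t0; apply: is_derive_eq (is_deriveD (is_derive_cst _ _ _) ((hprim _ cvl).2 t t0)) _.
  by rewrite add0r /= npE.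
have dV t : 0 <= t -> is_derive t (1:R) Vv (G t (ul t) (vl t)).
  move=> t0; apply: is_derive_eq (is_deriveD (is_derive_cst _ _ _) ((hprim _ cgl).2 t t0)) _.
  by rewrite add0r /= !npE.
have U0 : U 0 = u0 by rewrite /U (hprim _ cvl).1 addr0.
have V0 : Vv 0 = v0 by rewrite /Vv (hprim _ cgl).1 addr0.
have gl : lu_cvg g (fun t => G t (ul t) (vl t)).
  move=> T e e0; have [L L0 hL] := Glip T.
  have e1 : 0 < e / (2 * L + 1) by rewrite divr_gt0//; lra.
  have [N1 h1] := hul T _ e1; have [N2 h2] := hvl T _ e1.
  exists (maxn N1 N2) => n; rewrite geq_max => /andP[n1 n2] t tT.
  apply: le_trans (hL t tT _ _ _ _) _.
  apply: (@le_trans _ _ (L * (e / (2 * L + 1) + e / (2 * L + 1)))).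
    by rewrite ler_wpM2l// lerD ?h1 ?h2.
  have L1 : 0 < 2 * L + 1 by lra.
  have -> : L * (e / (2 * L + 1) + e / (2 * L + 1)) = (2 * L * e) / (2 * L + 1).
    by field; rewrite gt_eqF.
  by rewrite ler_pdivrMr//; lra.
have eU := identify u v U vl ul u0 u00 U0 du dU hul hvl.
have eV := identify v g Vv (fun t => G t (ul t) (vl t)) vl v0 v00 V0 dv dV hvl gl.
exists U, Vv; split => // t t0; first by rewrite eV//; exact: dU.
by rewrite eU// eV//; exact: dV.
Qed.
End Picard.

(** * Spectral projections *)

Section Resolution.
Variables (R : realType) (H : completeNormedModType R) (dot : {dot H for idfun}).
Hypothesis hdot : hilbert_form dot.
Variable E : resolution_of_identity dot.
Local Notation mu := (spec_measure E).
Local Notation P := (Defs.proj E).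
Implicit Types (S T : set (measurableTypeR R)) (x y z : H).

Lemma proj_idem S x : measurable S -> P S (P S x) = P S x.
Proof. by move=> mS; rewrite -projI// setIid. Qed.

Lemma proj_mass S x : measurable S -> mu x S = (`|P S x| ^+ 2)%:E.
Proof.
move=> mS; rewrite spec_measureE//; congr (_%:E).
by rewrite -hdot -{1}(proj_idem x mS) (proj_sym E mS).
Qed.

Lemma proj_eq0 S x : measurable S -> mu x S = 0%E -> P S x = 0.
Proof.
move=> mS; rewrite proj_mass// => -[] /eqP.
by rewrite sqrf_eq0 normr_eq0 => /eqP.
Qed.

Lemma spec_total x : mu x setT = (`|x| ^+ 2)%:E.
Proof. by rewrite proj_mass// projT. Qed.

Lemma projD S x y : measurable S -> P S (x + y) = P S x + P S y.
Proof. by move=> mS; rewrite -[x]scale1r proj_linear// !scale1r. Qed.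

Lemma proj0 S : measurable S -> P S 0 = 0.
Proof.
by move=> mS; have := projD 0 0 mS; rewrite addr0 => /eqP; rewrite -subr_eq0 opprD addrA subrr add0r oppr_eq0 => /eqP.
Qed.

Lemma projZ S (a : R) x : measurable S -> P S (a *: x) = a *: P S x.
Proof. by move=> mS; rewrite -[_ *: _]addr0 proj_linear// proj0// addr0. Qed.

Lemma projN S x : measurable S -> P S (- x) = - P S x.
Proof. by move=> mS; rewrite -scaleN1r projZ// scaleN1r. Qed.

Lemma projB S x y : measurable S -> P S (x - y) = P S x - P S y.
Proof. by move=> mS; rewrite projD// projN. Qed.

Lemma proj_norm_le S x : measurable S -> `|P S x| <= `|x|.
Proof.
move=> mS; rewrite -(@ler_pXn2r _ 2)// ?nnegrE// -lee_fin -proj_mass// -spec_total.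
by apply: le_measure; rewrite ?inE.
Qed.

Lemma proj_set0 x : P set0 x = 0.
Proof. by apply: proj_eq0 => //; rewrite measure0. Qed.

Lemma spec_proj S T x : measurable S -> measurable T -> mu (P S x) T = mu x (T `&` S).
Proof. by move=> mS mT; rewrite !proj_mass ?projI//; exact: measurableI. Qed.

Lemma proj_compl_mass S x : measurable S -> P S x = x -> mu x (~` S) = 0%E.
Proof.
move=> mS xE; have mC := measurableC mS.
by rewrite -xE spec_proj// setIC setICr measure0.
Qed.

(** Polarization. *)
Lemma sym_form_eq0 (F : H -> H) :
  (forall x y, F (x + y) = F x + F y) -> (forall x y, dot (F x) y = dot x (F y)) ->
  (forall x, dot (F x) x = 0) -> forall x, F x = 0.
Proof.
move=> FD Fs F0 x; apply: (dot_ext hdot) => z; rewrite dot0l.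
have := F0 (x + z); rewrite FD !dotE !F0 (Fs z x) (dotC dot z); lra.
Qed.

(** The defect of additivity is a symmetric map with vanishing quadratic form. *)
Lemma projU S T x : measurable S -> measurable T -> S `&` T = set0 ->
  P (S `|` T) x = P S x + P T x.
Proof.
move=> mS mT ST; have mU := measurableU _ _ mS mT.
apply/eqP; rewrite -subr_eq0; apply/eqP; move: x.
apply: (sym_form_eq0 (F := fun x => P (S `|` T) x - (P S x + P T x))) => [x y|x y|x].
- by rewrite !projD// [RHS]addrACA -opprD (addrACA (P S x)).
- by rewrite !dotE !proj_sym.
- have : (mu x (S `|` T) = mu x S + mu x T)%E := measureU (mu x) mS mT ST.
  rewrite !spec_measureE// -EFinD => -[h]; rewrite !dotE h; lra.
Qed.

Lemma proj_orth S T x y : measurable S -> measurable T -> S `&` T = set0 ->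
  dot (P S x) (P T y) = 0.
Proof.
by move=> mS mT ST; rewrite (proj_sym E mS) -(projI E mS mT) ST proj_set0 dot0r.
Qed.

(** Countable additivity is available for the measures <E x, x> only, but the
    norm of x - P (S n) x is the square root of a difference of such masses. *)
Lemma proj_cvg (S : nat -> set (measurableTypeR R)) x : (forall n, measurable (S n)) ->
  {homo S : n m / (n <= m)%N >-> n `<=` m} -> P (\bigcup_n S n) x = x ->
  P (S n) x @[n --> \oo] --> x.
Proof.
move=> mS hS xE; have mU := bigcup_measurable (fun n _ => mS n).
have : (mu x \o S) n @[n --> \oo] --> mu x (\bigcup_n S n).
  by apply: nondecreasing_cvg_mu => // n m nm; rewrite subsetEset; exact: hS.
rewrite proj_mass// xE.
have -> : mu x \o S = (fun n => (`|P (S n) x| ^+ 2)%:E) by apply/funext => n /=; rewrite proj_mass.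
move=> /fine_cvgP[_ /cvgrPdist_lt h].
apply/cvgrPdist_lt => e e0.
have := h _ (exprn_gt0 2 e0); apply: filterS => n /= hn.
rewrite -(@ltr_pXn2r _ 2)// ?nnegrE ?(ltW e0)//.
apply: le_lt_trans hn; apply: le_trans (ler_norm _).
have PP : dot (P (S n) x) (P (S n) x) = dot x (P (S n) x).
  by rewrite (proj_sym E (mS n)) proj_idem.
rewrite (normsqD hdot) dotNr normrN -PP hdot; lra.
Qed.
End Resolution.

(** * Operators given by spectral integrals *)

Section Operator.
Variables (R : realType) (H : completeNormedModType R).
Variable A : unbounded_operator H.
Implicit Types x y : H.

Lemma domD x y : dom A x -> dom A y -> dom A (x + y).
Proof. by move=> dx dy; rewrite -[x]scale1r; exact: domP. Qed.
Lemma domZ (a : R) x : dom A x -> dom A (a *: x).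
Proof. by move=> dx; rewrite -[_ *: _]addr0; exact: domP dx (dom0 A). Qed.
Lemma domN x : dom A x -> dom A (- x).
Proof. by move=> dx; rewrite -scaleN1r; exact: domZ. Qed.
Lemma domB x y : dom A x -> dom A y -> dom A (x - y).
Proof. by move=> dx dy; apply: domD => //; exact: domN. Qed.
Lemma appD x y : dom A x -> dom A y -> A (x + y) = A x + A y.
Proof. by move=> dx dy; rewrite -[x]scale1r Defs.appP// !scale1r. Qed.
Lemma app0 : A 0 = 0.
Proof. by have /eqP := appD (dom0 A) (dom0 A); rewrite addr0 -subr_eq0 opprD addrA subrr add0r oppr_eq0 => /eqP. Qed.
Lemma appZ (a : R) x : dom A x -> A (a *: x) = a *: A x.
Proof. by move=> dx; rewrite -[in LHS](addr0 (a *: x)) (Defs.appP _ dx (dom0 A)) app0 addr0. Qed.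
Lemma appN x : dom A x -> A (- x) = - A x.
Proof. by move=> dx; rewrite -scaleN1r appZ// scaleN1r. Qed.
Lemma appB x y : dom A x -> dom A y -> A (x - y) = A x - A y.
Proof. by move=> dx dy; rewrite (appD dx (domN dy)) appN. Qed.
End Operator.

Section SpectralOperator.
Variables (R : realType) (H : completeNormedModType R) (dot : {dot H for idfun}).
Hypothesis hdot : hilbert_form dot.
Variable E : resolution_of_identity dot.
Local Notation mu := (spec_measure E).
Local Notation P := (Defs.proj E).
Variables (f : measurableTypeR R -> R) (B : unbounded_operator H).
Hypothesis mf : measurable_fun setT f.
Hypothesis hB : spectral_integral E f B.
Implicit Types (S T : set (measurableTypeR R)) (x y z : H).

Let mEf : measurable_fun [set: measurableTypeR R] (EFin \o f).
Proof. exact/measurable_EFinP. Qed.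

Let mf2 : measurable_fun [set: measurableTypeR R] (fun l : measurableTypeR R => ((f l) ^+ 2)%:E).
Proof. by apply/measurable_EFinP; apply: measurable_funX. Qed.

(** Since |f| <= 1 + f^2 and the spectral measure is finite. *)
Lemma spec_integrable x : dom B x -> (mu x).-integrable setT (EFin \o f).
Proof.
move=> /hB.1 fin.
apply: (@le_integrable _ _ _ (mu x) setT measurableT _ (fun l => (1 + (f l) ^+ 2)%:E)) => //.
  move=> l _ /=; rewrite lee_fin (ger0_norm (_ : 0 <= 1 + f l ^+ 2)) ?addr_ge0 ?sqr_ge0//.
  have := ler_norm (f l); have := sqr_ge0 (`|f l| - 1); have := real_normK (num_real (f l)).
  move: (normr_ge0 (f l)); nra.
apply/integrableP; split.
  apply/measurable_EFinP; apply: measurable_funD; first exact: measurable_cst.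
  exact: measurable_funX.
rewrite (eq_integral (fun l : measurableTypeR R => 1%:E + ((f l) ^+ 2)%:E)%E); last first.
  by move=> l _; rewrite -EFinD gee0_abs// lee_fin addr_ge0// sqr_ge0.
rewrite ge0_integralD//; last by move=> l _; rewrite lee_fin sqr_ge0.
by rewrite integral_cst// spec_total// lte_add_pinfty// -EFinM ltry.
Qed.

Lemma ge0_integral_proj S x (g : measurableTypeR R -> \bar R) : measurable S ->
  measurable_fun setT g -> (forall l, 0 <= g l)%E ->
  (\int[mu (P S x)]_l g l = \int[mu x]_(l in S) g l)%E.
Proof.
move=> mS mg g0.
have mC := measurableC mS.
have null : mu (P S x) (~` S) = 0%E by apply: proj_compl_mass => //; exact: proj_idem.
rewrite (ge0_negligible_integral mC _ _ _ null)// setTD setCK; apply: eq_measure_integral => T mT TS.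
by rewrite spec_proj// setIidl.
Qed.

Lemma dom_proj S x : measurable S -> dom B x -> dom B (P S x).
Proof.
move=> mS /hB.1 fin; apply/hB.1; rewrite ge0_integral_proj//; last first.
  by move=> l; rewrite lee_fin sqr_ge0.
apply: le_lt_trans fin; apply: ge0_subset_integral => //.
by move=> l _; rewrite lee_fin sqr_ge0.
Qed.

Lemma dom_bounded S C x : measurable S -> (forall l, S l -> `|f l| <= C) ->
  dom B (P S x).
Proof.
move=> mS fC; apply/hB.1; rewrite ge0_integral_proj//; last first.
  by move=> l; rewrite lee_fin sqr_ge0.
apply: (@le_lt_trans _ _ (\int[mu x]_(l in S) (C ^+ 2)%:E)%E).
  apply: ge0_le_integral => //.
  - by move=> l _; rewrite lee_fin sqr_ge0.
  - exact: measurable_funS mf2.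
  - move=> l Sl; rewrite lee_fin -(real_normK (num_real (f l))) ler_pXn2r ?nnegrE ?fC//.
    exact: le_trans (fC l Sl).
rewrite integral_cst// proj_mass// -EFinM ltry//.
Qed.

(** The spectral measure of x lives on S. *)
Lemma slice_integral S (a b : R) x : measurable S -> (forall l, S l -> a <= f l <= b) ->
  P S x = x -> dom B x ->
  a * `|x| ^+ 2 <= \int[mu x]_l f l /\ \int[mu x]_l f l <= b * `|x| ^+ 2.
Proof.
move=> mS fab xE dx; have int := spec_integrable dx.
have mC := measurableC mS.
have null : mu x (~` S) = 0%E by exact: proj_compl_mass.
have -> : \int[mu x]_l f l = \int[mu x]_(l in S) f l.
  rewrite /Rintegral; congr fine.
  by rewrite (negligible_integral mC _ int null)// setTD setCK.
have intS : (mu x).-integrable S (EFin \o f) by apply: integrableS int.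
have intc (c : R) : (mu x).-integrable S (EFin \o cst c).
  apply: measurable_bounded_integrable => //.
  - by rewrite proj_mass// ltry.
  - exists `|c|; split; first exact: num_real.
    by move=> M cM l _ /=; exact: ltW.
have mass : fine (mu x S) = `|x| ^+ 2 by rewrite proj_mass// xE.
split.
- rewrite -mass -Rintegral_cst//; apply: (le_Rintegral mS (intc a) intS) => l Sl.
  by have /andP[] := fab l Sl.
- rewrite -mass -Rintegral_cst//; apply: (le_Rintegral mS intS (intc b)) => l Sl.
  by have /andP[] := fab l Sl.
Qed.

(** Stated with sums because a difference of spectral measures is a signed measure. *)
Lemma Rintegral_relation x1 x2 x3 x4 :
  (forall S, measurable S -> (mu x1 S + mu x2 S = mu x3 S + mu x4 S)%E) ->
  dom B x1 -> dom B x2 -> dom B x3 -> dom B x4 ->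
  \int[mu x1]_l f l + \int[mu x2]_l f l = \int[mu x3]_l f l + \int[mu x4]_l f l.
Proof.
move=> h d1 d2 d3 d4.
have i1 := spec_integrable d1; have i2 := spec_integrable d2.
have i3 := spec_integrable d3; have i4 := spec_integrable d4.
have fin y : dom B y -> (\int[mu y]_l (f l)%:E)%E \is a fin_num.
  by move=> dy; apply: integrable_fin_num => //; exact: spec_integrable.
rewrite /Rintegral -!fineD ?fin//; congr fine.
rewrite -(integral_measure_add measurableT i1 i2) -(integral_measure_add measurableT i3 i4).
by apply: eq_measure_integral => S mS _; exact: (etrans (measure_addE _ _ _) (etrans (h S mS) (esym (measure_addE _ _ _)))).
Qed.

Let polar x z := hB.2 x z.

Variables (S_ : nat -> set (measurableTypeR R)) (C_ : nat -> R).
Hypothesis mS_ : forall n, measurable (S_ n).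
Hypothesis fC_ : forall n l, S_ n l -> `|f l| <= C_ n.
Hypothesis S_cvg : forall x, P (S_ n) x @[n --> \oo] --> x.

(** Vectors in the range of a bounded piece of the spectrum lie in the domain and are dense. *)
Lemma dom_dense_ext x y : (forall z, dom B z -> dot x z = dot y z) -> x = y.
Proof.
move=> h; apply: (dot_ext hdot) => z.
have c w : dot w (P (S_ n) z) @[n --> \oo] --> dot w z.
  by apply: cvg_dot => //; exact: cvg_cst.
have e : (fun n => dot x (P (S_ n) z)) = (fun n => dot y (P (S_ n) z)).
  by apply/funext => n; apply: h; exact: (dom_bounded _ (mS_ n) (@fC_ n)).
have cx := c x; rewrite e in cx.
by rewrite -(cvg_lim (@Rhausdorff R) cx) -(cvg_lim (@Rhausdorff R) (c y)).
Qed.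

Lemma spectral_sym x z : dom B x -> dom B z -> dot (B x) z = dot x (B z).
Proof.
move=> dx dz; rewrite (dotC dot x) !polar// (addrC z x); congr (_ * (_ - _)).
rewrite /Rintegral; congr fine; apply: eq_measure_integral => T mT _.
have -> : z - x = - (x - z) by rewrite opprB.
by rewrite !proj_mass// projN// normrN.
Qed.

(** By polarization this is an identity between integrals of f, which holds because
    the corresponding identity between spectral measures does. *)
Lemma spectral_commute S x : measurable S -> dom B x -> B (P S x) = P S (B x).
Proof.
move=> mS dx; apply: dom_dense_ext => z dz.
have dPx := dom_proj mS dx; have dPz := dom_proj mS dz.
rewrite (proj_sym E mS) (polar dPx dz) (polar dx dPz); congr (_ * _).
suff : \int[mu (P S x + z)]_l f l + \int[mu (x - P S z)]_l f l =
   \int[mu (x + P S z)]_l f l + \int[mu (P S x - z)]_l f l by lra.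
apply: Rintegral_relation; [|exact: domD|exact: domB|exact: domD|exact: domB].
move=> T mT; rewrite !proj_mass// -!EFinD; congr (_%:E).
rewrite !projB// !projD//.
have TS w : P T (P S w) = P S (P T w) by rewrite -!projI// setIC.
have cross : dot (P T (P S x)) (P T z) = dot (P T x) (P T (P S z)).
  by rewrite !TS (proj_sym E mS).
rewrite !(normsqD hdot) !dotNr !normrN cross; lra.
Qed.

(** The symbol is within (b - a) / 2 of the midpoint of [a, b] on S. Only quadratic
    integrals being available, the norm is recovered by testing
    against a vector of the same length as x. *)
Lemma slice_estimate S (a b : R) x : measurable S -> a <= b ->
  (forall l, S l -> a <= f l <= b) -> P S x = x -> dom B x ->
  `|B x - ((a + b) / 2) *: x| <= (b - a) / 2 * `|x|.
Proof.
move=> mS ab fab xE dx.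
set y := B x - _.
have yE : P S y = y by rewrite /y projB// projZ// -spectral_commute// xE.
have dy : dom B y.
  rewrite -yE; apply: (@dom_bounded S (`|a| + `|b|) y mS) => l Sl.
  have /andP[h1 h2] := fab l Sl.
  have := ler_norm b; have := ler_norm (- a); rewrite normrN => h3 h4.
  have := normr_ge0 a; have := normr_ge0 b => h5 h6.
  rewrite ler_norml; apply/andP; split; lra.
have [y0|y0] := eqVneq y 0; first by rewrite y0 normr0 mulr_ge0// divr_ge0// subr_ge0.
have [x0|x0] := eqVneq x 0; first by rewrite /y x0 app0 scaler0 subr0 normr0 mulr0.
have ny : 0 < `|y| by rewrite normr_gt0.
have nx : 0 < `|x| by rewrite normr_gt0.
(* testing against the multiple of y that has the length of x *)
pose z := (`|x| / `|y|) *: y.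
have dz : dom B z by exact: domZ.
have zE : P S z = z by rewrite projZ// yE.
have nz : `|z| = `|x| by rewrite normrZ ger0_norm ?divr_ge0// divfK// gt_eqF.
have exz : P S (x + z) = x + z by rewrite projD// xE zE.
have exz' : P S (x - z) = x - z by rewrite projB// xE zE.
have [_ h1] := slice_integral mS fab exz (domD dx dz).
have [h2 _] := slice_integral mS fab exz' (domB dx dz).
have e1 : dot y z = `|x| * `|y| by rewrite dotZr hdot expr2 mulrA divfK ?gt_eqF.
have e2 : dot y z = dot (B x) z - (a + b) / 2 * dot x z by rewrite dotBl dotZl.
move: e2; rewrite e1 (polar dx dz) => e2.
have e3 : 2 * dot x z = `|x + z| ^+ 2 - `|x| ^+ 2 - `|x| ^+ 2.
  by rewrite (normsqD hdot) nz; ring.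
have e4 : `|x - z| ^+ 2 = 4 * `|x| ^+ 2 - `|x + z| ^+ 2.
  by rewrite !(normsqD hdot) dotNr normrN nz; ring.
rewrite -(ler_pM2l nx).
rewrite e4 in h2.
have e5 : dot x z = (`|x + z| ^+ 2 - `|x| ^+ 2 - `|x| ^+ 2) / 2 by rewrite -e3; field.
rewrite e5 in e2; move: h1 h2 e2; rewrite expr2.
move: (`|x + z| ^+ 2) => w; nra.
Qed.
End SpectralOperator.

(** * Truncation of an operator and its square root *)

(** If D and m are additive under cutting an interval, and D is at most C h m on every interval of
    length h, then D 0 N is at most C N / 2^n times the total mass for every n. *)
Lemma halving (R : realType) (D m : R -> R -> R) (C N : R) : 0 <= N ->
  (forall a h, 0 <= h -> D a (h + h) = D a h + D (a + h) h) ->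
  (forall a h, 0 <= h -> m a (h + h) = m a h + m (a + h) h) ->
  (forall a h, 0 <= a -> 0 <= h -> a + h <= N -> `|D a h| <= C * h * m a h) ->
  D 0 N = 0.
Proof.
move=> N0 hD hm hb.
have step k : forall a h, 0 <= a -> 0 <= h -> a + 2 ^+ k * h <= N ->
    `|D a (2 ^+ k * h)| <= C * h * m a (2 ^+ k * h).
  elim: k => [|k IH] a h a0 h0 ahN.
    by rewrite expr0 mul1r in ahN *; exact: hb.
  have e : 2 ^+ k.+1 * h = 2 ^+ k * h + 2 ^+ k * h by rewrite exprS; ring.
  have h20 : 0 <= 2 ^+ k * h by rewrite mulr_ge0// exprn_ge0.
  rewrite e addrA in ahN; rewrite e hD// hm// mulrDr.
  apply: le_trans (ler_normD _ _) _; apply: lerD; apply: IH => //; last by rewrite addr_ge0.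
  by apply: le_trans ahN; rewrite lerDl.
have lim : C * (N * 2^-1 ^+ n) * m 0 N @[n --> \oo] --> C * (N * 0) * m 0 N.
  apply: cvgM; last exact: cvg_cst.
  apply: cvgM; first exact: cvg_cst.
  apply: cvgM; first exact: cvg_cst.
  by apply: cvg_expr; rewrite ger0_norm ?invr_ge0// invf_lt1// ltr1n.
rewrite mulr0 mulr0 mul0r in lim.
apply/eqP; rewrite -normr_eq0 eq_le normr_ge0 andbT.
rewrite -[leRHS](cvg_lim (@Rhausdorff R) lim); apply: limr_ge; first by apply/cvg_ex; eexists; exact: lim.
apply: nearW => k.
have k2 : 2 ^+ k != 0 :> R by rewrite expf_neq0.
have e : 2 ^+ k * (N * 2^-1 ^+ k) = N by rewrite exprVn; field.
have hk : 0 <= N * 2^-1 ^+ k by rewrite mulr_ge0// exprn_ge0// invr_ge0.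
by have := step k 0 _ (lexx 0) hk; rewrite e add0r => /(_ (lexx N)).
Qed.

(** What the proof uses of the spectral theory of A and its square root B:
    bounded projections P n, increasing to the identity, that reduce both
    operators, with B^2 = A on their ranges and both operators closed. *)
Record sqrt_truncation (R : realType) (H : completeNormedModType R)
    (dot : {dot H for idfun}) (A B : unbounded_operator H) (P : nat -> H -> H) :
    Prop := {
  truncP : forall n (a : R) x y, P n (a *: x + y) = a *: P n x + P n y;
  trunc_sym : forall n x y, dot (P n x) y = dot x (P n y);
  truncI : forall n k x, P n (P k x) = P (minn n k) x;
  trunc_cvg : forall x, P n x @[n --> \oo] --> x;
  trunc_domA : forall n x, dom A (P n x);
  trunc_domB : forall n x, dom B (P n x);
  truncA : forall n x, dom A x -> A (P n x) = P n (A x);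
  truncB : forall n x, dom B x -> B (P n x) = P n (B x);
  trunc_bound : forall n, exists C, forall x, `|B (P n x)| <= C * `|x|;
  trunc_square : forall n x, B (B (P n x)) = A (P n x);
  symB : forall x y, dom B x -> dom B y -> dot (B x) y = dot x (B y);
  closedA : forall x y, A (P n x) @[n --> \oo] --> y -> dom A x /\ A x = y;
  closedB : forall x C, (forall n, `|B (P n x)| <= C) -> dom B x
}.

Section SquareRoot.
Variables (R : realType) (H : completeNormedModType R) (dot : {dot H for idfun}).
Hypothesis hdot : hilbert_form dot.
Variables (A B : unbounded_operator H).
Hypotheses (Asa : self_adjoint dot A) (Ann : nonnegative dot A).
Variable E : resolution_of_identity dot.
Local Notation mu := (spec_measure E).
Local Notation P := (Defs.proj E).
Let rt (l : measurableTypeR R) : R := l `^ 2^-1.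
Let idR (l : measurableTypeR R) : R := l.
Hypotheses (hA : spectral_integral E idR A) (hB : spectral_integral E rt B).
Implicit Types (S T : set (measurableTypeR R)) (x y z : H) (a h : R).

Let mid : measurable_fun setT idR.
Proof. exact: measurable_id. Qed.

Let mrt : measurable_fun setT rt.
Proof. exact: measurable_powR. Qed.

Let rt0 l : 0 <= rt l.
Proof. exact: powR_ge0. Qed.

Let rt2 (l : R) : 0 <= l -> rt l ^+ 2 = l.
Proof. by move=> l0; rewrite /rt powR12_sqrt// sqr_sqrtr. Qed.

(** On such a set A is at most b < 0, against <A y, y> >= 0. *)
Let negative_mass S b x : measurable S -> b < 0 -> (exists a, forall l, S l -> a <= l <= b) ->
  P S x = 0.
Proof.
move=> mS b0 [a0 hS].
pose a := Num.min a0 b.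
have ab : a <= b by rewrite /a ge_min lexx orbT.
have hS' l : S l -> a <= idR l <= b.
  by move=> /hS /andP[h1 h2]; rewrite h2 andbT /a ge_min h1.
pose W n : set (measurableTypeR R) := `[- n%:R, n%:R]%classic.
have mW n : measurable (W n) by exact: measurable_itv.
have bW n l : W n l -> `|idR l| <= n%:R.
  by rewrite /W /= in_itv /= -ler_norml.
have cW z : P (W n) z @[n --> \oo] --> z.
  apply: (proj_cvg hdot) => //.
    move=> n m nm l; rewrite /W /= !in_itv /= => /andP[h1 h2].
    have nm' : n%:R <= m%:R :> R by rewrite ler_nat.
    by apply/andP; split; lra.
  rewrite (_ : \bigcup_n W n = setT) ?projT//.
  rewrite -subTset => l _; exists (Num.truncn `|l|).+1 => //.
  rewrite /W /= in_itv /= -ler_norml; apply: ltW; exact: truncnS_gt.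
pose y := P S x.
have yE : P S y = y by exact: proj_idem.
have dy : dom A y.
  apply: (dom_bounded hdot mid hA (C := `|a| + `|b|)) => // l /hS' /andP[h1 h2].
  have := ler_norm b; have := ler_norm (- a); rewrite normrN => h3 h4.
  have := normr_ge0 a; have := normr_ge0 b => h5 h6.
  by rewrite ler_norml; apply/andP; split; lra.
have est := slice_estimate hdot mid hA mW bW cW mS ab hS' yE dy.
have pos := Ann dy.
apply/eqP; rewrite -normr_eq0 -/y; apply/eqP.
have h1 : dot (A y) y = dot (A y - ((a + b) / 2) *: y) y + (a + b) / 2 * `|y| ^+ 2.
  by rewrite dotBl dotZl hdot; ring.
have h2 := dot_le_norm hdot (A y - ((a + b) / 2) *: y) y.
have h3 := ler_norm (dot (A y - ((a + b) / 2) *: y) y).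
have h4 : `|A y - ((a + b) / 2) *: y| * `|y| <= (b - a) / 2 * `|y| * `|y| by rewrite ler_wpM2r.
have h5 := normr_ge0 y.
move: h1 h2 h3 h4 pos; move: (dot (A y) y) (dot _ y) (`|A y - _|) => u v w h1 h2 h3 h4 pos.
have : b * `|y| ^+ 2 >= 0 by rewrite expr2; rewrite expr2 in h1; lra.
rewrite nmulr_rge0// => h6.
by apply/eqP; rewrite -sqrf_eq0 eq_le h6 sqr_ge0.
Qed.

Let neg_zero x : P `]-oo, 0[%classic x = 0.
Proof.
(* compact intervals exhausting the negative half-line *)
pose W n : set (measurableTypeR R) := [set l : R | - n.+1%:R <= l <= - n.+1%:R^-1].
have mW n : measurable (W n).
  by rewrite (_ : W n = `[- n.+1%:R, - n.+1%:R^-1]%classic)//; apply/seteqP; split=> l; rewrite /W /= in_itv.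
have WE : \bigcup_n W n = `]-oo, (0:R)[%classic.
  apply/seteqP; split => l.
    move=> [n _]; rewrite /W /= in_itv /= => /andP[_ h]; apply: le_lt_trans h _.
    by rewrite oppr_lt0 invr_gt0.
  rewrite /= in_itv /= => l0.
  pose n := maxn (Num.truncn `|l|) (Num.truncn (`|l|^-1)).
  have l1 : `|l| = - l by rewrite ltr0_norm.
  exists n => //; apply/andP; split.
    rewrite lerNl -l1; apply: (@le_trans _ _ (Num.truncn `|l|).+1%:R).
      by apply: ltW; exact: truncnS_gt.
    by rewrite ler_nat ltnS leq_maxl.
  rewrite lerNr -l1 -[leRHS]invrK lef_pV2 ?posrE ?invr_gt0 ?normr_gt0 ?lt_eqF//.
  apply: (@le_trans _ _ (Num.truncn `|l|^-1).+1%:R).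
    by apply: ltW; exact: truncnS_gt.
  by rewrite ler_nat ltnS leq_maxr.
have mU : measurable (`]-oo, (0:R)[%classic : set (measurableTypeR R)) by exact: measurable_itv.
pose y := P `]-oo, 0[%classic x.
have cy : P (W n) y @[n --> \oo] --> y.
  apply: (proj_cvg hdot mW); last by rewrite WE proj_idem.
  move=> n m nm l; rewrite /W /= => /andP[h1 h2].
  have nm' : n.+1%:R <= m.+1%:R :> R by rewrite ler_nat.
  have nm2 : m.+1%:R^-1 <= n.+1%:R^-1 :> R by rewrite lef_pV2 ?posrE.
  by rewrite (le_trans _ h1) ?lerN2// (le_trans h2)// lerN2.
have zW n : P (W n) y = 0.
  apply: (negative_mass (b := - n.+1%:R^-1)) => //.
  by exists (- n.+1%:R).
rewrite -/y -(cvg_lim (@norm_hausdorff _ _) cy).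
by rewrite (_ : (fun n => P (W n) y) = fun=> 0) ?lim_cst//; apply/funext.
Qed.

(* the slice where sqrt l is in [a, a + h[ *)
Let sl a h : set (measurableTypeR R) := [set l : R | [&& 0 <= l, a <= rt l & rt l < a + h]].
Let S_ n := sl 0 n%:R.
Let Pn n x := P (S_ n) x.

Let msl a h : measurable (sl a h).
Proof.
have -> : sl a h = (`[0, +oo[%classic : set (measurableTypeR R)) `&` (setT `&` rt @^-1` `[a, a + h[%classic).
  rewrite setTI; apply/seteqP; split=> l; rewrite /sl /= !in_itv /= andbT.
    by move=> /and3P[-> -> ->].
  by move=> [-> /andP[-> ->]].
apply: measurableI; first exact: measurable_itv.
by apply: mrt => //; exact: measurable_itv.
Qed.

Let mS n : measurable (S_ n). Proof. exact: msl. Qed.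

Let slU a h : 0 <= h -> sl a (h + h) = sl a h `|` sl (a + h) h.
Proof.
move=> h0; apply/seteqP; split=> l; rewrite /sl /=.
  move=> /and3P[-> h1 h2]; have [h3|h3] := ltP (rt l) (a + h); [left|right].
    by rewrite h1.
  by rewrite /= -addrA h2.
by move=> [/and3P[-> h1 h2]|/and3P[-> h1 h2]] /=; apply/andP; split; lra.
Qed.

Let slI a h : sl a h `&` sl (a + h) h = set0.
Proof.
rewrite -subset0 => l [/and3P[_ _ h1] /and3P[_ h2 _]].
by move: (lt_le_trans h1 h2); rewrite ltxx.
Qed.

Let Sbound n l : S_ n l -> `|rt l| <= n%:R.
Proof. by rewrite /S_ /sl /= add0r => /and3P[_ h1 h2]; rewrite ger0_norm// ltW. Qed.

Let Sbound2 n l : S_ n l -> `|idR l| <= n%:R ^+ 2.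
Proof.
rewrite /S_ /sl /= add0r => /and3P[l0 h1 h2].
by rewrite /idR ger0_norm// -[leLHS]rt2// ler_pXn2r ?nnegrE// ltW.
Qed.

Let Smono : {homo S_ : n m / (n <= m)%N >-> n `<=` m}.
Proof.
move=> n m nm l; rewrite /S_ /sl /= !add0r => /and3P[-> -> h2] /=.
by apply: lt_le_trans h2 _; rewrite ler_nat.
Qed.

Let Scup : \bigcup_n S_ n = (`[0, +oo[%classic : set (measurableTypeR R)).
Proof.
apply/seteqP; split=> l; first by move=> [n _]; rewrite /S_ /sl /= in_itv /= andbT => /and3P[].
rewrite /= in_itv /= andbT => l0; exists (Num.truncn (rt l)).+1 => //.
by rewrite /S_ /sl /= l0 rt0 add0r truncnS_gt.
Qed.

Let Scvg x : Pn n x @[n --> \oo] --> x.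
Proof.
apply: (proj_cvg hdot mS Smono); rewrite Scup.
have m1 : measurable (`]-oo, (0:R)[%classic : set (measurableTypeR R)) by exact: measurable_itv.
have m2 : measurable (`[(0:R), +oo[%classic : set (measurableTypeR R)) by exact: measurable_itv.
have := projU hdot E x m1 m2; rewrite neg_zero add0r => <-.
  rewrite -[RHS](projT E); congr (P _ x).
  rewrite -subTset => l _; rewrite /= !in_itv /= andbT.
  by case: (ltP l 0); [left|right].
rewrite -subset0 => l; rewrite /= !in_itv /= andbT => -[h1 h2].
by move: (lt_le_trans h1 h2); rewrite ltxx.
Qed.

Let sl_sub a h n : 0 <= a -> a + h <= n%:R -> sl a h `<=` S_ n.
Proof.
move=> a0 ahn l; rewrite /S_ /sl /= add0r => /and3P[-> h1 h2]; rewrite rt0 /=; exact: lt_le_trans ahn.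
Qed.

Let slice_bound a h x n : 0 <= a -> 0 <= h -> a + h <= n%:R -> let y := P (sl a h) x in
  [/\ dom A y, dom B y, `|B y - (a + h / 2) *: y| <= h * `|y| &
   `|A y - ((a + h / 2) ^+ 2 + h ^+ 2 / 4) *: y| <= h * n%:R * `|y|].
Proof.
move=> a0 h0 ahn /=; set y := P _ x.
have yE : P (sl a h) y = y by exact: proj_idem.
have sub := sl_sub a0 ahn.
have dA : dom A y.
  by apply: (dom_bounded hdot mid hA (C := n%:R ^+ 2)) => // l /sub; exact: Sbound2.
have dB : dom B y.
  by apply: (dom_bounded hdot mrt hB (C := n%:R)) => // l /sub; exact: Sbound.
have ny := normr_ge0 y.
split => //.
  have ab : a <= a + h by lra.
  have fab l : sl a h l -> a <= rt l <= a + h by move=> /and3P[_ -> /ltW ->].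
  have := slice_estimate hdot mrt hB mS Sbound Scvg (msl a h) ab fab yE dB.
  have -> : (a + (a + h)) / 2 = a + h / 2 by field.
  move=> /le_trans; apply; rewrite ler_wpM2r//; lra.
have ab : a ^+ 2 <= (a + h) ^+ 2 by rewrite ler_pXn2r ?nnegrE//; lra.
have fab l : sl a h l -> a ^+ 2 <= idR l <= (a + h) ^+ 2.
  move=> /and3P[l0 h1 h2]; rewrite /idR -(rt2 l0).
  by rewrite !ler_pXn2r ?nnegrE ?(ltW h2)//; lra.
have := slice_estimate hdot mid hA mS Sbound2 Scvg (msl a h) ab fab yE dA.
have -> : (a ^+ 2 + (a + h) ^+ 2) / 2 = (a + h / 2) ^+ 2 + h ^+ 2 / 4 by field.
move=> /le_trans; apply; rewrite ler_wpM2r//; nra.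
Qed.

Let Bcomm S x : measurable S -> dom B x -> B (P S x) = P S (B x).
Proof. by move=> m dx; exact: (spectral_commute hdot mrt hB mS Sbound Scvg m dx). Qed.

Let Acomm S x : measurable S -> dom A x -> A (P S x) = P S (A x).
Proof. by move=> m dx; exact: (spectral_commute hdot mid hA mS Sbound2 Scvg m dx). Qed.

(** On a slice B is h-close to its midpoint a + h / 2, so |B y|^2 and, in the next lemma,
    <A y, y> agree with (a + h / 2)^2 |y|^2 up to O(h). *)
Let square_mass a h x n : 0 <= a -> 0 <= h -> a + h <= n%:R ->
  let y := P (sl a h) x in `| `|B y| ^+ 2 - (a + h / 2) ^+ 2 * `|y| ^+ 2| <= h * (3 * n%:R) * `|y| ^+ 2.
Proof.
move=> a0 h0 ahn /=; have [dA dB h1 _] := slice_bound x a0 h0 ahn.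
set y := P _ x in dA dB h1 *; set c := a + h / 2 in h1 *.
have c0 : 0 <= c by rewrite /c; lra.
have -> : `|B y| ^+ 2 - c ^+ 2 * `|y| ^+ 2 = (`|B y| - `|c *: y|) * (`|B y| + `|c *: y|).
  by rewrite normrZ (ger0_norm c0); ring.
have h4 : 0 <= `|B y| + `|c *: y| by rewrite addr_ge0.
rewrite normrM (ger0_norm h4).
have h2 : `| `|B y| - `|c *: y| | <= h * `|y| by exact: le_trans (ler_dist_dist _ _) h1.
have h3 : `|B y| + `|c *: y| <= 3 * n%:R * `|y|.
  have := ler_norm (`|B y| - `|c *: y|); rewrite normrZ (ger0_norm c0) in h2 *.
  have e : (h + 2 * c) * `|y| <= 3 * n%:R * `|y| by rewrite ler_wpM2r// /c; lra.
  lra.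
apply: le_trans (ler_pM (normr_ge0 _) h4 h2 h3) _.
by rewrite le_eqVlt; apply/orP; left; apply/eqP; ring.
Qed.

Let form_mass a h x n : 0 <= a -> 0 <= h -> a + h <= n%:R ->
  let y := P (sl a h) x in `|dot (A y) y - (a + h / 2) ^+ 2 * `|y| ^+ 2| <= h * (3 * n%:R) * `|y| ^+ 2.
Proof.
move=> a0 h0 ahn /=; have [dA dB _ h1] := slice_bound x a0 h0 ahn.
set y := P _ x in dA dB h1 *.
have -> : dot (A y) y - (a + h / 2) ^+ 2 * `|y| ^+ 2 =
    dot (A y - ((a + h / 2) ^+ 2 + h ^+ 2 / 4) *: y) y + h ^+ 2 / 4 * `|y| ^+ 2.
  by rewrite dotBl dotZl hdot; ring.
apply: le_trans (ler_normD _ _) _.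
have h2 : 0 <= h ^+ 2 / 4 * `|y| ^+ 2 by rewrite mulr_ge0// ?divr_ge0 ?sqr_ge0.
rewrite (ger0_norm h2).
have h3 := dot_le_norm hdot (A y - ((a + h / 2) ^+ 2 + h ^+ 2 / 4) *: y) y.
have h4 : `|A y - ((a + h / 2) ^+ 2 + h ^+ 2 / 4) *: y| * `|y| <= h * n%:R * `|y| * `|y| by rewrite ler_wpM2r.
have h5 : h ^+ 2 / 4 * `|y| ^+ 2 <= h * n%:R * `|y| ^+ 2.
  by rewrite ler_wpM2r ?sqr_ge0//; nra.
have h6 : 0 <= h * n%:R * `|y| ^+ 2 by rewrite !mulr_ge0// sqr_ge0.
apply: le_trans (lerD (le_trans h3 h4) h5) _; move: h6; rewrite !expr2; lra.
Qed.

Let form_eq n x : dot (A (Pn n x)) (Pn n x) = `|B (Pn n x)| ^+ 2.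
Proof.
pose D a h := `|B (P (sl a h) x)| ^+ 2 - dot (A (P (sl a h) x)) (P (sl a h) x).
pose m a h := `|P (sl a h) x| ^+ 2.
have dAsl a h : dom A (P (sl a h) x).
  have [k hk] : exists k, sl a h `<=` S_ k.
    exists (Num.truncn (a + h)).+1 => l; rewrite /S_ /sl /= add0r => /and3P[-> _ h2].
    by rewrite rt0 /= (lt_trans h2)// truncnS_gt.
  by apply: (dom_bounded hdot mid hA (C := k%:R ^+ 2)) => // l /hk; exact: Sbound2.
have dBsl a h : dom B (P (sl a h) x).
  have [k hk] : exists k, sl a h `<=` S_ k.
    exists (Num.truncn (a + h)).+1 => l; rewrite /S_ /sl /= add0r => /and3P[-> _ h2].
    by rewrite rt0 /= (lt_trans h2)// truncnS_gt.
  by apply: (dom_bounded hdot mrt hB (C := k%:R)) => // l /hk; exact: Sbound.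
have orth a h y z : dot (P (sl a h) y) (P (sl (a + h) h) z) = 0.
  by apply: (proj_orth hdot) => //; exact: slI.
suff : D 0 n%:R = 0 by rewrite /D /Pn /S_; lra.
apply: (@halving R D m (6 * n%:R) n%:R) => // [a h h0|a h h0|a h a0 h0 ahn].
- rewrite /D slU// (projU hdot) ?slI// appD// (appD (dAsl a h) (dAsl (a + h) h)).
  have o1 : dot (B (P (sl a h) x)) (B (P (sl (a + h) h) x)) = 0.
    by rewrite -(proj_idem E x (msl a h)) -(proj_idem E x (msl (a + h) h)) (Bcomm (msl a h) (dBsl a h)) (Bcomm (msl (a + h) h) (dBsl (a + h) h)) orth.
  have o2 : dot (A (P (sl a h) x)) (P (sl (a + h) h) x) = 0.
    by rewrite -(proj_idem E x (msl a h)) (Acomm (msl a h) (dAsl a h)) orth.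
  have o3 : dot (A (P (sl (a + h) h) x)) (P (sl a h) x) = 0.
    by rewrite -(proj_idem E x (msl (a + h) h)) (Acomm (msl (a + h) h) (dAsl (a + h) h)) dotC orth.
  rewrite (normsqD hdot) !dotE o1 o2 o3; ring.
- by rewrite /m slU// (projU hdot) ?slI// (normsqD hdot) orth; ring.
- have h1 := square_mass x a0 h0 ahn; have h2 := form_mass x a0 h0 ahn.
  rewrite /D /m; move: h1 h2 => /=.
  move: (`|B _| ^+ 2) (dot _ _) (`|P _ _| ^+ 2) => u v w.
  rewrite !ler_norml => /andP[h1 h2] /andP[h3 h4]; apply/andP; split; lra.
Qed.

Let mrt2 : measurable_fun setT (fun l : measurableTypeR R => (rt l ^+ 2)%:E).
Proof. by apply/measurable_EFinP; exact: measurable_funX. Qed.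

Let mass_integral n x : (\int[mu x]_(l in S_ n) (rt l ^+ 2)%:E = (`|B (Pn n x)| ^+ 2)%:E)%E.
Proof.
pose m a h := `|P (sl a h) x| ^+ 2.
have slb a h l : sl a h l -> rt l <= `|a + h|.
  by move=> /and3P[_ _ /ltW h2]; exact: le_trans (ler_norm _).
have int a h : (mu x).-integrable (sl a h) (EFin \o (fun l => rt l ^+ 2)).
  apply: measurable_bounded_integrable => //.
  - by rewrite proj_mass// ltry.
  - by apply: measurable_funS (measurable_funX 2 mrt).
  - exists (`|a + h| ^+ 2); split; first exact: num_real.
    move=> M cM l /slb h1 /=; apply: le_trans (ltW cM).
    by rewrite ger0_norm ?sqr_ge0// ler_pXn2r ?nnegrE.
have intc a h (c : R) : (mu x).-integrable (sl a h) (EFin \o cst c).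
  apply: measurable_bounded_integrable => //.
  - by rewrite proj_mass// ltry.
  - exists `|c|; split; first exact: num_real.
    by move=> M cM l _ /=; exact: ltW.
pose I a h := \int[mu x]_(l in sl a h) (rt l ^+ 2).
pose D a h := `|B (P (sl a h) x)| ^+ 2 - I a h.
have massE a h : fine (mu x (sl a h)) = m a h by rewrite proj_mass.
have dBsl a h : dom B (P (sl a h) x).
  by apply: (dom_bounded hdot mrt hB (C := `|a + h|)) => // l /slb; rewrite (ger0_norm (rt0 l)).
have orth a h y z : dot (P (sl a h) y) (P (sl (a + h) h) z) = 0.
  by apply: (proj_orth hdot) => //; exact: slI.
have fin : (\int[mu x]_(l in S_ n) (rt l ^+ 2)%:E)%E \is a fin_num.
  exact: integrable_fin_num (int 0 n%:R).
rewrite -(fineK fin); congr (_%:E); rewrite -/(Rintegral _ _ _) -/(I 0 n%:R).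
suff : D 0 n%:R = 0 by rewrite /D /Pn /S_; lra.
apply: (@halving R D m (6 * n%:R) n%:R) => // [a h h0|a h h0|a h a0 h0 ahn].
- rewrite /D slU// (projU hdot) ?slI// (appD (dBsl a h) (dBsl (a + h) h)).
  have o1 : dot (B (P (sl a h) x)) (B (P (sl (a + h) h) x)) = 0.
    by rewrite -(proj_idem E x (msl a h)) -(proj_idem E x (msl (a + h) h)) (Bcomm (msl a h) (dBsl a h)) (Bcomm (msl (a + h) h) (dBsl (a + h) h)) orth.
  rewrite (normsqD hdot) o1 /I slU// Rintegral_setU//; first ring.
    by rewrite -slU//; exact: int.
  by apply/disj_setPS; rewrite slI.
- by rewrite /m slU// (projU hdot) ?slI// (normsqD hdot) orth; ring.
- have h1 := square_mass x a0 h0 ahn.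
  have l1 : a ^+ 2 * m a h <= I a h.
    rewrite -massE -Rintegral_cst//; apply: (le_Rintegral (msl a h) (intc a h _) (int a h)) => l /and3P[_ h2 _].
    change (a ^+ 2 <= rt l ^+ 2); by rewrite ler_pXn2r ?nnegrE.
  have l2 : I a h <= (a + h) ^+ 2 * m a h.
    rewrite -massE -Rintegral_cst//; apply: (le_Rintegral (msl a h) (int a h) (intc a h _)) => l /and3P[_ _ /ltW h2].
    change (rt l ^+ 2 <= (a + h) ^+ 2); by rewrite ler_pXn2r ?nnegrE// addr_ge0.
  have m0 : 0 <= m a h by exact: sqr_ge0.
  have b1 : (a + h / 2) ^+ 2 * m a h <= a ^+ 2 * m a h + h * n%:R * m a h.
    by rewrite -mulrDl ler_wpM2r//; nra.
  have b2 : (a + h) ^+ 2 * m a h <= (a + h / 2) ^+ 2 * m a h + h * (2 * n%:R) * m a h.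
    by rewrite -mulrDl ler_wpM2r//; nra.
  have b3 : 0 <= h * n%:R * m a h by rewrite !mulr_ge0.
  rewrite /D; move: h1 => /=; rewrite -/(m a h).
  rewrite !ler_norml => /andP[h1 h2]; apply/andP; split; lra.
Qed.

(** Here P n projects on the spectral values l with 0 <= l and sqrt l < n. The negative part of the
    spectrum carries no mass by nonnegativity. The slices are cut on the scale of sqrt l, so that
    both symbols l and sqrt l oscillate by O(h) on a slice of width h below level n, and [halving]
    compares <A y, y>, |B y|^2 and the integral of l. *)
Lemma spectral_sqrt_truncation : sqrt_truncation dot A B Pn.
Proof.
have dAn n x : dom A (Pn n x).
  exact: (dom_bounded hdot mid hA _ (mS n) (@Sbound2 n)).
have dBn n x : dom B (Pn n x).
  exact: (dom_bounded hdot mrt hB _ (mS n) (@Sbound n)).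
have PnD n x y : Pn n (x + y) = Pn n x + Pn n y by exact: projD.
have Pnsym n x y : dot (Pn n x) y = dot x (Pn n y) by exact: proj_sym.
have Pnn n x : Pn n (Pn n x) = Pn n x by exact: proj_idem.
have BPn n x : B (Pn n x) = Pn n (B (Pn n x)).
  by rewrite -{1}(Pnn n x); exact: (Bcomm (mS n) (dBn n x)).
have Bsym x y : dom B x -> dom B y -> dot (B x) y = dot x (B y).
  exact: (spectral_sym hdot hB).
have Asym x y : dom A x -> dom A y -> dot (A x) y = dot x (A y).
  exact: (spectral_sym hdot hA).
have dBB n x : dom B (B (Pn n x)) by rewrite BPn.
have keyB n x y : dot (B (B (Pn n x))) y = dot (B (Pn n x)) (B (Pn n y)).
  have wE : Pn n (B (Pn n x)) = B (Pn n x) by rewrite -BPn.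
  move: (B (Pn n x)) wE (dBB n x) => w wE dw.
  rewrite -[in LHS]wE BPn Pnsym wE; apply: Bsym => //.
have APn n x : A (Pn n x) = Pn n (A (Pn n x)).
  by rewrite -{1}(Pnn n x); exact: (Acomm (mS n) (dAn n x)).
have keyA n x y : dot (A (Pn n x)) y = dot (A (Pn n x)) (Pn n y).
  by rewrite {1}APn Pnsym.
split => //.
- by move=> n a x y; rewrite /Pn proj_linear.
- move=> n k x; rewrite /Pn -projI//; congr (P _ x).
  apply/seteqP; split=> l; rewrite /S_ /sl /= !add0r.
    move=> [/and3P[-> -> h1] /and3P[_ _ h2]] /=.
    by rewrite /minn; case: ifP.
  move=> /and3P[-> -> h] /=; split; apply: lt_le_trans h _; rewrite ler_nat.
    exact: geq_minl.
  exact: geq_minr.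
- by move=> n x dx; exact: Acomm.
- by move=> n x dx; exact: Bcomm.
- move=> n; exists (2 * n%:R) => x.
  have h1 : n%:R = n%:R :> R by [].
  have nn : 0 + n%:R <= n%:R :> R by rewrite add0r.
  have [_ _ h2 _] := slice_bound x (lexx 0) (ler0n _ n) nn.
  rewrite -/(S_ n) -/(Pn n x) add0r in h2.
  have h3 : `|Pn n x| <= `|x| by exact: proj_norm_le.
  have -> : B (Pn n x) = (B (Pn n x) - (n%:R / 2) *: Pn n x) + (n%:R / 2) *: Pn n x by rewrite subrK.
  apply: le_trans (ler_normD _ _) _; rewrite normrZ ger0_norm ?divr_ge0//.
  have h4 : n%:R * `|Pn n x| <= n%:R * `|x| by rewrite ler_wpM2l.
  have h5 := normr_ge0 (Pn n x); have h6 : 0 <= n%:R * `|Pn n x| by rewrite mulr_ge0.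
  lra.
- move=> n x; apply/eqP; rewrite -subr_eq0; apply/eqP; move: x.
  apply: (sym_form_eq0 hdot (F := fun x => B (B (Pn n x)) - A (Pn n x))) => [x y|x y|x].
  + by rewrite PnD !appD// opprD addrACA.
  + have s1 : dot (B (B (Pn n x))) y = dot x (B (B (Pn n y))).
      by rewrite keyB (dotC dot x) keyB dotC.
    have s2 : dot (A (Pn n x)) y = dot x (A (Pn n y)).
      by rewrite (keyA n x y) (dotC dot x) (keyA n y x) (Asym _ _ (dAn n x) (dAn n y)) dotC.
    by rewrite dotBl dotBr s1 s2.
  + by rewrite dotBl keyB keyA form_eq hdot subrr.
- move=> x y hy; apply/(Asa.2 x y) => z dz.
  have c1 : dot (A z) (Pn n x) @[n --> \oo] --> dot (A z) x.
    by apply: cvg_dot => //; exact: cvg_cst.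
  have c2 : dot z (A (Pn n x)) @[n --> \oo] --> dot z y.
    by apply: cvg_dot => //; exact: cvg_cst.
  have e : (fun n => dot (A z) (Pn n x)) = (fun n => dot z (A (Pn n x))).
    by apply/funext => n; exact: Asym.
  rewrite e in c1.
  by rewrite -(cvg_lim (@Rhausdorff R) c1) -(cvg_lim (@Rhausdorff R) c2).
- move=> x C hC; apply/hB.1.
  have mneg : measurable (`]-oo, (0:R)[%classic : set (measurableTypeR R)) by exact: measurable_itv.
  have null : mu x `]-oo, 0[%classic = 0%E by rewrite proj_mass// neg_zero normr0 expr0n.
  have p0 l : (0 <= (rt l ^+ 2)%:E)%E by rewrite lee_fin sqr_ge0.
  rewrite (ge0_negligible_integral mneg measurableT mrt2 (fun l _ => p0 l) null).
  have -> : setT `\` `]-oo, 0[%classic = \bigcup_n S_ n.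
    rewrite Scup; apply/seteqP; split => l; rewrite /= !in_itv /= andbT.
      by move=> [_ /negP]; rewrite -leNgt.
    by move=> l0; split => //; apply/negP; rewrite -leNgt.
  have cvgI := @ge0_nondecreasing_set_cvg_integral _ _ R S_ (fun l => (rt l ^+ 2)%:E) (mu x)
    _ mS (fun n => measurable_funS measurableT (@subsetT _ _) mrt2) (fun _ l _ => p0 l).
  rewrite -(cvg_lim (@ereal_hausdorff R) (cvgI _)); last first.
    by move=> n m nm; rewrite subsetEset; exact: Smono.
  apply: (@le_lt_trans _ _ ((C ^+ 2)%:E)); last exact: ltry.
  apply: lime_le.
    apply: cvgP; apply: cvgI.
    by move=> n m nm; rewrite subsetEset; exact: Smono.
  apply: nearW => n; rewrite mass_integral lee_fin ler_pXn2r ?nnegrE//.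
  exact: le_trans (hC n).
Qed.
End SquareRoot.

(** * The truncated equation *)

Section PowerLipschitz.
Variable R : realType.

(** Only one of the two points has to stay away from 0: if y < lo / 2 the
    points are at least lo / 2 apart and the boundedness of the power suffices; otherwise the mean value theorem
    applies. *)
Lemma powR_lipschitz (a lo hi : R) : 0 < a -> 0 < lo -> lo <= hi ->
  exists2 L, 0 <= L & forall x y, lo <= x <= hi -> 0 <= y <= hi ->
    `|x `^ a - y `^ a| <= L * `|x - y|.
Proof.
move=> a0 lo0 lohi.
have hi0 : 0 < hi by exact: lt_le_trans lohi.
have l20 : 0 < lo / 2 by rewrite divr_gt0.
pose K := (lo / 2) `^ (a - 1) + hi `^ (a - 1).
exists (a * K + hi `^ a * (2 / lo)).
  exact: addr_ge0 (mulr_ge0 (ltW a0) (addr_ge0 (powR_ge0 _ _) (powR_ge0 _ _)))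
    (mulr_ge0 (powR_ge0 _ _) (divr_ge0 (ler0n _ _) (ltW lo0))).
move=> x y /andP[x1 x2] /andP[y1 y2].
have [yl|yl] := leP (lo / 2) y; last first.
  have d : lo / 2 <= `|x - y| by apply: le_trans (ler_norm _); lra.
  rewrite mulrDl -[leLHS]add0r; apply: lerD.
    exact: mulr_ge0 (mulr_ge0 (ltW a0) (addr_ge0 (powR_ge0 _ _) (powR_ge0 _ _))) (normr_ge0 _).
  apply: (@le_trans _ _ (hi `^ a)).
    have pw := ge0_ler_powR (ltW a0).
    have px : x `^ a <= hi `^ a by apply: pw => //; rewrite nnegrE; lra.
    have py : y `^ a <= hi `^ a by apply: pw => //; rewrite nnegrE; lra.
    have := powR_ge0 x a; have := powR_ge0 y a => h1 h2.
    by rewrite ler_norml; apply/andP; split; lra.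
  rewrite -mulrA ler_peMr ?powR_ge0//.
  rewrite -[leLHS](_ : 2 / lo * (lo / 2) = 1); last by field; rewrite gt_eqF.
  by rewrite ler_wpM2l// divr_ge0// ltW.
have [r hr e] : exists2 r, Num.min x y <= r <= Num.max x y & x `^ a - y `^ a = (a * r `^ (a - 1)) * (x - y).
  apply: (mvt_between (G := fun s => s `^ a) (g := fun r => a * r `^ (a - 1))) => r /andP[r1 _].
  apply: is_derive1_powR; apply: lt_le_trans r1; rewrite lt_min; apply/andP; split; lra.
rewrite e normrM ler_wpM2r//.
have r1 : lo / 2 <= r by case/andP: hr => h _; apply: le_trans h; rewrite le_min; apply/andP; split; lra.
have r2 : r <= hi by case/andP: hr => _ h; apply: (le_trans h); rewrite ge_max x2 y2.
have r0 : 0 < r by exact: lt_le_trans r1.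
rewrite ger0_norm ?mulr_ge0 ?powR_ge0 ?(ltW a0)//.
rewrite -[leLHS]addr0; apply: lerD; last first.
  exact: mulr_ge0 (powR_ge0 _ _) (divr_ge0 (ler0n _ _) (ltW lo0)).
rewrite ler_wpM2l ?(ltW a0)// /K.
have [a1|a1] := leP 0 (a - 1).
  apply: ler_wpDl; first exact: powR_ge0.
  by apply: (ge0_ler_powR a1) => //; rewrite nnegrE ltW.
apply: ler_wpDr; first exact: powR_ge0.
rewrite -[a - 1]opprK !(powRN _ (- (a - 1))) lef_pV2 ?posrE ?powR_gt0//.
by apply: ge0_ler_powR => //; rewrite ?nnegrE ?ltW//; lra.
Qed.

Lemma clamp_lipschitz (lo hi r s : R) :
  `|Num.max lo (Num.min r hi) - Num.max lo (Num.min s hi)| <= `|r - s|.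
Proof.
wlog rs : r s / s <= r.
  move=> h; case/orP: (le_total s r) => [/h//|/h]; rewrite distrC (distrC s); exact.
rewrite ger0_norm ?subr_ge0; last first.
  by rewrite ge_max !le_max lexx /= le_min !ge_min lexx rs !orbT.
rewrite (ger0_norm (_ : 0 <= r - s)) ?subr_ge0// lerBlDr ge_max; apply/andP; split.
  by apply: (@le_trans _ _ (Num.max lo (Num.min s hi))); [rewrite le_max lexx|rewrite lerDr subr_ge0].
have [h|h] := leP s hi.
  rewrite ge_min; apply/orP; left; rewrite -lerBlDl opprB addrC subrK.
  by rewrite le_max; apply/orP; right.
rewrite ge_min; apply/orP; right.
apply: (@le_trans _ _ (Num.max lo hi)); first by rewrite le_max lexx orbT.
by rewrite lerDr subr_ge0.
Qed.
End PowerLipschitz.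

Section BoundedLinear.
Variables (R : realType) (H K : completeNormedModType R).

Lemma deriv_bounded_linear (L : H -> K) (C : R) (u : R -> H) (t : R) du :
  (forall (a : R) x y, L (a *: x + y) = a *: L x + L y) ->
  (forall x, `|L x| <= C * `|x|) ->
  is_derive t (1:R) u du -> is_derive t (1:R) (fun s => L (u s)) (L du).
Proof.
move=> Llin Lb /is_deriveP hu; apply/is_deriveP => e e0.
have LB x y : L (x - y) = L x - L y.
  by rewrite addrC -scaleN1r Llin scaleN1r addrC.
have L0 : L 0 = 0 by rewrite -(subrr 0) LB subrr.
have LZ a x : L (a *: x) = a *: L x by rewrite -[_ *: _]addr0 Llin L0 addr0.
have C0 : 0 < `|C| + 1 by rewrite ltr_pwDr.
have [r r0 hr] := hu (e / (`|C| + 1)) (divr_gt0 e0 C0).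
exists r => // s st; rewrite -LB -LZ -LB; apply: le_trans (Lb _) _.
apply: (@le_trans _ _ ((`|C| + 1) * (e / (`|C| + 1) * `|s - t|))).
  apply: (@le_trans _ _ ((`|C| + 1) * `|u s - u t - (s - t) *: du|)).
    by rewrite ler_wpM2r// (le_trans (ler_norm _))// lerDl.
  by rewrite ler_wpM2l ?(ltW C0)// hr.
by rewrite mulrA (mulrCA _ e) divff ?gt_eqF// mulr1.
Qed.
End BoundedLinear.

Section Truncation.
Variables (R : realType) (H : completeNormedModType R) (dot : {dot H for idfun}).
Hypothesis hdot : hilbert_form dot.
Variables (A B : unbounded_operator H) (P : nat -> H -> H).
Hypothesis tr : sqrt_truncation dot A B P.
Variable nu : R.
Hypothesis coercive : forall x, dom A x -> nu * `|x| ^+ 2 <= dot (A x) x.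
Implicit Types (x y : H) (n k : nat) (t s T : R).

(** The truncated square root, a bounded symmetric operator on the whole space. *)
Definition Sn n x := B (P n x).

Lemma truncK n x : P n (P n x) = P n x.
Proof. by rewrite (truncI tr) minnn. Qed.

Lemma truncD n x y : P n (x + y) = P n x + P n y.
Proof. by rewrite -[x]scale1r (truncP tr) !scale1r. Qed.

Lemma trunc0 n : P n 0 = 0.
Proof.
by have /eqP := truncD n 0 0; rewrite addr0 -subr_eq0 opprD addrA subrr add0r oppr_eq0 => /eqP.
Qed.

Lemma truncZ n (a : R) x : P n (a *: x) = a *: P n x.
Proof. by rewrite -[_ *: _]addr0 (truncP tr) trunc0 !addr0. Qed.

Lemma truncBr n x y : P n (x - y) = P n x - P n y.
Proof. by rewrite truncD -scaleN1r truncZ scaleN1r. Qed.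

Lemma trunc_norm n x : `|P n x| <= `|x|.
Proof.
have [->|h] := eqVneq (P n x) 0; first by rewrite normr0.
have h0 : 0 < `|P n x| by rewrite normr_gt0.
rewrite -(ler_pM2l h0) -expr2 -(hdot (P n x)).
have -> : dot (P n x) (P n x) = dot (P n x) x by rewrite (trunc_sym tr n x (P n x)) truncK (dotC dot x).
by apply: le_trans (ler_norm _) _; exact: dot_le_norm.
Qed.

Lemma Sn_linear n (a : R) x y : Sn n (a *: x + y) = a *: Sn n x + Sn n y.
Proof. by rewrite /Sn (truncP tr) Defs.appP//; exact: (trunc_domB tr). Qed.

Lemma SnZ n (a : R) x : Sn n (a *: x) = a *: Sn n x.
Proof. by rewrite /Sn truncZ appZ//; exact: (trunc_domB tr). Qed.

Lemma SnB n x y : Sn n (x - y) = Sn n x - Sn n y.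
Proof. by rewrite /Sn truncBr appB//; exact: (trunc_domB tr). Qed.

Lemma trunc_Sn n x : P n (Sn n x) = Sn n x.
Proof. by rewrite /Sn -(truncB tr) ?truncK//; exact: (trunc_domB tr). Qed.

Lemma Sn_trunc n x : Sn n (P n x) = Sn n x.
Proof. by rewrite /Sn truncK. Qed.

Lemma Sn_sym n x y : dot (Sn n x) y = dot x (Sn n y).
Proof.
rewrite -trunc_Sn (trunc_sym tr) /Sn (symB tr); try exact: (trunc_domB tr).
by rewrite (trunc_sym tr) -/(Sn n y) trunc_Sn.
Qed.

Lemma Sn_square n x : Sn n (Sn n x) = A (P n x).
Proof. by rewrite {1}/Sn trunc_Sn /Sn (trunc_square tr). Qed.

Lemma Sn_form n x : dot (Sn n (Sn n x)) x = `|Sn n x| ^+ 2.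
Proof. by rewrite Sn_sym hdot. Qed.

Lemma Sn_coercive n x : nu * `|P n x| ^+ 2 <= `|Sn n x| ^+ 2.
Proof.
have <- : dot (A (P n x)) (P n x) = `|Sn n x| ^+ 2.
  by rewrite -Sn_square Sn_sym Sn_trunc hdot.
exact: coercive (trunc_domA tr n x).
Qed.

Lemma Sn_coercive2 n x : nu * `|Sn n x| ^+ 2 <= `|Sn n (Sn n x)| ^+ 2.
Proof. by rewrite -{1}(trunc_Sn n x); exact: Sn_coercive. Qed.

Lemma Sn_bound n : exists2 C, 0 <= C & forall x, `|Sn n x| <= C * `|x|.
Proof.
have [C hC] := trunc_bound tr n; exists `|C| => // x.
by apply: le_trans (hC x) _; rewrite ler_wpM2r// ler_norm.
Qed.

Variables (g p eps m : R) (ell : R -> R) (u0 u1 : H).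
Hypotheses (g0 : 0 < g) (eps0 : 0 < eps) (m0 : 0 < m) (p0 : 0 <= p).
Hypothesis ell0 : forall T, exists2 lo, 0 < lo & forall t, 0 <= t <= T -> lo <= ell t.
Hypothesis ellm : forall t, 0 <= t -> ell t <= m.
Hypothesis ellc : continuous (ell \o @nonneg_part R).

(** The stiffness r^(2 g), with r clamped between ell t and m. *)
Definition cutoff t (r : R) := (Num.max (ell t) (Num.min r m)) `^ (2 * g).

(** The clamp is what makes the nonlinearity globally Lipschitz on bounded time intervals: it keeps the argument of
    the power away from 0, where r^(2 g) may fail to be Lipschitz, and bounds
    the factor of the linear term. *)
Lemma truncated_solution n : exists u v : R -> H,
  [/\ u 0 = P n u0, v 0 = P n u1,
  forall t, 0 <= t -> is_derive t (1:R) u (v t)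
  & forall t, 0 <= t -> is_derive t (1:R) v
     (eps^-1 *: (- (((1 + t) `^ p)^-1 *: v t) - cutoff t `|Sn n (u t)| *: Sn n (Sn n (u t))))].
Proof.
have [K K0 hK] := Sn_bound n.
have g2 : 0 < 2 * g by rewrite mulr_gt0.
have Sc (w : R -> H) : continuous w -> continuous (fun t => Sn n (w t)).
  move=> cw t; apply/cvgrPdist_lt => e e0.
  have K1 : 0 < K + 1 by rewrite ltr_wpDl.
  have /cvgrPdist_lt/(_ _ (divr_gt0 e0 K1)) := cw t.
  apply: filterS => s hs; rewrite -SnB; apply: le_lt_trans (hK _) _.
  apply: (@le_lt_trans _ _ ((K + 1) * `|w t - w s|)); first by rewrite ler_wpM2r// lerDl.
  by rewrite mulrC -ltr_pdivlMr.
apply: (picard hdot (G := fun t x y => eps^-1 *: (- (((1 + t) `^ p)^-1 *: y)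
    - cutoff t `|Sn n x| *: Sn n (Sn n x)))) => [w z cw cz t|T].
  have n1 : 0 < 1 + nonneg_part t by have := nonneg_part_ge0 t; lra.
  have cq : {for t, continuous (fun s : R => (1 + nonneg_part s) `^ p)}.
    apply: (continuous_comp (f := @nonneg_part R) (g := fun s => (1 + s) `^ p)).
      exact: nonneg_part_continuous.
    exact: drv_cont (deriv_drag p (nonneg_part_ge0 t)).
  have cut : {for t, continuous (fun s : R => cutoff (nonneg_part s) `|Sn n (w s)|)}.
    have cc : {for t, continuous (fun s : R => Num.max (ell (nonneg_part s)) (Num.min `|Sn n (w s)| m))}.
      apply: continuous_max; first exact: ellc.
      apply: continuous_min; last exact: cst_continuous.
      exact: continuous_comp (Sc w cw t) (@norm_continuous _ _ _).
    apply: (continuous_comp cc (g := fun r => r `^ (2 * g))).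
    have pos : 0 < Num.max (ell (nonneg_part t)) (Num.min `|Sn n (w t)| m).
      have [lo lo0 hlo] := ell0 (nonneg_part t).
      rewrite lt_max; apply/orP; left; apply: lt_le_trans lo0 (hlo _ _).
      by rewrite nonneg_part_ge0 lexx.
    exact: drv_cont (is_derive1_powR (2 * g) pos).
  apply: cvgZr; apply: cvgB.
    apply: cvgN; apply: cvgZ; last exact: cz.
    by apply: cvgV => //; rewrite gt_eqF// powR_gt0.
  by apply: cvgZ => //; exact: Sc (Sc w cw) t.
have [lo lo0 hlo] := ell0 T.
have [T0|T0] := leP 0 T; last first.
  exists 0 => // t /andP[t0 tT]; by move: (le_lt_trans (le_trans t0 tT) T0); rewrite ltxx.
have lom : lo <= m.
  by apply: le_trans (ellm (lexx 0)); apply: hlo; rewrite lexx.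
have [L L0 hL] := powR_lipschitz g2 lo0 lom.
pose M := m `^ (2 * g).
exists (eps^-1 * (1 + M * K ^+ 2 + L * K ^+ 2 * m)).
  rewrite mulr_ge0 ?invr_ge0 ?(ltW eps0)// addr_ge0//; last by rewrite !mulr_ge0 ?sqr_ge0// ltW.
  by rewrite addr_ge0// mulr_ge0 ?sqr_ge0// powR_ge0.
move=> t /[dup] tT /andP[t0 t1] x y x' y'.
have rng r : 0 <= r -> lo <= Num.max (ell t) (Num.min r m) <= m.
  move=> r0; rewrite ge_max ellm// ge_min lexx orbT !andbT.
  by rewrite le_max hlo.
have cM r : 0 <= r -> cutoff t r <= M.
  move=> /rng /andP[h1 h2]; apply: (ge0_ler_powR (ltW g2)) => //.
    by rewrite nnegrE (le_trans (ltW lo0)).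
  by rewrite nnegrE ltW.
have cl r s : 0 <= r -> 0 <= s -> `|cutoff t r - cutoff t s| <= L * `|r - s|.
  move=> r0 s0; apply: le_trans (hL _ _ (rng r r0) _) _.
    by have /andP[h1 ->] := rng s s0; rewrite andbT (le_trans (ltW lo0)).
  by rewrite ler_wpM2l// clamp_lipschitz.
have SS z : `|Sn n (Sn n z)| <= K ^+ 2 * `|z|.
  by apply: le_trans (hK _) _; rewrite expr2 -mulrA ler_wpM2l.
(* the factor A v is evaluated at the argument with the smaller norm *)
have key a b : `|Sn n b| <= m -> `|cutoff t `|Sn n a| *: Sn n (Sn n a) - cutoff t `|Sn n b| *: Sn n (Sn n b)|
    <= (M * K ^+ 2 + L * K ^+ 2 * m) * `|a - b|.
  move=> bm.
  have -> : cutoff t `|Sn n a| *: Sn n (Sn n a) - cutoff t `|Sn n b| *: Sn n (Sn n b) =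
    cutoff t `|Sn n a| *: Sn n (Sn n (a - b)) + (cutoff t `|Sn n a| - cutoff t `|Sn n b|) *: Sn n (Sn n b).
    by rewrite !SnB scalerBr scalerBl subrKA.
  apply: le_trans (ler_normD _ _) _; rewrite mulrDl; apply: lerD; rewrite normrZ.
    rewrite (ger0_norm (powR_ge0 _ _)) -[leRHS]mulrA.
    by apply: ler_pM => //; rewrite ?powR_ge0// ?cM.
  have -> : L * K ^+ 2 * m * `|a - b| = (L * (K * `|a - b|)) * (K * m) by ring.
  apply: ler_pM => //.
    apply: le_trans (cl _ _ (normr_ge0 _) (normr_ge0 _)) _; rewrite ler_wpM2l//.
    by apply: le_trans (ler_dist_dist _ _) _; rewrite -SnB.
  by apply: le_trans (hK _) _; rewrite ler_wpM2l.
have main a b : `|cutoff t `|Sn n a| *: Sn n (Sn n a) - cutoff t `|Sn n b| *: Sn n (Sn n b)|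
    <= (M * K ^+ 2 + L * K ^+ 2 * m) * `|a - b|.
  have [bm|bm] := leP `|Sn n b| m; first exact: key.
  have [am|am] := leP `|Sn n a| m; first by rewrite distrC (distrC a); exact: key.
  have -> : cutoff t `|Sn n a| = cutoff t `|Sn n b|.
    by rewrite /cutoff (min_idPr (ltW am)) (min_idPr (ltW bm)).
  rewrite -scalerBr -!SnB normrZ (ger0_norm (powR_ge0 _ _)).
  apply: (@le_trans _ _ (M * (K ^+ 2 * `|a - b|))).
    by apply: ler_pM => //; rewrite ?powR_ge0// ?cM.
  by rewrite mulrA ler_wpM2r// lerDl !mulr_ge0 ?sqr_ge0// ltW.
have ei : 0 <= eps^-1 by rewrite invr_ge0 ltW.
rewrite -(scalerBr eps^-1) normrZ (ger0_norm ei) -[leRHS]mulrA; apply: (ler_wpM2l ei).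
have -> : - (((1 + t) `^ p)^-1 *: y) - cutoff t `|Sn n x| *: Sn n (Sn n x) -
     (- (((1 + t) `^ p)^-1 *: y') - cutoff t `|Sn n x'| *: Sn n (Sn n x')) =
  - (((1 + t) `^ p)^-1 *: (y - y')) - (cutoff t `|Sn n x| *: Sn n (Sn n x) - cutoff t `|Sn n x'| *: Sn n (Sn n x')).
  rewrite scalerBr; move: (((1 + t) `^ p)^-1 *: y) (((1 + t) `^ p)^-1 *: y')
    (cutoff t `|Sn n x| *: Sn n (Sn n x)) (cutoff t `|Sn n x'| *: Sn n (Sn n x')) => a a' X X'.
  by rewrite [in LHS]opprD ![in LHS]opprK addrACA ![in RHS]opprB; congr (_ + _); exact: addrC.
apply: le_trans (ler_normD _ _) _; rewrite !normrN normrZ.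
have q1 : `|((1 + t) `^ p)^-1| <= 1.
  rewrite ger0_norm ?invr_ge0 ?powR_ge0// invf_le1 ?drag_ge1// powR_gt0//; lra.
have h1 := main x x'.
have h2 : `|((1 + t) `^ p)^-1| * `|y - y'| <= 1 * `|y - y'| by rewrite ler_wpM2r.
have h3 : 0 <= M * K ^+ 2 + L * K ^+ 2 * m.
  by rewrite addr_ge0 ?mulr_ge0 ?sqr_ge0 ?powR_ge0// ltW.
rewrite -[1 + M * K ^+ 2 + _]addrA.
have := normr_ge0 (x - x'); have := normr_ge0 (y - y'); move: h1 h2 h3.
move: (`|x - x'|) (`|y - y'|) (M * K ^+ 2 + _) => a b c h1 h2 h3 h4 h5.
have := mulr_ge0 h3 h4; have := mulr_ge0 h3 h5; rewrite mulrDl mul1r mulrDr; lra.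
Qed.
End Truncation.

(** * Galerkin approximations *)

Section Galerkin.
Variables (R : realType) (H : completeNormedModType R) (dot : {dot H for idfun}).
Hypothesis hdot : hilbert_form dot.
Variables (A B : unbounded_operator H) (P : nat -> H -> H).
Hypothesis tr : sqrt_truncation dot A B P.
Variable nu : R.
Hypothesis nu0 : 0 < nu.
Hypothesis coercive : forall x, dom A x -> nu * `|x| ^+ 2 <= dot (A x) x.
Implicit Types (x y : H) (n k : nat) (t s T : R).
Local Notation S := (Sn B P).

Lemma energy_identities n (p eps : R) (c : R -> R) (u v : R -> H) : 0 < eps ->
  (forall t, 0 <= t -> is_derive t (1:R) u (v t)) ->
  (forall t, 0 <= t -> is_derive t (1:R) v
     (eps^-1 *: (- (((1 + t) `^ p)^-1 *: v t) - c t *: S n (S n (u t))))) ->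
  kirchhoff_energies p nu eps (fun t => `|S n (u t)| ^+ 2)
    (fun t => dot (S n (u t)) (S n (v t))) (fun t => `|S n (S n (u t))| ^+ 2)
    (fun t => `|S n (v t)| ^+ 2) (fun t => `|v t| ^+ 2)
    (fun t => dot (S n (S n (u t))) (S n (S n (v t)))) c.
Proof.
move=> eps0 du dv.
have en : eps != 0 by rewrite gt_eqF.
have [C _ hC] := Sn_bound tr n.
have dS (w : R -> H) t dw : is_derive t (1:R) w dw -> is_derive t (1:R) (fun s => S n (w s)) (S n dw).
  by move=> h; exact: (deriv_bounded_linear (Sn_linear tr n) hC h).
have nsq (w : R -> H) : (fun t => `|w t| ^+ 2) = (fun t => dot (w t) (w t)).
  by apply/funext => t; rewrite hdot.
have S0 x : S n (- x) = - S n x by rewrite -scaleN1r (SnZ tr) scaleN1r.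
have sym := Sn_sym tr n.
split=> t t0; rewrite ?nsq.
- apply: is_derive_eq (deriv_dot hdot (dS _ _ _ (du t t0)) (dS _ _ _ (du t t0))) _.
  rewrite (dotC dot (S n (v t))); ring.
- apply: is_derive_eq (deriv_dot hdot (dS _ _ _ (du t t0)) (dS _ _ _ (dv t t0))) _.
  rewrite (SnZ tr) (SnB tr) S0 !(SnZ tr) !dotE !hdot -(sym (S n (u t)) (S n (S n (u t)))) hdot; field.
  by rewrite en gt_eqF// powR_gt0//; lra.
- apply: is_derive_eq (deriv_dot hdot (dS _ _ _ (dS _ _ _ (du t t0))) (dS _ _ _ (dS _ _ _ (du t t0)))) _.
  rewrite (dotC dot (S n (S n (v t)))); ring.
- apply: is_derive_eq (deriv_dot hdot (dS _ _ _ (dv t t0)) (dS _ _ _ (dv t t0))) _.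
  rewrite (SnZ tr) (SnB tr) S0 !(SnZ tr) !dotE !hdot.
  rewrite (sym (S n (S n (u t))) (S n (v t))) (dotC dot (S n (v t))).
  rewrite (sym (S n (S n (u t))) (S n (v t))); field.
  by rewrite en gt_eqF// powR_gt0//; lra.
- apply: is_derive_eq (deriv_dot hdot (dv t t0) (dv t t0)) _.
  rewrite !dotE !hdot (dotC dot (v t)) !(sym (S n (u t))); field.
  by rewrite en gt_eqF// powR_gt0//; lra.
- exact: sqr_ge0.
- by rewrite -sym; exact: dot_sqr_le.
- exact: dot_sqr_le.
- exact: (Sn_coercive2 hdot tr coercive).
Qed.

(** The component of v outside the range of P n satisfies a pure damping equation with
    zero data. *)
Lemma truncated_invariant n (p eps : R) (c : R -> R) (u v : R -> H) (u0 u1 : H) : 0 < eps ->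
  u 0 = P n u0 -> v 0 = P n u1 ->
  (forall t, 0 <= t -> is_derive t (1:R) u (v t)) ->
  (forall t, 0 <= t -> is_derive t (1:R) v
     (eps^-1 *: (- (((1 + t) `^ p)^-1 *: v t) - c t *: S n (S n (u t))))) ->
  forall t, 0 <= t -> P n (u t) = u t /\ P n (v t) = v t.
Proof.
move=> eps0 iu iv du dv.
pose Q x := x - P n x.
have Qlin (a : R) x y : Q (a *: x + y) = a *: Q x + Q y.
  by rewrite /Q (truncP tr) scalerBr opprD addrACA.
have Qb x : `|Q x| <= 2 * `|x|.
  apply: le_trans (ler_normB _ _) _; have := trunc_norm hdot tr n x; lra.
have dQ (w : R -> H) t dw : is_derive t (1:R) w dw -> is_derive t (1:R) (fun s => Q (w s)) (Q dw).
  by move=> h; exact: (deriv_bounded_linear Qlin Qb h).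
have QS x : Q (S n x) = 0 by rewrite /Q (trunc_Sn tr) subrr.
have Q0 : Q 0 = 0 by rewrite /Q (trunc0 tr) subrr.
have QP x : Q (P n x) = 0 by rewrite /Q (truncK tr) subrr.
have QZ (a : R) x : Q (a *: x) = a *: Q x by rewrite -[_ *: _]addr0 Qlin Q0 !addr0.
have QB x y : Q (x - y) = Q x - Q y.
  by rewrite addrC -scaleN1r Qlin scaleN1r addrC.
have vz t : 0 <= t -> Q (v t) = 0.
  move=> t0.
  pose df s := 2 * dot (Q (eps^-1 *: (- (((1 + s) `^ p)^-1 *: v s) - c s *: S n (S n (u s))))) (Q (v s)).
  have d s : 0 <= s -> is_derive s (1:R) (fun r => dot (Q (v r)) (Q (v r))) (df s).
    move=> s0; apply: is_derive_eq (deriv_dot hdot (dQ _ _ _ (dv s s0)) (dQ _ _ _ (dv s s0))) _.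
    by rewrite /df (dotC dot (Q (v s))); ring.
  have : dot (Q (v t)) (Q (v t)) <= dot (Q (v 0)) (Q (v 0)).
    apply: (deriv_le0_ge (f := fun r => dot (Q (v r)) (Q (v r))) (df := df) t0) => s /andP[s0 st].
    - exact: drv_cont (d s s0).
    - exact: d (ltW s0).
    - rewrite /df QZ QB QZ QS scaler0 subr0 -scaleN1r QZ QZ scaleN1r dotZl dotNl dotZl hdot.
      rewrite pmulr_rle0// mulrN oppr_le0 mulr_ge0 ?invr_ge0 ?(ltW eps0)//.
      by rewrite mulr_ge0 ?sqr_ge0// invr_ge0 powR_ge0.
  rewrite iv QP dot0l hdot => h; apply/eqP.
  by rewrite -normr_eq0 -sqrf_eq0 eq_le h sqr_ge0.
move=> t t0; split; last by apply/esym/eqP; rewrite -subr_eq0; apply/eqP; exact: vz.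
apply/esym/eqP; rewrite -subr_eq0 -normr_eq0 eq_le normr_ge0 andbT.
have dr s : is_derive s (1:R) (fun=> 0 : R) 0 by exact: is_derive_cst.
have := norm_increment hdot (u := fun s => Q (u s)) (u' := fun s => Q (v s)) (g := fun=> 0) (g' := fun=> 0) t0.
rewrite iu QP !subr0; apply => s /andP[s0 st].
- exact: drv_cont (dQ _ _ _ (du s s0)).
- exact: drv_cont (dr s).
- exact: dQ _ _ _ (du s (ltW s0)).
- by rewrite vz ?normr0// ltW.
Qed.

Variables (g p : R) (u0 u1 : H).
Hypotheses (g0 : 0 < g) (p0 : 0 <= p) (p1 : p <= 1).
Hypotheses (du0 : dom A u0) (du1 : dom B u1) (nz : B u0 <> 0).

(** A solution of the equation in the range of P n, with the estimates that
    do not depend on n. The last field bounds the rate of change of the stiffness. *)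
Record galerkin (eps C1 C2 C3 C4 d : R) (n : nat) (u v : R -> H) : Prop := {
  galerkin_u0 : u 0 = P n u0;
  galerkin_v0 : v 0 = P n u1;
  galerkin_Pu : forall t, 0 <= t -> P n (u t) = u t;
  galerkin_Pv : forall t, 0 <= t -> P n (v t) = v t;
  galerkin_du : forall t, 0 <= t -> is_derive t (1:R) u (v t);
  galerkin_dv : forall t, 0 <= t -> is_derive t (1:R) v
    (eps^-1 *: (- (((1 + t) `^ p)^-1 *: v t) - `|B (u t)| `^ (2 * g) *: A (u t)));
  galerkin_lower : forall t, 0 <= t -> C1 <= `|B (u t)| ^+ 2 * (1 + t) `^ ((p + 1) / g);
  galerkin_upper : forall t, 0 <= t -> `|B (u t)| ^+ 2 * (1 + t) `^ ((p + 1) / g) <= C2;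
  galerkin_A : forall t, 0 <= t -> `|A (u t)| ^+ 2 <= C3 * `|B (u t)| ^+ 2;
  galerkin_v : forall t, 0 <= t -> `|v t| ^+ 2 * (1 + t) ^+ 2 <= C4 * `|B (u t)| ^+ 2;
  galerkin_rate : forall t, 0 <= t ->
    eps * (2 * g * `|dot (A (u t)) (v t)|) <= d * `|B (u t)| ^+ 2
}.

(** Since |B (P n x)|^2 = <A (P n x), x> <= |A x| |x|. *)
Lemma domAB x : dom A x -> dom B x.
Proof.
move=> dx; apply: (closedB tr (C := Num.sqrt (`|A x| * `|x|))) => n.
rewrite -[leLHS]ger0_norm// -sqrtr_sqr ler_wsqrtr//.
rewrite -/(S n x) -(Sn_form hdot tr) (Sn_square tr) (truncA tr)//.
apply: le_trans (ler_norm _) _; apply: le_trans (dot_le_norm hdot _ _) _.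
by rewrite ler_wpM2r// (trunc_norm hdot tr).
Qed.

(** The clamp acts only where B is at least a factor 2 outside the a priori bounds, which
    are therefore available and show that it never acts. *)
Lemma galerkin_existence : exists e0 C1 C2 C3 C4 d n0,
  [/\ 0 < e0, 0 < C1, 0 < C2, 0 < C3 & 0 < C4] /\ 0 < d /\
  forall eps, 0 < eps -> eps < e0 -> forall n, (n0 <= n)%N ->
  exists u v, galerkin eps C1 C2 C3 C4 d n u v.
Proof.
have du0B := domAB du0.
have bp : 0 < `|B u0| ^+ 2.
  by rewrite exprn_gt0// normr_gt0; apply/eqP.
have blo : 0 < `|B u0| ^+ 2 / 2 by rewrite divr_gt0.
have blohi : `|B u0| ^+ 2 / 2 <= `|B u0| ^+ 2 by rewrite ler_pdivrMr// ler_peMr ?ler1n// ltW.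
have [e0 [C1 [C2 [C3 [C4 [d [pos [d0 apr]]]]]]]] := kirchhoff_a_priori g0 p0 p1 nu0 blo blohi
  (sqr_ge0 `|B u1|) (sqr_ge0 `|A u0|) (sqr_ge0 `|u1|).
have [e00 C10 C20 C30 C40] := pos.
have [n0 hn0] : exists n0, forall n, (n0 <= n)%N -> `|B u0| ^+ 2 / 2 <= `|S n u0| ^+ 2.
  have c1 : `|P n (B u0)| ^+ 2 @[n --> \oo] --> `|B u0| ^+ 2.
    have -> : (fun n => `|P n (B u0)| ^+ 2) = (fun n => dot (P n (B u0)) (P n (B u0))).
      by apply/funext => n; rewrite hdot.
    by rewrite -hdot; apply: cvg_dot => //; exact: (trunc_cvg tr).
  have /cvgrPdist_le /(_ _ blo) [n0 _ hn0] := c1.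
  exists n0 => n /hn0 /=; rewrite /Sn (truncB tr)// => h.
  have := ler_norm (`|B u0| ^+ 2 - `|P n (B u0)| ^+ 2); lra.
exists e0, C1, C2, C3, C4, d, n0; split => //; split => // eps ep el n nn.
(* the second summand ensures that the upper clamp lies above the lower one *)
pose m := Num.sqrt (2 * C2) + Num.sqrt (C1 / 2).
pose w t := (1 + t) `^ ((p + 1) / g).
pose ell t := Num.sqrt (C1 / 2 / w t).
have C12 : 0 < C1 / 2 by rewrite divr_gt0.
have w1 t : 0 <= t -> 1 <= w t by exact: weight_ge1.
have w0 t : 0 <= t -> 0 < w t by move=> /w1; exact: lt_le_trans.
have m0 : 0 < m by rewrite addr_gt0// sqrtr_gt0// mulr_gt0.
have wmono s t : 0 <= s -> s <= t -> w s <= w t.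
  move=> s0 st; apply: ge0_ler_powR; rewrite ?nnegrE//; try lra.
  by rewrite divr_ge0 ?(ltW g0)//; move: p0; lra.
have ell0 T : exists2 lo, 0 < lo & forall t, 0 <= t <= T -> lo <= ell t.
  exists (ell (Num.max T 0)) => [|t /andP[t0 tT]].
    by rewrite sqrtr_gt0 divr_gt0// w0// le_max lexx orbT.
  have tm : t <= Num.max T 0 by rewrite le_max tT.
  rewrite ler_wsqrtr// ler_pM2l// lef_pV2 ?posrE ?w0 ?(le_trans t0)//.
  exact: wmono.
have ellm t : 0 <= t -> ell t <= m.
  move=> t0; apply: (@le_trans _ _ (Num.sqrt (C1 / 2))); last by rewrite lerDr sqrtr_ge0.
  by rewrite ler_wsqrtr// ler_pdivrMr ?w0// ler_peMr ?w1// ltW.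
have ellc : continuous (ell \o @nonneg_part R).
  move=> t; have t0 := nonneg_part_ge0 t.
  apply: (continuous_comp (f := @nonneg_part R) (g := ell)); first exact: nonneg_part_continuous.
  apply: (continuous_comp (f := fun s => C1 / 2 / w s) (g := @Num.sqrt R)); last exact: sqrt_continuous.
  apply: continuousM; first exact: cst_continuous.
  apply: continuousV; first by rewrite gt_eqF ?w0.
  exact: drv_cont (deriv_drag ((p + 1) / g) t0).
have [u [v [iu iv du dv]]] := truncated_solution hdot tr u0 u1 g0 ep m0 p0 ell0 ellm ellc n.
have inv t (t0 : 0 <= t) := truncated_invariant ep iu iv du dv t0.
pose c t := cutoff g m ell t `|S n (u t)|.
have en := energy_identities ep du dv.
have bu t : 0 <= t -> B (u t) = S n (u t) by move=> t0; rewrite /Sn (inv t t0).1.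
have au t : 0 <= t -> A (u t) = S n (S n (u t)) by move=> t0; rewrite (Sn_square tr) (inv t t0).1.
have SP x : dom B x -> `|S n x| <= `|B x|.
  by move=> dx; rewrite /Sn (truncB tr)//; exact: (trunc_norm hdot tr).
have pow2 x : (`|x| ^+ 2) `^ g = `|x| `^ (2 * g) by rewrite powRrM -powR_mulrn.
have est := apr eps ep el _ _ _ _ _ _ _ en.
have {}est : forall t, 0 <= t ->
  [/\ C1 <= `|S n (u t)| ^+ 2 * w t /\ `|S n (u t)| ^+ 2 * w t <= C2,
      `|S n (S n (u t))| ^+ 2 <= C3 * `|S n (u t)| ^+ 2,
      `|v t| ^+ 2 * (1 + t) ^+ 2 <= C4 * `|S n (u t)| ^+ 2,
      eps * (2 * g * `|dot (S n (u t)) (S n (v t))|) <= d * `|S n (u t)| ^+ 2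
    & c t = (`|S n (u t)| ^+ 2) `^ g].
  apply: est.
    rewrite iu iv !(Sn_trunc tr) (Sn_square tr) (truncA tr)//; split.
    - exact: hn0.
    - by rewrite ler_pXn2r ?nnegrE// SP.
    - by rewrite ler_pXn2r ?nnegrE// SP.
    - by rewrite ler_pXn2r ?nnegrE// (trunc_norm hdot tr).
    - by rewrite ler_pXn2r ?nnegrE// (trunc_norm hdot tr).
  move=> t t0 h1 h2; rewrite pow2 /c /cutoff; congr (_ `^ _).
  have r1 : `|S n (u t)| <= m.
    apply: (@le_trans _ _ (Num.sqrt (2 * C2))); last by rewrite lerDl sqrtr_ge0.
    by rewrite -[leLHS]ger0_norm// -sqrtr_sqr ler_wsqrtr.
  have r2 : ell t <= `|S n (u t)|.
    by rewrite -[leRHS]ger0_norm// -sqrtr_sqr ler_wsqrtr// ler_pdivrMr ?w0.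
  by rewrite (min_idPl r1) (max_idPr r2).
exists u, v; split => // t t0.
- exact: (inv t t0).1.
- exact: (inv t t0).2.
- rewrite au// bu// -pow2; have [_ _ _ _ <-] := est t t0; exact: dv.
- by rewrite bu//; have [[h _] _ _ _ _] := est t t0.
- by rewrite bu//; have [[_ h] _ _ _ _] := est t t0.
- by rewrite au// bu//; have [_ h _ _ _] := est t t0.
- by rewrite bu//; have [_ _ h _ _] := est t t0.
- rewrite au// bu// (Sn_sym tr); by have [_ _ _ h _] := est t t0.
Qed.
End Galerkin.

(** * Convergence of the Galerkin approximations *)

Section CauchyCriteria.
Variables (R : realType).
Implicit Types (t T : R).

Lemma cvg_small_diff (V : completeNormedModType R) (a : nat -> V) (l : V) (e : R) : 0 < e -> a n @[n --> \oo] --> l ->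
  exists N, forall m n, (N <= m)%N -> (N <= n)%N -> `|a m - a n| <= e.
Proof.
move=> e0 /cvgrPdist_le /(_ _ (divr_gt0 e0 (ltr0n _ 2))) [N _ hN].
exists N => m n /hN h1 /hN h2; rewrite -(subrKA l) [leRHS]splitr.
by apply: le_trans (ler_normD _ _) _; apply: lerD => //; rewrite distrC.
Qed.

Lemma lu_cauchy_data (V W1 W2 : completeNormedModType R) (f : nat -> R -> V)
    (a : nat -> W1) (b : nat -> W2) (la : W1) (lb : W2) :
  a n @[n --> \oo] --> la -> b n @[n --> \oo] --> lb ->
  (forall T, exists2 K, 0 <= K & forall n m t, 0 <= t <= T ->
     `|f n t - f m t| ^+ 2 <= K * (`|a n - a m| ^+ 2 + `|b n - b m| ^+ 2)) -> lu_cauchy f.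
Proof.
move=> ca cb h T e e0; have [K K0 hK] := h T.
have K1 : 0 < K + 1 by rewrite ltr_wpDl.
pose d := e / (K + 1).
have d0 : 0 < d by rewrite divr_gt0.
have [N1 h1] := cvg_small_diff d0 ca.
have [N2 h2] := cvg_small_diff d0 cb.
exists (maxn N1 N2) => m n; rewrite !geq_max => /andP[m1 m2] /andP[n1 n2] t tT.
rewrite -ler_sqr ?nnegrE ?(ltW e0)//; apply: le_trans (hK _ _ _ tT) _.
have q1 : `|a m - a n| ^+ 2 <= d ^+ 2 by rewrite ler_sqr ?nnegrE ?(ltW d0)// h1.
have q2 : `|b m - b n| ^+ 2 <= d ^+ 2 by rewrite ler_sqr ?nnegrE ?(ltW d0)// h2.
apply: (@le_trans _ _ (K * (d ^+ 2 + d ^+ 2))); first by rewrite ler_wpM2l// lerD.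
have -> : e = d * (K + 1) by rewrite /d mulfVK// gt_eqF.
have -> : K * (d ^+ 2 + d ^+ 2) = d ^+ 2 * (2 * K) by ring.
rewrite [leRHS]exprMn ler_wpM2l ?sqr_ge0//.
by have := sqr_ge0 K; rewrite !expr2; lra.
Qed.

Lemma lu_cauchy_dominated (V W : completeNormedModType R) (f : nat -> R -> V) (h1 h2 h3 : nat -> R -> W) :
  (forall T, exists2 K, 0 <= K & forall n m t, 0 <= t <= T ->
    `|f n t - f m t| <= K * (`|h1 n t - h1 m t| + `|h2 n t - h2 m t| + `|h3 n t - h3 m t|)) ->
  lu_cauchy h1 -> lu_cauchy h2 -> lu_cauchy h3 -> lu_cauchy f.
Proof.
move=> h c1 c2 c3 T e e0; have [K K0 hK] := h T.
have K1 : 0 < K + 1 by rewrite ltr_wpDl.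
pose d := e / (3 * (K + 1)).
have d0 : 0 < d by rewrite divr_gt0// mulr_gt0.
have [N1 s1] := c1 T d d0; have [N2 s2] := c2 T d d0; have [N3 s3] := c3 T d d0.
exists (maxn N1 (maxn N2 N3)) => m n; rewrite !geq_max => /and3P[m1 m2 m3] /and3P[n1 n2 n3] t tT.
apply: le_trans (hK _ _ _ tT) _.
apply: (@le_trans _ _ (K * (d + d + d))); first by rewrite ler_wpM2l// !lerD// ?s1 ?s2 ?s3.
have -> : e = 3 * d * (K + 1) by rewrite /d; field; rewrite gt_eqF.
have -> : d + d + d = 3 * d by ring.
by rewrite mulrC ler_wpM2l ?lerDl// mulr_ge0// ltW.
Qed.

(** Interchange of limits: the truncations converge for every k, and the remainders
    are small uniformly in n. *)
Lemma lu_cauchy_tails (V : completeNormedModType R) (P : nat -> V -> V) (f : nat -> R -> V) :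
  (forall k, lu_cauchy (fun n t => P k (f n t))) ->
  (forall T e, 0 < e -> exists k, forall n t, 0 <= t <= T -> `|f n t - P k (f n t)| <= e) ->
  lu_cauchy f.
Proof.
move=> hP tail T e e0.
have e3 : 0 < e / 3 by rewrite divr_gt0.
have [k hk] := tail T _ e3; have [N hN] := hP k T _ e3.
exists N => m n Nm Nn t tT.
have := hN m n Nm Nn t tT; have := hk m t tT; have := hk n t tT.
rewrite (distrC (f n t)); move: (f m t) (f n t) (P k (f m t)) (P k (f n t)) => a b x y h1 h2 h3.
have -> : a - b = (a - x) + (x - y) + (y - b) by rewrite !subrKA.
apply: le_trans (ler_normD _ _) _; have := ler_normD (a - x) (x - y); lra.
Qed.
End CauchyCriteria.

Section Galerkin.
Variables (R : realType) (H : completeNormedModType R) (dot : {dot H for idfun}).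
Hypothesis hdot : hilbert_form dot.
Variables (A B : unbounded_operator H) (P : nat -> H -> H).
Hypothesis tr : sqrt_truncation dot A B P.
Implicit Types (x y : H) (n k : nat) (t s T : R).
Local Notation S := (Sn B P).
Variables (g p : R) (u0 u1 : H).
Hypotheses (g0 : 0 < g) (p0 : 0 <= p).
Hypotheses (du0 : dom A u0) (du1 : dom B u1).
Variables (eps C1 C2 C3 C4 d : R) (n0 : nat).
Hypotheses (eps0 : 0 < eps) (C10 : 0 < C1) (C30 : 0 < C3) (d0 : 0 < d).
Variables (U V : nat -> R -> H).
Hypothesis gal : forall n, galerkin dot A B P g p u0 u1 eps C1 C2 C3 C4 d (n0 + n) (U n) (V n).

Lemma galerkin_range T : exists lo hi, [/\ 0 < lo, lo <= hi &
  forall n t, 0 <= t <= T -> lo <= `|B (U n t)| <= hi].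
Proof.
pose w := (1 + Num.max T 0) `^ ((p + 1) / g).
have T0 : 0 <= Num.max T 0 by rewrite le_max lexx orbT.
have w0 : 0 < w by rewrite powR_gt0//; lra.
(* the second summand is there to have lo <= hi *)
pose hi := Num.sqrt C2 + Num.sqrt (C1 / w).
exists (Num.sqrt (C1 / w)), hi; split; first by rewrite sqrtr_gt0 divr_gt0.
  by rewrite lerDr sqrtr_ge0.
move=> n t /andP[t0 tT].
have wt : 1 <= (1 + t) `^ ((p + 1) / g) by exact: weight_ge1.
have ww : (1 + t) `^ ((p + 1) / g) <= w.
  have tm : t <= Num.max T 0 by rewrite le_max tT.
  apply: ge0_ler_powR; rewrite ?nnegrE//; try lra.
  by rewrite divr_ge0 ?(ltW g0)//; move: p0; lra.
have b0 := sqr_ge0 `|B (U n t)|.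
rewrite -[X in _ <= X <= _]ger0_norm// -sqrtr_sqr; apply/andP; split.
  rewrite ler_wsqrtr// ler_pdivrMr//; apply: le_trans (galerkin_lower (gal n) t0) _.
  by rewrite ler_wpM2l.
apply: (@le_trans _ _ (Num.sqrt C2)); last by rewrite lerDl sqrtr_ge0.
rewrite ler_wsqrtr//; apply: le_trans (galerkin_upper (gal n) t0).
by rewrite ler_peMr.
Qed.

Let trunc_ge n k x : (n <= k)%N -> P n x = x -> P k x = x.
Proof. by move=> nk h; rewrite -h (truncI tr) (minn_idPr nk). Qed.

Let US n k t : (n0 + n <= k)%N -> 0 <= t ->
  [/\ B (U n t) = S k (U n t), A (U n t) = S k (S k (U n t)), B (V n t) = S k (V n t) &
   A (V n t) = S k (S k (V n t))].
Proof.
move=> nk t0.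
have h1 := trunc_ge nk (galerkin_Pu (gal n) t0).
have h2 := trunc_ge nk (galerkin_Pv (gal n) t0).
by rewrite !(Sn_square tr) /Sn h1 h2.
Qed.

Let stiff n t := (`|S (n0 + n) (U n t)| ^+ 2) `^ g.

Let stiffE n t : 0 <= t -> stiff n t = `|B (U n t)| `^ (2 * g).
Proof.
move=> t0; have [h _ _ _] := US (leqnn (n0 + n)) t0.
by rewrite /stiff -h powRrM -powR_mulrn.
Qed.

Let dS k (w : R -> H) t dw : is_derive t (1:R) w dw -> is_derive t (1:R) (fun s => S k (w s)) (S k dw).
Proof.
have [C _ hC] := Sn_bound tr k.
by move=> h; exact: (deriv_bounded_linear (Sn_linear tr k) hC h).
Qed.

Let dstiff n t : 0 <= t ->
  is_derive t (1:R) (stiff n) (g * (`|S (n0 + n) (U n t)| ^+ 2) `^ (g - 1) *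
     (2 * dot (S (n0 + n) (U n t)) (S (n0 + n) (V n t)))).
Proof.
move=> t0; have dd := dS (n0 + n) (galerkin_du (gal n) t0).
have b0 : 0 < `|S (n0 + n) (U n t)| ^+ 2.
  have [<- _ _ _] := US (leqnn (n0 + n)) t0.
  rewrite -(@pmulr_lgt0 _ ((1 + t) `^ ((p + 1) / g))).
    exact: lt_le_trans (galerkin_lower (gal n) t0).
  by rewrite powR_gt0//; lra.
have db : is_derive t (1:R) (fun s => `|S (n0 + n) (U n s)| ^+ 2)
    (2 * dot (S (n0 + n) (U n t)) (S (n0 + n) (V n t))).
  have -> : (fun s => `|S (n0 + n) (U n s)| ^+ 2) = (fun s => dot (S (n0 + n) (U n s)) (S (n0 + n) (U n s))).
    by apply/funext => s; rewrite hdot.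
  apply: is_derive_eq (deriv_dot hdot dd dd) _; rewrite (dotC dot (S _ (V n t))); ring.
exact: (drvpow (f := fun s => `|S (n0 + n) (U n s)| ^+ 2) g b0 db).
Qed.

Lemma stiffness_bounds T : exists c0 K, [/\ 0 < c0, 0 <= K &
  forall n t, 0 <= t <= T -> [/\ c0 <= stiff n t, stiff n t <= K &
    forall dc, is_derive t (1:R) (stiff n) dc -> dc <= K]].
Proof.
have [lo [hi [lo0 lohi hr]]] := galerkin_range T.
have g2 : 0 <= 2 * g by rewrite mulr_ge0// ltW.
have hi0 : 0 < hi by exact: lt_le_trans lohi.
pose K := hi `^ (2 * g) * (1 + d / eps).
have de : 0 <= d / eps by rewrite divr_ge0 ?ltW.
exists (lo `^ (2 * g)), K; split; first exact: powR_gt0.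
  by rewrite mulr_ge0 ?powR_ge0// addr_ge0.
move=> n t /[dup] tT /andP[t0 _].
have /andP[h1 h2] := hr n t tT.
have s2 : stiff n t <= hi `^ (2 * g).
  by rewrite stiffE//; apply: (ge0_ler_powR g2) => //; rewrite nnegrE// ltW.
split.
- by rewrite stiffE//; apply: (ge0_ler_powR g2) => //; rewrite nnegrE ?normr_ge0 // ltW.
- by apply: le_trans s2 _; rewrite ler_peMr ?powR_ge0// lerDl.
move=> dc hdc.
have -> : dc = g * (`|S (n0 + n) (U n t)| ^+ 2) `^ (g - 1) *
     (2 * dot (S (n0 + n) (U n t)) (S (n0 + n) (V n t))).
  by have [_ <-] := dstiff n t0; have [_ <-] := hdc.
have [e1 e2 _ _] := US (leqnn (n0 + n)) t0.
have b0 : 0 < `|S (n0 + n) (U n t)| ^+ 2 by rewrite -e1 exprn_gt0// (lt_le_trans lo0).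
have rate := galerkin_rate (gal n) t0.
rewrite e1 e2 (Sn_sym tr) in rate.
rewrite powRB ?(gt_eqF b0) ?implybT// powRr1 ?(ltW b0)//.
rewrite -/(stiff n t).
set b := `|S (n0 + n) (U n t)| ^+ 2 in b0 rate *; set X := dot _ _ in rate *.
have -> : g * (stiff n t / b) * (2 * X) = stiff n t * (2 * g * X / b) by ring.
have h3 : 2 * g * X / b <= d / eps.
  rewrite ler_pdivrMr// [leRHS]mulrAC ler_pdivlMr// mulrC; apply: le_trans rate.
  by rewrite ler_pM2l// ler_wpM2l// ler_norm.
apply: (@le_trans _ _ (stiff n t * (d / eps))); first by rewrite ler_wpM2l// powR_ge0.
apply: (@le_trans _ _ (hi `^ (2 * g) * (d / eps))); first by rewrite ler_wpM2r.
by rewrite ler_wpM2l ?powR_ge0// lerDr.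
Qed.

Let drag01 t : 0 <= t -> 0 < ((1 + t) `^ p)^-1 /\ ((1 + t) `^ p)^-1 <= 1.
Proof.
move=> t0; have q1 := drag_ge1 p0 t0.
by rewrite invr_gt0 invf_le1 ?(lt_le_trans ltr01).
Qed.

Let A_bound n t : 0 <= t -> `|A (U n t)| <= Num.sqrt (C3 * C2).
Proof.
move=> t0; rewrite -[leLHS]ger0_norm// -sqrtr_sqr ler_wsqrtr//.
apply: le_trans (galerkin_A (gal n) t0) _; rewrite ler_pM2l//.
apply: le_trans (galerkin_upper (gal n) t0); rewrite ler_peMr ?sqr_ge0//.
exact: weight_ge1.
Qed.

(** The nonlinearity contributes the difference of two stiffnesses times A (U m), a bounded
    vector; by the Lipschitz bound on the power it is a term of the size of the energy. Two
    approximations live in the range of a common P k, where B is bounded. *)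
Lemma galerkin_stability T : exists2 K, 0 <= K & forall n m t, 0 <= t <= T ->
  `|V n t - V m t| ^+ 2 <= K * (`|V n 0 - V m 0| ^+ 2 + `|B (U n 0) - B (U m 0)| ^+ 2) /\
  `|B (U n t) - B (U m t)| ^+ 2 <= K * (`|V n 0 - V m 0| ^+ 2 + `|B (U n 0) - B (U m 0)| ^+ 2).
Proof.
have [lo [hi [lo0 lohi hr]]] := galerkin_range T.
have [c0 [Kc [c00 Kc0 hc]]] := stiffness_bounds T.
have g2 : 0 < 2 * g by rewrite mulr_gt0.
have [L L0 hL] := powR_lipschitz g2 lo0 lohi.
pose a := Num.sqrt (C3 * C2).
have a0 : 0 <= a by exact: sqrtr_ge0.
pose K := Kc + L * a.
have K0 : 0 <= K by rewrite addr_ge0// mulr_ge0.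
exists (stability_constant eps c0 Kc K T); first exact: stability_constant_ge0.
move=> n m t /[dup] tT /andP[t0 t1].
pose k := maxn (n0 + n) (n0 + m).
have nk : (n0 + n <= k)%N by exact: leq_maxl.
have mk : (n0 + m <= k)%N by exact: leq_maxr.
pose e1 s := `|V n s - V m s| ^+ 2.
pose e2 s := `|S k (U n s - U m s)| ^+ 2.
have e2E s : 0 <= s -> e2 s = `|B (U n s) - B (U m s)| ^+ 2.
  move=> s0; have [-> _ _ _] := US nk s0; have [-> _ _ _] := US mk s0.
  by rewrite /e2 (SnB tr).
pose w s := eps^-1 *: (- (((1 + s) `^ p)^-1 *: (V n s - V m s))
   - (stiff n s *: S k (S k (U n s)) - stiff m s *: S k (S k (U m s)))).
pose y s := dot (V n s - V m s) (w s).
pose x s := dot (S k (U n s - U m s)) (S k (V n s - V m s)).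
have dw s : 0 <= s -> is_derive s (1:R) (fun r => V n r - V m r) (w s).
  move=> s0; apply: is_derive_eq (is_deriveB (galerkin_dv (gal n) s0) (galerkin_dv (gal m) s0)) _.
  have [_ -> _ _] := US nk s0; have [_ -> _ _] := US mk s0.
  rewrite -!stiffE// -[LHS]scalerBr /w [X in _ = _ *: (- X - _)]scalerBr; congr (_ *: _).
  move: (_ *: V n s) (_ *: V m s) (stiff n s *: _) (stiff m s *: _) => b1 b2 b3 b4.
  by rewrite [in LHS]opprD ![in LHS]opprK addrACA ![in RHS]opprB; congr (_ + _); exact: addrC.
have dz s : 0 <= s -> is_derive s (1:R) (fun r => U n r - U m r) (V n s - V m s).
  move=> s0; exact: is_deriveB (galerkin_du (gal n) s0) (galerkin_du (gal m) s0).
have d1 s : 0 <= s -> is_derive s (1:R) e1 (2 * y s).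
  move=> s0; rewrite /e1.
  have -> : (fun s => `|V n s - V m s| ^+ 2) = (fun s => dot (V n s - V m s) (V n s - V m s)).
    by apply/funext => r; rewrite hdot.
  apply: is_derive_eq (deriv_dot hdot (dw s s0) (dw s s0)) _.
  rewrite (dotC dot (w s)) /y; ring.
have d2 s : 0 <= s -> is_derive s (1:R) e2 (2 * x s).
  move=> s0; rewrite /e2.
  have -> : (fun s => `|S k (U n s - U m s)| ^+ 2) = (fun s => dot (S k (U n s - U m s)) (S k (U n s - U m s))).
    by apply/funext => r; rewrite hdot.
  apply: is_derive_eq (deriv_dot hdot (dS k (dz s s0)) (dS k (dz s s0))) _.
  rewrite (dotC dot (S k (V n s - V m s))) /x; ring.
have sub s : 0 < s < t -> 0 <= s /\ 0 <= s <= T.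
  by move=> /andP[s0 st]; rewrite (ltW s0) (le_trans (ltW st)).
have key := energy_stability (e1 := e1) (e2 := e2) (x := x) (y := y) (c := stiff n)
  (dc := fun s => g * (`|S (n0 + n) (U n s)| ^+ 2) `^ (g - 1) *
     (2 * dot (S (n0 + n) (U n s)) (S (n0 + n) (V n s)))) (c1 := Kc) t0 t1 eps0 c00 K0.
have T00 : (0:R) <= 0 by [].
rewrite -(e2E t t0) -(e2E 0 T00) -/(e1 t) -/(e1 0).
apply: key => [s /andP[s0 _]|s /andP[s0 _]|s /andP[s0 _]|s /sub[s0 _]|s /sub[s0 _]|s /sub[s0 _]|s|s|s /andP[s0 st]|s /sub[s0 sT]|s /sub[s0 sT]].
  - exact: drv_cont (d1 s s0).
  - exact: drv_cont (d2 s s0).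
  - exact: drv_cont (dstiff n s0).
  - exact: d1.
  - exact: d2.
  - exact: dstiff.
  - exact: sqr_ge0.
  - exact: sqr_ge0.
  - have sT : 0 <= s <= T by rewrite s0 (le_trans st).
    by have [-> -> _] := hc n s sT.
  - have [_ _ h] := hc n s sT; apply: le_trans (h _ (dstiff n s0)) _.
    by rewrite /K lerDl mulr_ge0.
  have [b1 b2 _ _] := US nk s0; have [b3 b4 _ _] := US mk s0.
  have E1 : eps * y s = - ((1 + s) `^ p)^-1 * e1 s - stiff n s * x s
     - (stiff n s - stiff m s) * dot (V n s - V m s) (A (U m s)).
    rewrite /y /w dotZr mulrA divff ?gt_eqF// mul1r.
    have -> : stiff n s *: S k (S k (U n s)) - stiff m s *: S k (S k (U m s)) =
       stiff n s *: S k (S k (U n s - U m s)) + (stiff n s - stiff m s) *: A (U m s).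
      by rewrite b4 !(SnB tr) scalerBr scalerBl subrKA.
    rewrite /e1 /x; move: (V n s - V m s) (S k (U n s - U m s)) (A (U m s)) => z z' z''.
    by rewrite !dotE hdot -(Sn_sym tr) (dotC dot (S k z)); ring.
  have E2 : `|(stiff n s - stiff m s) * dot (V n s - V m s) (A (U m s))| <= L * a * (e1 s + e2 s).
    have h1 : `|stiff n s - stiff m s| <= L * `|B (U n s) - B (U m s)|.
      rewrite !stiffE//; apply: le_trans (hL _ _ (hr n s sT) _) _.
        by have /andP[h ->] := hr m s sT; rewrite andbT (le_trans (ltW lo0)).
      by rewrite ler_wpM2l// ler_dist_dist.
    have h2 : `|dot (V n s - V m s) (A (U m s))| <= `|V n s - V m s| * a.
      apply: le_trans (dot_le_norm hdot _ _) _; rewrite ler_wpM2l//; exact: A_bound.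
    rewrite normrM; apply: le_trans (ler_pM (normr_ge0 _) (normr_ge0 _) h1 h2) _.
    rewrite e2E// /e1; move: (`|V n s - V m s|) (`|B (U n s) - B (U m s)|) => r1 r2.
    have -> : L * r2 * (r1 * a) = L * a * (r1 * r2) by ring.
    rewrite ler_wpM2l ?mulr_ge0//; have := sqr_ge0 (r1 - r2); have := sqr_ge0 r1; have := sqr_ge0 r2; nra.
  have [dr0 _] := drag01 s0.
  have E3 : 0 <= ((1 + s) `^ p)^-1 * e1 s by rewrite mulr_ge0 ?sqr_ge0// ltW.
  have E4 : 0 <= Kc * (e1 s + e2 s) by rewrite mulr_ge0// addr_ge0// sqr_ge0.
  move: E2; rewrite ler_norml => /andP[E2 _].
  rewrite E1 /K mulNr mulrDl; lra.
Qed.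

(** The projection Q = id - P k commutes with the equation, in which the stiffness is a scalar, so
    Q U solves a linear equation with bounded coefficients and its energy one level up,
    |Q S V|^2 and |Q S^2 U|^2, is controlled by the initial one. *)
Lemma galerkin_tail T : exists2 K, 0 <= K & forall k n t, 0 <= t <= T ->
  `|B (V n t) - P k (B (V n t))| ^+ 2 <= K * (`|B u1 - P k (B u1)| ^+ 2 + `|A u0 - P k (A u0)| ^+ 2) /\
  `|A (U n t) - P k (A (U n t))| ^+ 2 <= K * (`|B u1 - P k (B u1)| ^+ 2 + `|A u0 - P k (A u0)| ^+ 2).
Proof.
have [c0 [K [c00 K0 hc]]] := stiffness_bounds T.
exists (stability_constant eps c0 K K T); first exact: stability_constant_ge0.
move=> k n t /[dup] tT /andP[t0 t1].
pose N := (n0 + n)%N.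
pose Q x := x - P k x.
have Qlin (a : R) x y : Q (a *: x + y) = a *: Q x + Q y.
  by rewrite /Q (truncP tr) scalerBr opprD addrACA.
have Qb x : `|Q x| <= 2 * `|x|.
  apply: le_trans (ler_normB _ _) _; have := trunc_norm hdot tr k x; lra.
have dQ (w : R -> H) s dw : is_derive s (1:R) w dw -> is_derive s (1:R) (fun r => Q (w r)) (Q dw).
  by move=> h; exact: (deriv_bounded_linear Qlin Qb h).
have QZ (a : R) x : Q (a *: x) = a *: Q x.
  by rewrite /Q (truncZ tr) scalerBr.
have QB x y : Q (x - y) = Q x - Q y.
  by rewrite addrC -scaleN1r Qlin scaleN1r addrC.
have SQ x : S N (Q x) = Q (S N x).
  rewrite /Q (SnB tr); congr (_ - _).
  rewrite /Sn -(truncB tr); last exact: (trunc_domB tr).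
  by rewrite !(truncI tr) minnC.
have QP x : Q (P N x) = P N (Q x).
  by rewrite /Q (truncBr tr) !(truncI tr) minnC.
pose e1 s := `|Q (S N (V n s))| ^+ 2.
pose e2 s := `|Q (S N (S N (U n s)))| ^+ 2.
pose w s := eps^-1 *: (- (((1 + s) `^ p)^-1 *: V n s) - stiff n s *: S N (S N (U n s))).
pose y s := dot (Q (S N (V n s))) (Q (S N (w s))).
pose x s := dot (Q (S N (S N (U n s)))) (Q (S N (S N (V n s)))).
have dw s : 0 <= s -> is_derive s (1:R) (V n) (w s).
  move=> s0; apply: is_derive_eq (galerkin_dv (gal n) s0) _.
  by have [_ -> _ _] := US (leqnn N) s0; rewrite -stiffE.
have d1 s : 0 <= s -> is_derive s (1:R) e1 (2 * y s).
  move=> s0; rewrite /e1.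
  have -> : (fun s => `|Q (S N (V n s))| ^+ 2) = (fun s => dot (Q (S N (V n s))) (Q (S N (V n s)))).
    by apply/funext => r; rewrite hdot.
  have h := dQ _ _ _ (dS N (dw s s0)).
  apply: is_derive_eq (deriv_dot hdot h h) _.
  rewrite (dotC dot (Q (S N (w s)))) /y; ring.
have d2 s : 0 <= s -> is_derive s (1:R) e2 (2 * x s).
  move=> s0; rewrite /e2.
  have -> : (fun s => `|Q (S N (S N (U n s)))| ^+ 2) =
      (fun s => dot (Q (S N (S N (U n s)))) (Q (S N (S N (U n s))))).
    by apply/funext => r; rewrite hdot.
  have h := dQ _ _ _ (dS N (dS N (galerkin_du (gal n) s0))).
  apply: is_derive_eq (deriv_dot hdot h h) _.
  rewrite (dotC dot (Q (S N (S N (V n s))))) /x; ring.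
have sub s : 0 < s < t -> 0 <= s /\ 0 <= s <= T.
  by move=> /andP[s0 st]; rewrite (ltW s0) (le_trans (ltW st)).
have key := energy_stability (e1 := e1) (e2 := e2) (x := x) (y := y) (c := stiff n)
  (dc := fun s => g * (`|S (n0 + n) (U n s)| ^+ 2) `^ (g - 1) *
     (2 * dot (S (n0 + n) (U n s)) (S (n0 + n) (V n s)))) (c1 := K) t0 t1 eps0 c00 K0.
have i1 : e1 0 <= `|Q (B u1)| ^+ 2.
  rewrite /e1 (galerkin_v0 (gal n)) (Sn_trunc tr) /Sn (truncB tr)// QP.
  by rewrite ler_sqr ?nnegrE// (trunc_norm hdot tr).
have i2 : e2 0 <= `|Q (A u0)| ^+ 2.
  rewrite /e2 (galerkin_u0 (gal n)) (Sn_trunc tr) (Sn_square tr) (truncA tr)// QP.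
  by rewrite ler_sqr ?nnegrE// (trunc_norm hdot tr).
have st0 : 0 <= stability_constant eps c0 K K T by exact: stability_constant_ge0.
have [_ a2 a3 _] := US (leqnn N) t0; rewrite a2 a3.
suff [h1 h2] : e1 t <= stability_constant eps c0 K K T * (e1 0 + e2 0) /\
    e2 t <= stability_constant eps c0 K K T * (e1 0 + e2 0).
  by split; [apply: le_trans h1 _|apply: le_trans h2 _]; rewrite ler_wpM2l// lerD.
apply: key => [s /andP[s0 _]|s /andP[s0 _]|s /andP[s0 _]|s /sub[s0 _]|s /sub[s0 _]|s /sub[s0 _]|s|s|s /andP[s0 st]|s /sub[s0 sT]|s /sub[s0 sT]].
  - exact: drv_cont (d1 s s0).
  - exact: drv_cont (d2 s s0).
  - exact: drv_cont (dstiff n s0).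
  - exact: d1.
  - exact: d2.
  - exact: dstiff.
  - exact: sqr_ge0.
  - exact: sqr_ge0.
  - have sT : 0 <= s <= T by rewrite s0 (le_trans st).
    by have [-> -> _] := hc n s sT.
  - by have [_ _ h] := hc n s sT; apply: h (dstiff n s0).
  have E1 : eps * y s = - (((1 + s) `^ p)^-1 * e1 s) - stiff n s * x s.
    rewrite /y /w (SnZ tr) QZ (SnB tr) QB !(SnZ tr) QZ -scaleN1r !(SnZ tr) !QZ scaleN1r.
    rewrite -(SQ (S N (S N (U n s)))) /e1 /x -(SQ (S N (V n s))).
    move: (Q (S N (V n s))) (Q (S N (S N (U n s)))) => z z'.
    rewrite !dotE hdot -(Sn_sym tr) (dotC dot z'); field.
    by rewrite (gt_eqF eps0) gt_eqF // powR_gt0//; lra.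
  have [dr0 _] := drag01 s0.
  have E3 : 0 <= ((1 + s) `^ p)^-1 * e1 s by rewrite mulr_ge0 ?sqr_ge0// ltW.
  have E4 : 0 <= K * (e1 s + e2 s) by rewrite mulr_ge0// addr_ge0// sqr_ge0.
  rewrite E1; lra.
Qed.
End Galerkin.

(** * One-sided derivatives on the half-line *)

Section HalfLine.
Variables (R : realType) (H : completeNormedModType R).
Implicit Types (u v : R -> H) (s t : R).

Lemma within_half_line (F : set_system R) (Q : set R) : Filter F ->
  (forall s, 0 <= s -> Q s) -> within `[0, +oo[ F Q.
Proof.
move=> FF h; apply: (@filterS _ F FF setT) filterT => s _.
by rewrite /= in_itv/= andbT; exact: h.
Qed.

Definition right_nbhs t := within `[0, +oo[ (dnbhs t).

Lemma right_nbhs_filter t : Filter (right_nbhs t).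
Proof. exact: within_filter. Qed.
#[local] Existing Instance right_nbhs_filter.

Lemma right_nbhs_proper t : 0 <= t -> ProperFilter (right_nbhs t).
Proof.
move=> t0; apply: Build_ProperFilter => -[r /= r0 hr].
have := hr (t + r / 2); rewrite /ball /= opprD addrA subrr add0r normrN.
have r2 : 0 < r / 2 by rewrite divr_gt0.
rewrite gtr0_norm// ltr_pdivrMr// ltr_pMr// ltr1n => /(_ isT).
by rewrite -subr_eq0 addrC addKr gt_eqF// => /(_ isT); apply; rewrite in_itv/= andbT addr_ge0// ltW.
Qed.

Definition quotient_cvg u t (d : H) := (s - t)^-1 *: (u s - u t) @[s --> right_nbhs t] --> d.

Lemma quotient_cvgP u t d : quotient_cvg u t d <-> forall e : R, 0 < e ->
  exists2 r : R, 0 < r & forall s, 0 <= s -> `|s - t| < r -> `|u s - u t - (s - t) *: d| <= e * `|s - t|.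
Proof.
split=> [h e e0|h].
  move: h => /cvgrPdist_lt/(_ e e0) [r /= r0 hr]; exists r => // s s0 st.
  have [->|nst] := eqVneq s t; first by rewrite !subrr scale0r subr0 !normr0 mulr0.
  have st0 : s - t != 0 by rewrite subr_eq0.
  have := hr s; rewrite /ball/= distrC => /(_ st nst).
  rewrite in_itv/= andbT => /(_ s0) /ltW hd.
  have -> : u s - u t - (s - t) *: d = - ((s - t) *: (d - (s - t)^-1 *: (u s - u t))).
    by rewrite scalerBr scalerA divff// scale1r opprB.
  by rewrite normrN normrZ mulrC ler_wpM2r.
apply/cvgrPdist_le => e e0; have [r r0 hr] := h e e0.
exists r => //= s; rewrite /ball/= distrC => sr st; rewrite in_itv/= andbT => s0.
have st0 : s - t != 0 by rewrite subr_eq0.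
have := hr s s0 sr.
have -> : u s - u t - (s - t) *: d = - ((s - t) *: (d - (s - t)^-1 *: (u s - u t))).
  by rewrite scalerBr scalerA divff// scale1r opprB.
by rewrite normrN normrZ mulrC ler_pM2r// normr_gt0.
Qed.

Lemma deriv_ge0E u t d : 0 <= t -> quotient_cvg u t d -> deriv_ge0 u t = d.
Proof.
move=> t0 h; have pf := right_nbhs_proper t0.
exact: (cvg_lim (@norm_hausdorff _ _) h).
Qed.

Lemma quotient_cvg_eq u v t d : 0 <= t -> (forall s, 0 <= s -> u s = v s) ->
  quotient_cvg u t d -> quotient_cvg v t d.
Proof.
move=> t0 uv /quotient_cvgP h; apply/quotient_cvgP => e e0; have [r r0 hr] := h e e0.
by exists r => // s s0 st; rewrite -!uv//; exact: hr.
Qed.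

Lemma quotient_cvg_norm u t d : quotient_cvg u t d ->
  `|(s - t)^-1 *: (u s - u t) - d| @[s --> right_nbhs t] --> (0 : R).
Proof.
by move=> h; rewrite -(@normr0 _ H) -(subrr d); apply: cvg_norm; apply: cvgB => //; exact: cvg_cst.
Qed.

(** At t > 0 the one-sided notion is the usual one, for the extension that is constant on the
    negative half-line. *)
Lemma quotient_cvg_derive u t d : 0 < t -> quotient_cvg u t d ->
  is_derive t (1:R) (fun s => u (nonneg_part s)) d.
Proof.
move=> t0 /quotient_cvgP h; apply/is_deriveP => e e0; have [r r0 hr] := h e e0.
exists (Num.min r t) => [|s]; first by rewrite lt_min r0.
rewrite lt_min => /andP[sr st].
have s0 : 0 <= s by move: st; rewrite ltr_norml => /andP[st _]; lra.
by rewrite !nonneg_partE// ?(ltW t0)//; exact: hr.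
Qed.

Lemma quotient_cvg_continuous u : (forall t, 0 <= t -> exists d, quotient_cvg u t d) ->
  continuous (u \o @nonneg_part R).
Proof.
move=> h t; have [d /quotient_cvgP/(_ 1 ltr01)[r r0 hr]] := h _ (nonneg_part_ge0 t).
apply/cvgrPdist_lt => e e0.
have d1 : 0 < `|d| + 1 by rewrite ltr_wpDl.
have rr : 0 < Num.min r (e / (`|d| + 1)) by rewrite lt_min r0 divr_gt0.
have /cvgrPdist_lt/(_ _ rr) := @nonneg_part_continuous R t.
apply: filterS => s; rewrite distrC lt_min => /andP[s1 s2].
have := hr _ (nonneg_part_ge0 s) s1; rewrite mul1r /= distrC.
move: (nonneg_part s) (nonneg_part t) s2 => a b s2 h1.
have -> : u b - u a = (u b - u a + (a - b) *: d) - (a - b) *: d by rewrite addrK.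
apply: le_lt_trans (ler_normB _ _) _; rewrite normrZ.
have e1 : `|a - b| * (`|d| + 1) < e by rewrite -ltr_pdivlMr.
have h2 : `|u b - u a + (a - b) *: d| <= `|a - b|.
  by rewrite -normrN opprD opprB; move: h1; rewrite distrC -normrN opprB.
by apply: le_lt_trans e1; rewrite mulrDr mulr1 addrC lerD2l.
Qed.

Lemma cvg_within_half_line (f : R -> H) t : continuous (f \o @nonneg_part R) -> 0 <= t ->
  f s @[s --> within `[0, +oo[ (nbhs t)] --> f t.
Proof.
move=> cf t0; apply/cvgrPdist_lt => e e0.
have /cvgrPdist_lt/(_ e e0) := cf t; rewrite /= nonneg_partE// => h.
apply: filterS h => s /=; rewrite in_itv/= andbT => hs s0.
by move: hs; rewrite nonneg_partE.
Qed.

Lemma cvg_within_norm (f : R -> H) t : continuous (f \o @nonneg_part R) -> 0 <= t ->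
  `|f s - f t| @[s --> within `[0, +oo[ (nbhs t)] --> (0 : R).
Proof.
move=> cf t0; have FF : Filter (within `[0, +oo[ (nbhs t)) by exact: within_filter.
have h := cvg_norm (FF := FF) (cvgB (FF := FF) (cvg_within_half_line cf t0) (@cvg_cst H (f t) R _ FF)).
by rewrite subrr normr0 in h; exact: h.
Qed.

Lemma continuous_within_half_line (f : R -> H) :
  (forall t, 0 <= t -> f s @[s --> within `[0, +oo[ (nbhs t)] --> f t) ->
  continuous (f \o @nonneg_part R).
Proof.
move=> h t; apply/cvgrPdist_lt => e e0.
have /cvgrPdist_lt/(_ e e0)[r /= r0 hr] := h _ (nonneg_part_ge0 t).
have /cvgrPdist_lt/(_ _ r0) := @nonneg_part_continuous R t.
apply: filterS => s hs; apply: hr => //.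
by rewrite /= in_itv/= andbT nonneg_part_ge0.
Qed.

Lemma deriv_continuous u : (forall t, 0 <= t -> {for t, continuous u}) -> continuous (u \o @nonneg_part R).
Proof.
move=> h t; apply: (continuous_comp (f := @nonneg_part R)); first exact: nonneg_part_continuous.
exact: h (nonneg_part_ge0 t).
Qed.
End HalfLine.
#[global] Existing Instance right_nbhs_filter.

Section LimitDerivative.
Variables (R : realType) (H : completeNormedModType R) (dot : {dot H for idfun}).
Hypothesis hdot : hilbert_form dot.

(** The mean value inequality is applied to U n s - s w(t), whose derivative is small near t
    uniformly in n. *)
Lemma lu_cvg_quotient (U W : nat -> R -> H) (u w : R -> H) :
  (forall n (t : R), 0 <= t -> is_derive t (1:R) (U n) (W n t)) ->
  lu_cvg U u -> lu_cvg W w -> continuous (w \o @nonneg_part R) ->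
  forall t : R, 0 <= t -> quotient_cvg u t (w t).
Proof.
move=> dU cU cW cw t t0; apply/quotient_cvgP => e e0.
have e2 : 0 < e / 2 by rewrite divr_gt0.
have [r r0 hr] : exists2 r : R, 0 < r & forall s, 0 <= s -> `|s - t| < r -> `|w s - w t| <= e / 2.
  have /cvgrPdist_le/(_ _ e2) := cw t; rewrite /= nonneg_partE// => -[r /= r0 hr].
  exists r => // s s0 st; rewrite distrC -(nonneg_partE s0); apply: hr.
  by rewrite /ball/= distrC.
exists r => // s s0 st; apply/ler_addgt0Pr => d d0.
have d2 : 0 < d / 2 by rewrite divr_gt0.
pose T := Num.max s t.
have [N1 h1] := cU T _ d2; have [N2 h2] := cW T _ e2.
pose n := maxn N1 N2.
have tT : 0 <= t <= T by rewrite t0 /T le_max lexx orbT.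
have sT : 0 <= s <= T by rewrite s0 /T le_max lexx.
have ut := h1 n (leq_maxl _ _) t tT; have us := h1 n (leq_maxl _ _) s sT.
have main : `|U n s - U n t - (s - t) *: w t| <= e * `|s - t|.
  have gen (a b : R) : 0 <= a -> a <= b -> (forall x : R, a < x < b -> `|W n x - w t| <= e) ->
      `|(U n b - b *: w t) - (U n a - a *: w t)| <= e * b - e * a.
    move=> a0 ab hab.
    have dl x : is_derive x (1:R) (fun x : R => x *: w t) (w t).
      by apply/is_deriveP => e' e'0; exists 1 => // y _; rewrite scalerBl subrr normr0 mulr_ge0// ltW.
    have de x : is_derive x (1:R) (fun x : R => e * x) e.
      by apply: is_derive_eq (drvM (drvC e x) (is_derive_id x 1)) _; rewrite mulr1 mulr0 addr0.
    have du (x : R) : 0 <= x -> is_derive x (1:R) (fun x : R => U n x - x *: w t) (W n x - w t).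
      by move=> x0; exact: is_deriveB (dU n x x0) (dl x).
    apply: (norm_increment hdot (u := fun x : R => U n x - x *: w t) (u' := fun x => W n x - w t)
      (g := fun x => e * x) (g' := fun=> e) ab) => x.
    - by move=> /andP[ax _]; exact: drv_cont (du x (le_trans a0 ax)).
    - by move=> _; exact: drv_cont (de x).
    - by move=> /andP[ax _]; exact: du x (le_trans a0 (ltW ax)).
    - exact: hab.
  have close (x : R) : 0 <= x -> x <= T -> `|x - t| < r -> `|W n x - w t| <= e.
    move=> x0 xT xt; rewrite -(subrKA (w x)) [leRHS]splitr.
    apply: le_trans (ler_normD _ _) _; apply: lerD; last exact: hr.
    by apply: h2; rewrite ?leq_maxr// x0.
  have [ts|ts] := leP t s.
    rewrite (ger0_norm (_ : 0 <= s - t)) ?subr_ge0// mulrBr.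
    have -> : U n s - U n t - (s - t) *: w t = (U n s - s *: w t) - (U n t - t *: w t).
      by rewrite scalerBl opprD addrACA -opprD.
    apply: gen => // x /andP[tx xs]; apply: close.
    - exact: le_trans (ltW tx).
    - by rewrite /T le_max (ltW xs).
    - by rewrite gtr0_norm ?subr_gt0//; move: st; rewrite ger0_norm ?subr_ge0//; lra.
  rewrite (ltr0_norm (_ : s - t < 0)) ?subr_lt0// opprB mulrBr -normrN.
  have -> : - (U n s - U n t - (s - t) *: w t) = (U n t - t *: w t) - (U n s - s *: w t).
    by rewrite scalerBl [X in - (_ + X)]opprD addrACA -[X in - (_ + X)]opprD opprB.
  apply: gen => //; first exact: ltW.
  move=> x /andP[sx xt]; apply: close.
  - exact: le_trans s0 (ltW sx).
  - by rewrite /T le_max (ltW xt) orbT.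
  - by rewrite ltr0_norm ?subr_lt0//; move: st; rewrite ltr0_norm ?subr_lt0//; lra.
have -> : u s - u t - (s - t) *: w t = (U n s - U n t - (s - t) *: w t) + (U n t - u t) - (U n s - u s).
  move: (U n s) (U n t) (u s) (u t) (_ *: w t) => a b c d' f.
  by rewrite opprB [X in _ = X + _]addrAC subrKA [RHS]addrC addrA subrKA.
apply: le_trans (ler_normB _ _) _; apply: le_trans (lerD (ler_normD _ _) (lexx _)) _.
lra.
Qed.
End LimitDerivative.

(** * Closedness and quadratic forms *)

Section Closedness.
Variables (R : realType) (H : completeNormedModType R) (dot : {dot H for idfun}).
Hypothesis hdot : hilbert_form dot.
Variables (A B : unbounded_operator H) (P : nat -> H -> H).
Hypothesis tr : sqrt_truncation dot A B P.
Variable nu : R.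
Hypothesis coercive : forall x, dom A x -> nu * `|x| ^+ 2 <= dot (A x) x.
Implicit Types (x y : H) (n k : nat).
Local Notation S := (Sn B P).

Lemma cvg_lipschitz (L : H -> H) (C : R) (X : nat -> H) x : (forall y z, `|L y - L z| <= C * `|y - z|) ->
  X n @[n --> \oo] --> x -> L (X n) @[n --> \oo] --> L x.
Proof.
move=> hL cX; apply/cvgrPdist_le => e e0.
have C0 : 0 < `|C| + 1 by rewrite ltr_wpDl.
have /cvgrPdist_le/(_ _ (divr_gt0 e0 C0)) := cX.
apply: filterS => n hn; apply: le_trans (hL _ _) _.
apply: (@le_trans _ _ ((`|C| + 1) * `|x - X n|)).
  by rewrite ler_wpM2r// (le_trans (ler_norm _))// lerDl.
by rewrite mulrC -ler_pdivlMr.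
Qed.

Lemma cvg_trunc k (X : nat -> H) x : X n @[n --> \oo] --> x -> P k (X n) @[n --> \oo] --> P k x.
Proof.
apply: (@cvg_lipschitz _ 1) => y z.
by rewrite -(truncBr tr) mul1r; exact: (trunc_norm hdot tr).
Qed.

Lemma cvg_Sn k (X : nat -> H) x : X n @[n --> \oo] --> x -> S k (X n) @[n --> \oo] --> S k x.
Proof.
have [C _ hC] := Sn_bound tr k.
by apply: (@cvg_lipschitz _ C) => y z; rewrite -(SnB tr).
Qed.

(** The truncations of B are bounded, so the limit can be taken below each level k. *)
Lemma sqrt_closed (X : nat -> H) x y : (forall n, dom B (X n)) ->
  X n @[n --> \oo] --> x -> B (X n) @[n --> \oo] --> y -> dom B x /\ B x = y.
Proof.
move=> dX cX cB.
have e k : B (P k x) = P k y.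
  have c1 := @cvg_Sn k _ _ cX; have c2 := @cvg_trunc k _ _ cB.
  have E : (fun n => P k (B (X n))) = (fun n => S k (X n)).
    by apply/funext => n; rewrite /Sn (truncB tr).
  by rewrite E in c2; exact: (cvg_unique (@norm_hausdorff _ _) c1 c2).
have dx : dom B x.
  by apply: (closedB tr (C := `|y|)) => k; rewrite e; exact: (trunc_norm hdot tr).
split=> //; have c1 := @trunc_cvg _ _ _ _ _ _ tr (B x); have c2 := @trunc_cvg _ _ _ _ _ _ tr y.
have E : (fun n => P n (B x)) = (fun n => P n y) by apply/funext => k; rewrite -(truncB tr).
by rewrite E in c1; exact: (cvg_unique (@norm_hausdorff _ _) c1 c2).
Qed.

Lemma operator_closed (X : nat -> H) x y : (forall n, dom A (X n)) ->
  X n @[n --> \oo] --> x -> A (X n) @[n --> \oo] --> y -> dom A x /\ A x = y.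
Proof.
move=> dX cX cA.
have e k : A (P k x) = P k y.
  have c1 := @cvg_Sn k _ _ (@cvg_Sn k _ _ cX); have c2 := @cvg_trunc k _ _ cA.
  have E : (fun n => P k (A (X n))) = (fun n => S k (S k (X n))).
    by apply/funext => n; rewrite (Sn_square tr) (truncA tr).
  by rewrite E in c2; rewrite -(Sn_square tr); exact: (cvg_unique (@norm_hausdorff _ _) c1 c2).
apply: (closedA tr).
have -> : (fun n => A (P n x)) = (fun n => P n y) by apply/funext => k; exact: e.
exact: (trunc_cvg tr).
Qed.

Lemma sqrt_form x y : dom A x -> dom B y -> dot (B x) (B y) = dot (A x) y.
Proof.
move=> dx dy; have dBx := domAB hdot tr dx.
have c1 : dot (P n (B x)) (P n (B y)) @[n --> \oo] --> dot (B x) (B y).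
  by apply: cvg_dot => //; exact: (trunc_cvg tr).
have c2 : dot (P n (A x)) y @[n --> \oo] --> dot (A x) y.
  by apply: cvg_dot => //; [exact: (trunc_cvg tr)|exact: cvg_cst].
have E : (fun n => dot (P n (B x)) (P n (B y))) = (fun n => dot (P n (A x)) y).
  apply/funext => n; rewrite -!(truncB tr)// -/(S n y) -(Sn_sym tr) -(truncA tr)//.
  by rewrite -(Sn_square tr).
by rewrite E in c1; exact: (cvg_unique (@Rhausdorff R) c1 c2).
Qed.

Lemma sqrt_coercive x : dom A x -> nu * `|x| ^+ 2 <= `|B x| ^+ 2.
Proof.
by move=> dx; rewrite -(hdot (B x)) (sqrt_form dx (domAB hdot tr dx)); exact: coercive.
Qed.

Lemma sqrt_coercive2 x : dom A x -> nu * `|B x| ^+ 2 <= `|A x| ^+ 2.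
Proof.
move=> dx; have dBx := domAB hdot tr dx.
have c1 : nu * dot (P n (B x)) (P n (B x)) @[n --> \oo] --> nu * dot (B x) (B x).
  by apply: cvgMr; apply: cvg_dot => //; exact: (trunc_cvg tr).
rewrite hdot in c1; apply: (cvgr_to_le c1); apply: nearW => n.
rewrite hdot -(truncB tr)//; apply: le_trans (Sn_coercive2 hdot tr coercive n x) _.
by rewrite (Sn_square tr) (truncA tr)// ler_sqr ?nnegrE// (trunc_norm hdot tr).
Qed.
End Closedness.

(** * Passage to the limit *)

Section GraphNorm.
Variables (R : realType) (H : completeNormedModType R) (A : unbounded_operator H).
Implicit Types (u : R -> H) (s t : R).

Lemma graph_norm_quotient u t d : (forall s, 0 <= s -> dom A (u s)) -> 0 <= t -> dom A d ->
  quotient_cvg u t d -> quotient_cvg (fun s => A (u s)) t (A d) ->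
  graph_norm A ((s - t)^-1 *: (u s - u t) - d) @[s --> right_nbhs t] --> (0 : R).
Proof.
move=> du t0 dd /quotient_cvg_norm h1 /quotient_cvg_norm h2; have := cvgD (FF := right_nbhs_filter t) h1 h2; rewrite addr0 => h.
refine (cvg_trans _ h); apply: (near_eq_cvg (FF := right_nbhs_filter t)); apply: within_half_line => s s0.
have ds := domB (du s s0) (du t t0).
by rewrite /graph_norm (appB (domZ _ ds) dd) (appZ _ ds) (appB (du s s0) (du t t0)).
Qed.

Lemma graph_norm_increment u t : (forall s, 0 <= s -> dom A (u s)) -> 0 <= t ->
  continuous (u \o @nonneg_part R) -> continuous ((fun s => A (u s)) \o @nonneg_part R) ->
  graph_norm A (u s - u t) @[s --> within `[0, +oo[ (nbhs t)] --> (0 : R).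
Proof.
move=> du t0 c1 c2.
have FF : Filter (within `[0, +oo[ (nbhs t)) by exact: within_filter.
have := cvgD (FF := FF) (cvg_within_norm c1 t0) (cvg_within_norm c2 t0); rewrite addr0 => h.
refine (cvg_trans _ h); apply: near_eq_cvg; apply: within_half_line => s s0.
by rewrite /graph_norm (appB (du s s0) (du t t0)).
Qed.
End GraphNorm.

Section Limit.
Variables (R : realType) (H : completeNormedModType R) (dot : {dot H for idfun}).
Hypothesis hdot : hilbert_form dot.
Variables (A B : unbounded_operator H) (P : nat -> H -> H).
Hypothesis tr : sqrt_truncation dot A B P.
Variable nu : R.
Hypothesis nu0 : 0 < nu.
Hypothesis coercive : forall x, dom A x -> nu * `|x| ^+ 2 <= dot (A x) x.
Implicit Types (x y : H) (n k : nat) (t s T : R).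
Local Notation S := (Sn B P).
Variables (g p : R) (u0 u1 : H).
Hypotheses (g0 : 0 < g) (p0 : 0 <= p).
Hypotheses (du0 : dom A u0) (du1 : dom B u1).
Variables (eps C1 C2 C3 C4 d : R) (n0 : nat).
Hypotheses (eps0 : 0 < eps) (C10 : 0 < C1) (C30 : 0 < C3) (d0 : 0 < d).
Variables (U V : nat -> R -> H).
Hypothesis gal : forall n, galerkin dot A B P g p u0 u1 eps C1 C2 C3 C4 d (n0 + n) (U n) (V n).

Let domU n t : 0 <= t -> dom A (U n t).
Proof. by move=> t0; rewrite -(galerkin_Pu (gal n) t0); exact: (trunc_domA tr). Qed.

Let domU' n t : 0 <= t -> dom B (U n t).
Proof. by move=> t0; rewrite -(galerkin_Pu (gal n) t0); exact: (trunc_domB tr). Qed.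

Let domV n t : 0 <= t -> dom B (V n t).
Proof. by move=> t0; rewrite -(galerkin_Pv (gal n) t0); exact: (trunc_domB tr). Qed.

Let BU_E n t : 0 <= t -> S (n0 + n) (U n t) = B (U n t).
Proof. by move=> t0; rewrite /Sn (galerkin_Pu (gal n) t0). Qed.

Let BV_E n t : 0 <= t -> S (n0 + n) (V n t) = B (V n t).
Proof. by move=> t0; rewrite /Sn (galerkin_Pv (gal n) t0). Qed.

Let AU_E n t : 0 <= t -> S (n0 + n) (S (n0 + n) (U n t)) = A (U n t).
Proof. by move=> t0; rewrite (Sn_square tr) (galerkin_Pu (gal n) t0). Qed.

Let trunc_shift x : P (n0 + n) x @[n --> \oo] --> x.
Proof.
apply/cvgrPdist_le => e e0.
have /cvgrPdist_le/(_ e e0)[N _ hN] := @trunc_cvg _ _ _ _ _ _ tr x.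
by exists N => // n /= Nn; apply: hN; rewrite /= (leq_trans Nn)// leq_addl.
Qed.

Let cV0 : V n 0 @[n --> \oo] --> u1.
Proof.
have -> : (fun n => V n 0) = (fun n => P (n0 + n) u1) by apply/funext => n; exact: galerkin_v0 (gal n).
exact: trunc_shift.
Qed.

Let cB0 : B (U n 0) @[n --> \oo] --> B u0.
Proof.
have -> : (fun n => B (U n 0)) = (fun n => P (n0 + n) (B u0)).
  by apply/funext => n; rewrite (galerkin_u0 (gal n)) (truncB tr _ (domAB hdot tr du0)).
exact: trunc_shift.
Qed.

Lemma galerkin_cauchy_V : lu_cauchy V.
Proof.
apply: (lu_cauchy_data cV0 cB0) => T.
have [K K0 hK] := galerkin_stability hdot tr g0 p0 eps0 C10 C30 d0 gal T.
by exists K => // n m t tT; have [] := hK n m t tT.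
Qed.

Lemma galerkin_cauchy_BU : lu_cauchy (fun n t => B (U n t)).
Proof.
apply: (lu_cauchy_data cV0 cB0) => T.
have [K K0 hK] := galerkin_stability hdot tr g0 p0 eps0 C10 C30 d0 gal T.
by exists K => // n m t tT; have [] := hK n m t tT.
Qed.

(** By coercivity. *)
Lemma galerkin_cauchy_U : lu_cauchy U.
Proof.
have s0 : 0 < Num.sqrt nu by rewrite sqrtr_gt0.
apply: (@lu_cauchy_dominated _ _ _ _ (fun n t => B (U n t)) (fun n t => B (U n t)) (fun n t => B (U n t))) => [T|||];
  try exact: galerkin_cauchy_BU.
exists (Num.sqrt nu)^-1 => [|n m t /andP[t0 _]]; first by rewrite invr_ge0 ltW.
have h := sqrt_coercive hdot tr coercive (domB (domU n t0) (domU m t0)).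
rewrite appB in h; try exact: domU'.
rewrite ler_pdivlMl//; apply: (@le_trans _ _ `|B (U n t) - B (U m t)|).
  rewrite -ler_sqr ?nnegrE ?mulr_ge0 ?(ltW s0)//.
  by rewrite exprMn sqr_sqrtr// ltW.
by rewrite -addrA lerDl addr_ge0.
Qed.

Let tail_small T (e : R) : 0 < e -> exists k, forall n t, 0 <= t <= T ->
  `|B (V n t) - P k (B (V n t))| <= e /\ `|A (U n t) - P k (A (U n t))| <= e.
Proof.
move=> e0.
have [K K0 hK] := galerkin_tail hdot tr g0 p0 du0 du1 eps0 C10 d0 gal T.
have K1 : 0 < K + 1 by rewrite ltr_wpDl.
pose r := e / (K + 1).
have r0 : 0 < r by rewrite divr_gt0.
have /cvgrPdist_le/(_ _ r0)[N1 _ h1] := @trunc_cvg _ _ _ _ _ _ tr (B u1).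
have /cvgrPdist_le/(_ _ r0)[N2 _ h2] := @trunc_cvg _ _ _ _ _ _ tr (A u0).
have q1 := h1 (maxn N1 N2) (leq_maxl _ _); have q2 := h2 (maxn N1 N2) (leq_maxr _ _).
exists (maxn N1 N2) => n t tT.
have [b1 b2] := hK (maxn N1 N2) n t tT.
have bd : K * (`|B u1 - P (maxn N1 N2) (B u1)| ^+ 2 + `|A u0 - P (maxn N1 N2) (A u0)| ^+ 2) <= e ^+ 2.
  apply: (@le_trans _ _ (K * (r ^+ 2 + r ^+ 2))).
    by rewrite ler_wpM2l// lerD// ler_sqr ?nnegrE ?(ltW r0).
  have -> : e = r * (K + 1) by rewrite /r mulfVK// gt_eqF.
  have -> : K * (r ^+ 2 + r ^+ 2) = r ^+ 2 * (2 * K) by ring.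
  rewrite [leRHS]exprMn ler_wpM2l ?sqr_ge0//.
  by have := sqr_ge0 K; rewrite !expr2; lra.
split; rewrite -ler_sqr ?nnegrE ?(ltW e0)//; [exact: le_trans b1 bd|exact: le_trans b2 bd].
Qed.

(** Below level k, B is bounded and the convergence of V suffices; [galerkin_tail] controls the
    rest uniformly in n. *)
Lemma galerkin_cauchy_BV : lu_cauchy (fun n t => B (V n t)).
Proof.
apply: (@lu_cauchy_tails _ _ P) => [k|T e e0]; last first.
  by have [k hk] := tail_small T e0; exists k => n t tT; have [] := hk n t tT.
have [C C0 hC] := Sn_bound tr k.
apply: (@lu_cauchy_dominated _ _ _ _ V V V) => [T|||]; try exact: galerkin_cauchy_V.
exists C => // n m t /andP[t0 _]; rewrite -!(truncB tr); try exact: domV.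
rewrite -!/(S k _) -(SnB tr); apply: le_trans (hC _) _.
by rewrite ler_wpM2l// -addrA lerDl addr_ge0.
Qed.

Lemma galerkin_cauchy_AU : lu_cauchy (fun n t => A (U n t)).
Proof.
apply: (@lu_cauchy_tails _ _ P) => [k|T e e0]; last first.
  by have [k hk] := tail_small T e0; exists k => n t tT; have [] := hk n t tT.
have [C C0 hC] := Sn_bound tr k.
(* P k A = S_k B on the domain of A, with S_k the truncated square root *)
apply: (@lu_cauchy_dominated _ _ _ _ (fun n t => B (U n t)) (fun n t => B (U n t)) (fun n t => B (U n t))) => [T|||];
  try exact: galerkin_cauchy_BU.
have e n t : 0 <= t -> P k (A (U n t)) = S k (B (U n t)).
  move=> t0; rewrite -(truncA tr k (domU n t0)) -(Sn_square tr) {2}/Sn (truncB tr k (domU' n t0)).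
  exact: (Sn_trunc tr).
exists C => // n m t /andP[t0 _]; rewrite !e// -(SnB tr); apply: le_trans (hC _) _.
by rewrite ler_wpM2l// -addrA lerDl addr_ge0.
Qed.

Let accel t x y (c : R) : H := eps^-1 *: (- (((1 + t) `^ p)^-1 *: x) - c *: y).

(** The second derivatives converge because the equation expresses them by quantities that do. *)
Lemma galerkin_cauchy_accel : lu_cauchy (fun n t => accel t (V n t) (A (U n t)) (`|B (U n t)| `^ (2 * g))).
Proof.
apply: (@lu_cauchy_dominated _ _ _ _ V (fun n t => B (U n t)) (fun n t => A (U n t))) => [T|||];
  [|exact: galerkin_cauchy_V|exact: galerkin_cauchy_BU|exact: galerkin_cauchy_AU].
have [lo [hi [lo0 lohi hr]]] := galerkin_range g0 p0 C10 gal T.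
have g2 : 0 < 2 * g by rewrite mulr_gt0.
have [L L0 hL] := powR_lipschitz g2 lo0 lohi.
pose a := Num.sqrt (C3 * C2).
have a0 : 0 <= a by exact: sqrtr_ge0.
pose M := hi `^ (2 * g).
have M0 : 0 <= M by exact: powR_ge0.
have ei : 0 <= eps^-1 by rewrite invr_ge0 ltW.
exists (eps^-1 * (1 + L * a + M)).
  by rewrite mulr_ge0// addr_ge0// addr_ge0// mulr_ge0.
move=> n m t /[dup] tT /andP[t0 _].
have Am : `|A (U m t)| <= a.
  rewrite -[leLHS]ger0_norm// -sqrtr_sqr ler_wsqrtr//.
  apply: le_trans (galerkin_A (gal m) t0) _; rewrite ler_pM2l//.
  apply: le_trans (galerkin_upper (gal m) t0); rewrite ler_peMr ?sqr_ge0//.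
  exact: weight_ge1.
have /andP[r1 r2] := hr n t tT; have /andP[r3 r4] := hr m t tT.
have cM : `|B (U n t)| `^ (2 * g) <= M.
  by apply: (ge0_ler_powR (ltW g2)) => //; rewrite nnegrE ?normr_ge0// (le_trans (ltW lo0)).
have cl : `| `|B (U n t)| `^ (2 * g) - `|B (U m t)| `^ (2 * g)| <= L * `|B (U n t) - B (U m t)|.
  apply: le_trans (hL _ _ (hr n t tT) _) _; first by rewrite r4 normr_ge0.
  by rewrite ler_wpM2l// ler_dist_dist.
have q1 : `|((1 + t) `^ p)^-1| <= 1.
  have h := drag_ge1 p0 t0; rewrite ger0_norm ?invr_ge0 ?powR_ge0//.
  by rewrite invf_le1// (lt_le_trans ltr01).
rewrite /accel -scalerBr normrZ (ger0_norm ei) -[leRHS]mulrA; apply: (ler_wpM2l ei).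
set c := `|B (U n t)| `^ (2 * g) in cM cl *; set c' := `|B (U m t)| `^ (2 * g) in cl *.
have -> : - (((1 + t) `^ p)^-1 *: V n t) - c *: A (U n t) - (- (((1 + t) `^ p)^-1 *: V m t) - c' *: A (U m t)) =
  - (((1 + t) `^ p)^-1 *: (V n t - V m t)) - (c *: (A (U n t) - A (U m t)) + (c - c') *: A (U m t)).
  rewrite scalerBr (scalerBr c) scalerBl subrKA.
  by rewrite [X in _ + X = _]opprD addrACA -!opprD.
apply: le_trans (ler_normB _ _) _; rewrite normrN normrZ.
apply: le_trans (lerD (lexx _) (ler_normD _ _)) _; rewrite !normrZ.
have c0 : 0 <= c by exact: powR_ge0.
rewrite (ger0_norm c0).
have n1 := normr_ge0 (V n t - V m t).
have n2 := normr_ge0 (B (U n t) - B (U m t)).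
have n3 := normr_ge0 (A (U n t) - A (U m t)).
have t1 := ler_wpM2r n1 q1.
have t2 := ler_wpM2r n3 cM.
have t3 := ler_pM (normr_ge0 _) (normr_ge0 _) cl Am.
move: (`|V n t - V m t|) (`|B (U n t) - B (U m t)|) (`|A (U n t) - A (U m t)|) n1 n2 n3 t1 t2 t3 => x y z n1 n2 n3 t1 t2 t3.
have La : 0 <= L * a by exact: mulr_ge0.
have m1 := mulr_ge0 La n1; have m2 := mulr_ge0 La n3.
have m3 := mulr_ge0 M0 n1; have m4 := mulr_ge0 M0 n2.
have m5 : L * y * a = L * a * y by ring.
rewrite !mulrDl !mulrDr; lra.
Qed.

(** Convergence of the functions and of their derivatives, both locally uniform, gives the
    derivatives of the limit ([lu_cvg_quotient]), in the graph norms thanks to the convergence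
    of B (V n) and A (U n). *)
Lemma limit_solution : exists u, is_solution A B g p eps u0 u1 u /\ forall t, 0 <= t ->
  [/\ C1 <= `|B (u t)| ^+ 2 * (1 + t) `^ ((p + 1) / g),
      `|B (u t)| ^+ 2 * (1 + t) `^ ((p + 1) / g) <= C2,
      `|A (u t)| ^+ 2 <= C3 * `|B (u t)| ^+ 2,
      nu * `|B (u t)| ^+ 2 <= `|A (u t)| ^+ 2
    & `|deriv_ge0 u t| ^+ 2 * (1 + t) ^+ 2 <= C4 * `|B (u t)| ^+ 2].
Proof.
have [u hu] := lu_cauchy_cvg galerkin_cauchy_U.
have [v hv] := lu_cauchy_cvg galerkin_cauchy_V.
have [b hb] := lu_cauchy_cvg galerkin_cauchy_BU.
have [b' hb'] := lu_cauchy_cvg galerkin_cauchy_BV.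
have [a ha] := lu_cauchy_cvg galerkin_cauchy_AU.
have [w hw] := lu_cauchy_cvg galerkin_cauchy_accel.
have pu t (t0 : 0 <= t) := lu_cvg_pointwise t0 hu.
have pv t (t0 : 0 <= t) := lu_cvg_pointwise t0 hv.
have pb t (t0 : 0 <= t) := lu_cvg_pointwise t0 hb.
have pb' t (t0 : 0 <= t) := lu_cvg_pointwise t0 hb'.
have pa t (t0 : 0 <= t) := lu_cvg_pointwise t0 ha.
have pw t (t0 : 0 <= t) := lu_cvg_pointwise t0 hw.
have uB t : 0 <= t -> dom B (u t) /\ B (u t) = b t.
  by move=> t0; apply: (sqrt_closed hdot tr _ (pu t t0) (pb t t0)) => n; exact: domU'.
have vB t : 0 <= t -> dom B (v t) /\ B (v t) = b' t.
  by move=> t0; apply: (sqrt_closed hdot tr _ (pv t t0) (pb' t t0)) => n; exact: domV.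
have uA t : 0 <= t -> dom A (u t) /\ A (u t) = a t.
  by move=> t0; apply: (operator_closed hdot tr _ (pu t t0) (pa t t0)) => n; exact: domU.
have cnp (f : nat -> R -> H) (l : R -> H) : (forall n t, 0 <= t -> {for t, continuous (f n)}) ->
    lu_cvg f l -> continuous (l \o @nonneg_part R).
  by move=> cf; apply: lu_cvg_continuous => n; apply: deriv_continuous; exact: cf.
have lu_eq (f f' : nat -> R -> H) (l : R -> H) : (forall n t, 0 <= t -> f n t = f' n t) -> lu_cvg f l -> lu_cvg f' l.
  move=> ff h T e e0; have [N hN] := h T e e0; exists N => n Nn t /[dup] tT /andP[t0 _].
  by rewrite -ff//; exact: hN.
have dS n (f : R -> H) t df : is_derive t (1:R) f df ->
    is_derive t (1:R) (fun s => S (n0 + n) (f s)) (S (n0 + n) df).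
  have [C _ hC] := Sn_bound tr (n0 + n).
  by move=> h; exact: (deriv_bounded_linear (Sn_linear tr (n0 + n)) hC h).
have hb2 := lu_eq _ _ _ (fun n t ht => esym (BU_E n ht)) hb.
have hb'2 := lu_eq _ _ _ (fun n t ht => esym (BV_E n ht)) hb'.
have ha2 := lu_eq _ _ _ (fun n t ht => esym (AU_E n ht)) ha.
have cu : continuous (u \o @nonneg_part R).
  by apply: cnp hu => n t t0; exact: drv_cont (galerkin_du (gal n) t0).
have cv : continuous (v \o @nonneg_part R).
  by apply: cnp hv => n t t0; exact: drv_cont (galerkin_dv (gal n) t0).
have cb : continuous (b \o @nonneg_part R).
  by apply: cnp hb2 => n t t0; exact: drv_cont (dS n _ _ _ (galerkin_du (gal n) t0)).
have cb' : continuous (b' \o @nonneg_part R).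
  by apply: cnp hb'2 => n t t0; exact: drv_cont (dS n _ _ _ (galerkin_dv (gal n) t0)).
have ca : continuous (a \o @nonneg_part R).
  by apply: cnp ha2 => n t t0; exact: drv_cont (dS n _ _ _ (dS n _ _ _ (galerkin_du (gal n) t0))).
have nsq (f : nat -> H) l : f n @[n --> \oo] --> l -> `|f n| ^+ 2 @[n --> \oo] --> `|l| ^+ 2.
  move=> cf; have := cvg_dot hdot _ cf cf; rewrite hdot.
  have -> : (fun n => dot (f n) (f n)) = (fun n => `|f n| ^+ 2) by apply/funext => n; rewrite hdot.
  exact.
have cmul (f : nat -> R) (l c : R) : f n @[n --> \oo] --> l -> f n * c @[n --> \oo] --> l * c.
  by move=> cf; apply: cvgM => //; exact: cvg_cst.
have lower t : 0 <= t -> C1 <= `|b t| ^+ 2 * (1 + t) `^ ((p + 1) / g).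
  move=> t0; have c1 := cmul _ _ ((1 + t) `^ ((p + 1) / g)) (nsq _ _ (pb t t0)); apply: (cvgr_to_ge c1).
  by apply: nearW => n; exact: (galerkin_lower (gal n) t0).
have upper t : 0 <= t -> `|b t| ^+ 2 * (1 + t) `^ ((p + 1) / g) <= C2.
  move=> t0; have c1 := cmul _ _ ((1 + t) `^ ((p + 1) / g)) (nsq _ _ (pb t t0)); apply: (cvgr_to_le c1).
  by apply: nearW => n; exact: (galerkin_upper (gal n) t0).
have b0 t : 0 <= t -> 0 < `|b t|.
  move=> t0; have := lt_le_trans C10 (lower t t0); rewrite normr_gt0.
  by case: eqP => [->|//]; rewrite normr0 expr0n mul0r ltxx.
have cpow t : 0 <= t -> {for `|b t|, continuous (fun r : R => r `^ (2 * g))}.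
  by move=> t0; exact: drv_cont (is_derive1_powR (2 * g) (b0 t t0)).
have wE t : 0 <= t -> w t = accel t (v t) (a t) (`|b t| `^ (2 * g)).
  move=> t0; apply: (cvg_unique (@norm_hausdorff _ _) (pw t t0)).
  apply: cvgZr; apply: cvgB; first by apply: cvgN; apply: cvgZr; exact: pv.
  apply: cvgZ; last exact: pa.
  by apply: (cvg_comp _ (fun r : R => r `^ (2 * g)) (cvg_norm (pb t t0))); exact: cpow.
have cw : continuous (w \o @nonneg_part R).
  have -> : w \o @nonneg_part R = (fun t => accel (nonneg_part t) (v (nonneg_part t)) (a (nonneg_part t)) (`|b (nonneg_part t)| `^ (2 * g))).
    by apply/funext => t; rewrite /= wE// nonneg_part_ge0.
  move=> t; have t0 := nonneg_part_ge0 t.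
  apply: cvgZr; apply: cvgB.
    apply: cvgN; apply: cvgZ; last exact: cv.
    apply: cvgV; first by rewrite gt_eqF// powR_gt0//; lra.
    apply: (continuous_comp (f := @nonneg_part R) (g := fun s => (1 + s) `^ p)).
      exact: nonneg_part_continuous.
    exact: drv_cont (deriv_drag p t0).
  apply: cvgZ; last exact: ca.
  by apply: (cvg_comp _ (fun r : R => r `^ (2 * g)) (cvg_norm (cb t))); exact: cpow.
have qu t (t0 : 0 <= t) := lu_cvg_quotient hdot (fun n t ht => galerkin_du (gal n) ht) hu hv cv t0.
have qv t (t0 : 0 <= t) := lu_cvg_quotient hdot (fun n t ht => galerkin_dv (gal n) ht) hv hw cw t0.
have qb t (t0 : 0 <= t) := lu_cvg_quotient hdot (fun n t ht => dS n _ _ _ (galerkin_du (gal n) ht)) hb2 hb'2 cb' t0.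
have Du t : 0 <= t -> deriv_ge0 u t = v t by move=> t0; exact: deriv_ge0E (qu t t0).
have qDu t : 0 <= t -> quotient_cvg (deriv_ge0 u) t (w t).
  by move=> t0; apply: quotient_cvg_eq (qv t t0) => // s s0; rewrite Du.
have Dv t : 0 <= t -> deriv_ge0 (deriv_ge0 u) t = w t by move=> t0; exact: deriv_ge0E (qDu t t0).
have np_eq (f f' : R -> H) : (forall t, 0 <= t -> f t = f' t) -> continuous (f \o @nonneg_part R) ->
    continuous (f' \o @nonneg_part R).
  move=> ff h; have <- // : f \o @nonneg_part R = f' \o @nonneg_part R.
  by apply/funext => t; rewrite /= ff// nonneg_part_ge0.
exists u; split; last first.
  move=> t t0; have [dA eA] := uA t t0; rewrite (uB t t0).2 Du//; split.
  - exact: lower.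
  - exact: upper.
  - rewrite eA.
    have c1 := nsq _ _ (pa t t0); have c2 := cmul _ _ C3 (nsq _ _ (pb t t0)).
    rewrite [leRHS]mulrC; apply: (ler_cvg_to c1 c2); apply: nearW => n; rewrite [leRHS]mulrC; exact: (galerkin_A (gal n) t0).
  - by rewrite -(uB t t0).2; exact: (sqrt_coercive2 hdot tr coercive).
  - have c1 := cmul _ _ ((1 + t) ^+ 2) (nsq _ _ (pv t t0)); have c2 := cmul _ _ C4 (nsq _ _ (pb t t0)).
    rewrite [leRHS]mulrC; apply: (ler_cvg_to c1 c2); apply: nearW => n; rewrite [leRHS]mulrC; exact: (galerkin_v (gal n) t0).
split.
- split=> [t t0|]; first by split => //; split => //; rewrite Du//; exact: quotient_cvg_norm (qu t t0).
  split=> [t t0|t t0]; first by split => //; split => //; rewrite Dv//; exact: quotient_cvg_norm (qDu t t0).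
  split=> //.
  have cD : continuous (deriv_ge0 (deriv_ge0 u) \o @nonneg_part R).
    by apply: np_eq cw => s s0; rewrite Dv.
  exact: (cvg_within_norm cD t0).
- split=> [t t0|t t0].
    split; first exact: (uB t t0).1.
    split; first by rewrite Du//; exact: (vB t t0).1.
    apply: graph_norm_quotient => //; rewrite ?Du//.
    - by move=> s s0; exact: (uB s s0).1.
    - exact: (vB t t0).1.
    - exact: qu.
    - by rewrite (vB t t0).2; apply: quotient_cvg_eq (qb t t0) => // s s0; rewrite (uB s s0).2.
  split; first by rewrite Du//; exact: (vB t t0).1.
  apply: graph_norm_increment => //.
  - by move=> s s0; rewrite Du//; exact: (vB s s0).1.
  - by apply: np_eq cv => s s0; rewrite Du.
  - by apply: np_eq cb' => s s0; rewrite Du// (vB s s0).2.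
- move=> t t0; split; first exact: (uA t t0).1.
  apply: graph_norm_increment => //.
  - by move=> s s0; exact: (uA s s0).1.
  - by apply: np_eq ca => s s0; rewrite (uA s s0).2.
- move=> t t0; rewrite Du// Dv// wE// (uB t t0).2 (uA t t0).2 /accel scalerA divff ?gt_eqF// scale1r.
  by rewrite -addrA -opprD addNr.
- split.
    apply: (cvg_unique (@norm_hausdorff _ _) (pu 0 (lexx 0))).
    have -> : (fun n => U n 0) = (fun n => P (n0 + n) u0) by apply/funext => n; exact: (galerkin_u0 (gal n)).
    exact: trunc_shift.
  by rewrite Du//; exact: (cvg_unique (@norm_hausdorff _ _) (pv 0 (lexx 0)) cV0).
Qed.
End Limit.

(** * Uniqueness *)

Section Uniqueness.
Variables (R : realType) (H : completeNormedModType R) (dot : {dot H for idfun}).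
Hypothesis hdot : hilbert_form dot.
Variables (A B : unbounded_operator H) (P : nat -> H -> H).
Hypothesis tr : sqrt_truncation dot A B P.
Variable nu : R.
Hypothesis nu0 : 0 < nu.
Hypothesis coercive : forall x, dom A x -> nu * `|x| ^+ 2 <= dot (A x) x.
Implicit Types (x y : H) (t s T : R) (u z : R -> H).
Variables (g p eps : R) (u0 u1 : H).
Hypotheses (g0 : 0 < g) (eps0 : 0 < eps).

Lemma cvg_dominated (F : set_system R) (f : R -> H) (M : R -> R) (l : H) : Filter F ->
  (\forall s \near F, `|f s - l| <= M s) -> M s @[s --> F] --> (0 : R) -> f s @[s --> F] --> l.
Proof.
move=> FF hM cM; apply/cvgrPdist_lt => e e0.
have /cvgrPdist_lt/(_ e e0) h := cM.
apply: filterS2 hM h => s h1 h2; rewrite distrC; apply: le_lt_trans h1 _.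
by apply: le_lt_trans h2; rewrite sub0r normrN ler_norm.
Qed.

(** The graph norm dominates both the norm of x and that of its image, so derivatives in the graph norm are
    derivatives of u and of B u. *)
Lemma solution_regularity u : is_solution A B g p eps u0 u1 u ->
  forall t, 0 <= t -> [/\ dom A (u t), dom B (deriv_ge0 u t), quotient_cvg u t (deriv_ge0 u t),
    quotient_cvg (deriv_ge0 u) t (deriv_ge0 (deriv_ge0 u) t) &
    quotient_cvg (fun s => B (u s)) t (B (deriv_ge0 u t))].
Proof.
move=> [[h1 [h2 _]] [h3 h4] h5 _ _] t t0.
have dA s : 0 <= s -> dom A (u s) by move=> /h5[].
have [dBu [dBv h]] := h3 t t0.
split => //; first exact: dA.
- have [_ [_ q]] := h1 t t0; refine (cvg_dominated (right_nbhs_filter t) _ q).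
  by apply: within_half_line => s s0; exact: lexx.
- have [_ [_ q]] := h2 t t0; refine (cvg_dominated (right_nbhs_filter t) _ q).
  by apply: within_half_line => s s0; exact: lexx.
refine (cvg_dominated (right_nbhs_filter t) _ h); apply: within_half_line => s s0.
have ds := domB (domAB hdot tr (dA s s0)) (domAB hdot tr (dA t t0)).
rewrite /graph_norm (appB (domZ _ ds) dBv) (appZ _ ds) (appB (domAB hdot tr (dA s s0)) (domAB hdot tr (dA t t0))).
by rewrite lerDr.
Qed.

Lemma solution_continuous u : is_solution A B g p eps u0 u1 u ->
  continuous ((fun s => A (u s)) \o @nonneg_part R) /\
  continuous ((fun s => B (deriv_ge0 u s)) \o @nonneg_part R).
Proof.
move=> [_ [_ h4] h5 _ _].
have gen (C : unbounded_operator H) f : class_C 0 (dom C) (graph_norm C) f -> continuous ((fun s => C (f s)) \o @nonneg_part R).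
  move=> h; apply: continuous_within_half_line => t t0; have [d q] := h t t0.
  refine (cvg_dominated (within_filter _ _) _ q); apply: within_half_line => s s0.
  by rewrite /graph_norm (appB (h s s0).1 d) lerDr.
by split; exact: gen.
Qed.

(** The energy inequality for the difference of two solutions that start together. The bounds below on |B u| come
    from continuity on the compact interval [0, T], and only u is required not
    to vanish, since [powR_lipschitz] keeps only one of the two points away from 0. *)
Lemma uniqueness u z : is_solution A B g p eps u0 u1 u -> is_solution A B g p eps u0 u1 z ->
  (forall t, 0 <= t -> B (u t) <> 0) -> forall T, 0 <= T -> z T = u T.
Proof.
move=> su sz nz T T0.
have ru := solution_regularity su; have rz := solution_regularity sz.
have [cAu cBv] := solution_continuous su; have [cAz _] := solution_continuous sz.
pose v := deriv_ge0 u; pose w := deriv_ge0 z; pose np := @nonneg_part R.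
have npE s : 0 <= s -> np s = s by exact: nonneg_partE.
have np0 s : 0 <= np s by exact: nonneg_part_ge0.
have cBu : continuous ((fun s => B (u s)) \o np).
  by apply: quotient_cvg_continuous => t t0; have [_ _ _ _ q] := ru t t0; eexists; exact: q.
have cBz : continuous ((fun s => B (z s)) \o np).
  by apply: quotient_cvg_continuous => t t0; have [_ _ _ _ q] := rz t t0; eexists; exact: q.
have cv : continuous (v \o np).
  by apply: quotient_cvg_continuous => t t0; have [_ _ _ q _] := ru t t0; eexists; exact: q.
have cw : continuous (w \o np).
  by apply: quotient_cvg_continuous => t t0; have [_ _ _ q _] := rz t t0; eexists; exact: q.
have b0 s : 0 < `|B (u (np s))| by rewrite normr_gt0; apply/eqP; exact: nz.
have b20 s : 0 < `|B (u (np s))| ^+ 2 by rewrite exprn_gt0.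
have [M1 hM1] := bounded_on_segment (f := (fun s => B (u s)) \o np) 0 T cBu.
have [M2 hM2] := bounded_on_segment (f := (fun s => B (z s)) \o np) 0 T cBz.
have [a ha] := bounded_on_segment (f := (fun s => A (z s)) \o np) 0 T cAz.
have cb : continuous (fun s => `|B (u (np s))|).
  by move=> s; exact: (continuous_comp (cBu s) (@norm_continuous _ _ _)).
have [M3 hM3] : exists M, forall t : R, 0 <= t <= T -> `|(`|B (u (np t))|)^-1| <= M.
  apply: (@bounded_on_segment R R^o (fun s => (`|B (u (np s))|)^-1)) => s.
  by apply: cvgV; [rewrite gt_eqF|exact: cb].
pose dc s := g * (`|B (u (np s))| ^+ 2) `^ (g - 1) * (2 * dot (B (u (np s))) (B (v (np s)))).
have [M4 hM4] : exists M, forall t : R, 0 <= t <= T -> `|dc t| <= M.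
  apply: (@bounded_on_segment R R^o dc) => s; apply: cvgM.
    apply: cvgM; first exact: cvg_cst.
    have c2 : {for s, continuous (fun s => `|B (u (np s))| ^+ 2)}.
      have -> : (fun s => `|B (u (np s))| ^+ 2) = (fun s => `|B (u (np s))| * `|B (u (np s))|).
        by apply/funext => r; rewrite expr2.
      by apply: cvgM; exact: cb.
    apply: (continuous_comp c2 (g := fun r => r `^ (g - 1))).
    exact: drv_cont (is_derive1_powR (g - 1) (b20 s)).
  apply: cvgM; first exact: cvg_cst.
  by apply: (cvg_dot hdot); [exact: cBu|exact: cBv].
pose hi := `|M1| + `|M2|.
(* M3 bounds 1 / |B u|, which is continuous because |B u| does not vanish *)
pose lo := (`|M3| + 1)^-1.
have lo0 : 0 < lo by rewrite invr_gt0 ltr_wpDl.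
have TT : (0:R) <= 0 <= T by rewrite lexx.
have rb s : 0 <= s <= T -> lo <= `|B (u (np s))| <= hi.
  move=> sT; apply/andP; split.
    rewrite -[leRHS]invrK lef_pV2 ?posrE ?invr_gt0 ?ltr_wpDl//.
    apply: le_trans (ler_norm _) _; apply: le_trans (hM3 s sT) _.
    by apply: le_trans (ler_norm _) _; rewrite lerDl.
  apply: le_trans (hM1 s sT) _; apply: le_trans (ler_norm _) _; by rewrite lerDl.
have rz' s : 0 <= s <= T -> 0 <= `|B (z (np s))| <= hi.
  move=> sT; rewrite normr_ge0 /=.
  apply: le_trans (hM2 s sT) _; apply: le_trans (ler_norm _) _; by rewrite lerDr.
have lohi : lo <= hi by have /andP[h1 h2] := rb 0 TT; exact: le_trans h1 h2.
have g2 : 0 < 2 * g by rewrite mulr_gt0.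
have [L L0 hL] := powR_lipschitz g2 lo0 lohi.
pose c s := (`|B (u (np s))| ^+ 2) `^ g.
have cE s : c s = `|B (u (np s))| `^ (2 * g) by rewrite /c powRrM -powR_mulrn.
have a0 : 0 <= `|a| by [].
pose K := `|M4| + L * `|a|.
have K0 : 0 <= K by rewrite addr_ge0// mulr_ge0.
pose e1 s := `|v (np s) - w (np s)| ^+ 2.
pose e2 s := `|B (u (np s)) - B (z (np s))| ^+ 2.
pose y s := dot (v (np s) - w (np s)) (deriv_ge0 v s - deriv_ge0 w s).
pose x s := dot (B (u (np s)) - B (z (np s))) (B (v s) - B (w s)).
pose c0 := lo `^ (2 * g).
have c00 : 0 < c0 by exact: powR_gt0.
have nsq_cont (f : R -> H) : continuous f -> continuous (fun s => `|f s| ^+ 2).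
  move=> cf s; have -> : (fun s => `|f s| ^+ 2) = (fun s => dot (f s) (f s)) by apply/funext => r; rewrite hdot.
  by apply: (cvg_dot hdot); exact: cf.
have nsq_drv (f : R -> H) t df : is_derive t (1:R) f df -> is_derive t (1:R) (fun s => `|f s| ^+ 2) (2 * dot (f t) df).
  move=> d; have -> : (fun s => `|f s| ^+ 2) = (fun s => dot (f s) (f s)) by apply/funext => r; rewrite hdot.
  apply: is_derive_eq (deriv_dot hdot d d) _; rewrite (dotC dot df); ring.
have c1 : continuous e1.
  by apply: (nsq_cont (fun s => v (np s) - w (np s))) => s; apply: cvgB; [exact: cv|exact: cw].
have c2 : continuous e2.
  by apply: (nsq_cont (fun s => B (u (np s)) - B (z (np s)))) => s; apply: cvgB; [exact: cBu|exact: cBz].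
have cc : continuous c.
  move=> s; have c3 := nsq_cont _ cBu s.
  apply: (continuous_comp c3 (g := fun r => r `^ g)).
  exact: drv_cont (is_derive1_powR g (b20 s)).
have dBu s : 0 < s -> is_derive s (1:R) (fun r => B (u (np r))) (B (v s)).
  move=> s0; have [_ _ _ _ q] := ru s (ltW s0); exact: (quotient_cvg_derive s0 q).
have dBz s : 0 < s -> is_derive s (1:R) (fun r => B (z (np r))) (B (w s)).
  move=> s0; have [_ _ _ _ q] := rz s (ltW s0); exact: (quotient_cvg_derive s0 q).
have dv s : 0 < s -> is_derive s (1:R) (fun r => v (np r)) (deriv_ge0 v s).
  move=> s0; have [_ _ _ q _] := ru s (ltW s0); exact: (quotient_cvg_derive s0 q).
have dw s : 0 < s -> is_derive s (1:R) (fun r => w (np r)) (deriv_ge0 w s).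
  move=> s0; have [_ _ _ q _] := rz s (ltW s0); exact: (quotient_cvg_derive s0 q).
have key := energy_stability (e1 := e1) (e2 := e2) (x := x) (y := y) (c := c) (dc := dc) (c1 := hi `^ (2 * g))
  T0 (lexx T) eps0 c00 K0.
have [_ fin] : e1 T <= stability_constant eps c0 (hi `^ (2 * g)) K T * (e1 0 + e2 0) /\
    e2 T <= stability_constant eps c0 (hi `^ (2 * g)) K T * (e1 0 + e2 0).
  apply: key => [s _|s _|s _|s /andP[s0 _]|s /andP[s0 _]|s /andP[s0 _]|s|s|s sT'|s /andP[s0 sT]|s /andP[s0 sT]].
  - exact: c1.
  - exact: c2.
  - exact: cc.
  - exact: (nsq_drv (fun r => v (np r) - w (np r)) _ _ (is_deriveB (dv s s0) (dw s s0))).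
  - exact: (nsq_drv (fun r => B (u (np r)) - B (z (np r))) _ _ (is_deriveB (dBu s s0) (dBz s s0))).
  - have d := drvpow (f := fun s => `|B (u (np s))| ^+ 2) g (b20 s) (nsq_drv _ _ _ (dBu s s0)).
    by apply: is_derive_eq d _; rewrite /dc npE// ltW.
  - exact: sqr_ge0.
  - exact: sqr_ge0.
  - have /andP[h1 h2] := rb s sT'.
    by rewrite cE !(ge0_ler_powR (ltW g2))// nnegrE ltW// (lt_le_trans lo0).
  - have sT' : 0 <= s <= T by rewrite !ltW.
    apply: le_trans (ler_norm _) _; apply: le_trans (hM4 s sT') _.
    by apply: le_trans (ler_norm _) _; rewrite /K lerDl mulr_ge0.
  have sT' : 0 <= s <= T by rewrite !ltW.
  have s0' := ltW s0.
  have [dAu dBv _ _ _] := ru s s0'; have [dAz dBw _ _ _] := rz s s0'.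
  have [_ _ _ /(_ s s0') equ _] := su; have [_ _ _ /(_ s s0') eqz _] := sz.
  pose q := ((1 + s) `^ p)^-1.
  have q0 : 0 <= q by rewrite invr_ge0 powR_ge0.
  have equ' : eps *: deriv_ge0 v s = - (q *: v s + c s *: A (u s)).
    by apply/eqP; rewrite -addr_eq0 addrA cE npE// equ.
  have eqz' : eps *: deriv_ge0 w s = - (q *: w s + `|B (z s)| `^ (2 * g) *: A (z s)).
    by apply/eqP; rewrite -addr_eq0 addrA eqz.
  have E1 : eps * y s = - (q * e1 s) - c s * x s
     - (c s - `|B (z s)| `^ (2 * g)) * dot (v s - w s) (A (z s)).
    (* both forms of x express <B (u - z), B (v - w)> *)
    have xE : x s = dot (v s - w s) (A (u s) - A (z s)).
      rewrite /x npE// -(appB (domAB hdot tr dAu) (domAB hdot tr dAz)) -(appB dBv dBw).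
      by rewrite (sqrt_form hdot tr (domB dAu dAz) (domB dBv dBw)) (appB dAu dAz) (dotC dot (v s - w s)).
    rewrite xE /y /e1 npE// -dotZr scalerBr equ' eqz' -(hdot (v s - w s)).
    move: (v s) (w s) (A (u s)) (A (z s)) (`|B (z s)| `^ (2 * g)) => v1 w1 a1 a2 c'.
    rewrite !dotE; ring.
  have E2 : `|(c s - `|B (z s)| `^ (2 * g)) * dot (v s - w s) (A (z s))| <= L * `|a| * (e1 s + e2 s).
    have h1 : `|c s - `|B (z s)| `^ (2 * g)| <= L * `|B (u s) - B (z s)|.
      have h := hL _ _ (rb s sT') (rz' s sT'); rewrite -cE !npE// in h.
      by apply: le_trans h _; rewrite ler_wpM2l// ler_dist_dist.
    have h2 : `|dot (v s - w s) (A (z s))| <= `|v s - w s| * `|a|.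
      apply: le_trans (dot_le_norm hdot _ _) _; rewrite ler_wpM2l//.
      by have := ha s sT'; rewrite /= npE// => h; apply: le_trans h (ler_norm _).
    rewrite normrM; apply: le_trans (ler_pM (normr_ge0 _) (normr_ge0 _) h1 h2) _.
    rewrite /e1 /e2 npE//; move: (`|v s - w s|) (`|B (u s) - B (z s)|) => r1 r2.
    have -> : L * r2 * (r1 * `|a|) = L * `|a| * (r1 * r2) by ring.
    rewrite ler_wpM2l ?mulr_ge0//; have := sqr_ge0 (r1 - r2); have := sqr_ge0 r1; have := sqr_ge0 r2; nra.
  have E3 : 0 <= q * e1 s by rewrite mulr_ge0 ?sqr_ge0.
  have E4 : 0 <= `|M4| * (e1 s + e2 s) by rewrite mulr_ge0// addr_ge0// sqr_ge0.
  move: E2; rewrite ler_norml => /andP[E2 _].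
  rewrite E1 /K mulrDl; lra.
have [_ _ _ _ [iu iv]] := su; have [_ _ _ _ [jz jw]] := sz.
have i1 : e1 0 = 0 by rewrite /e1 npE// /v /w iv jw subrr normr0 expr0n.
have i2 : e2 0 = 0 by rewrite /e2 npE// iu jz subrr normr0 expr0n.
rewrite i1 i2 addr0 mulr0 in fin.
have [dAu _ _ _ _] := ru T T0; have [dAz _ _ _ _] := rz T T0.
have := sqrt_coercive hdot tr coercive (domB dAu dAz).
rewrite (appB (domAB hdot tr dAu) (domAB hdot tr dAz)) => h.
rewrite /e2 npE// in fin; have {}h := le_trans h fin.
rewrite pmulr_rle0// in h.
apply/esym/eqP; rewrite -subr_eq0 -normr_eq0 -sqrf_eq0 eq_le h sqr_ge0//.
Qed.
End Uniqueness.

(** * Existence, uniqueness and decay *)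

Section Coercivity.
Variables (R : realType) (H : completeNormedModType R) (dot : {dot H for idfun}).

(** Nonnegativity bounds the Rayleigh quotients from below, so that their infimum is a lower bound. *)
Lemma rayleigh_coercive (A : unbounded_operator H) : nonnegative dot A ->
  forall x, dom A x -> rayleigh_inf dot A * `|x| ^+ 2 <= dot (A x) x.
Proof.
move=> nn x dx; have [->|x0] := eqVneq x 0.
  by rewrite normr0 expr0n mulr0 linear0r.
have x2 : 0 < `|x| ^+ 2 by rewrite exprn_gt0// normr_gt0.
rewrite -ler_pdivlMr//; apply: ge_inf; last by exists x.
by exists 0 => _ [y [dy _] <-]; rewrite divr_ge0 ?sqr_ge0//; exact: nn.
Qed.

Lemma decay_bounds (C1 C2 C3 C4 nu w t b a v : R) : 0 < C1 -> 0 < C2 -> 0 < C3 -> 0 < C4 -> 0 < nu ->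
  0 < w -> 0 <= t -> C1 <= b * w -> b * w <= C2 -> a <= C3 * b -> nu * b <= a ->
  v * (1 + t) ^+ 2 <= C4 * b ->
  let c1 := C1 * (nu / (1 + nu)) in let c2 := C2 * (1 + C3 + C4) in
  [/\ c1 / w <= b, b <= c2 / w, c1 / w <= a, a <= c2 / w & v <= c2 / ((1 + t) ^+ 2 * w)].
Proof.
move=> C10 C20 C30 C40 nu0 w0 t0 l u au al vu c1 c2.
have n1 : 0 < 1 + nu by rewrite addr_gt0.
have r1 : nu / (1 + nu) <= 1 by rewrite ler_pdivrMr// mul1r lerDr.
have r2 : nu / (1 + nu) <= nu by rewrite ler_pdivrMr// ler_peMr ?(ltW nu0)// lerDl ltW.
(* nu / (1 + nu) is below both 1 and nu *)
have k1 : c1 <= C1 by rewrite ler_piMr// ltW.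
have k2 : c1 <= nu * C1 by rewrite [leRHS]mulrC ler_wpM2l// ltW.
have s0 : 0 < (1 + t) ^+ 2 by rewrite exprn_gt0//; lra.
have bw : 0 <= b * w by apply: le_trans l; exact: ltW.
have m3 : C3 * (b * w) <= C3 * C2 by rewrite ler_wpM2l// ltW.
have m4 : C4 * (b * w) <= C4 * C2 by rewrite ler_wpM2l// ltW.
have p3 : 0 <= C3 * C2 by rewrite mulr_ge0// ltW.
have p4 : 0 <= C4 * C2 by rewrite mulr_ge0// ltW.
have c2E : c2 = C2 + C3 * C2 + C4 * C2 by rewrite /c2; ring.
rewrite !ler_pdivrMr// !ler_pdivlMr//; last by rewrite mulr_gt0.
have a1 := ler_wpM2r (ltW w0) au; have a2 := ler_wpM2r (ltW w0) al; have a3 := ler_wpM2r (ltW w0) vu.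
rewrite -mulrA in a1; rewrite -mulrA in a2; rewrite -!mulrA in a3.
have a4 : nu * C1 <= nu * (b * w) by rewrite ler_wpM2l// ltW.
by split; rewrite ?c2E; lra.
Qed.
End Coercivity.

Theorem theorem2p1 (R : realType) (H : completeNormedModType R)
    (dot : {dot H for idfun}) (hdot : hilbert_form dot)
    (A sqrtA : unbounded_operator H)
    (A_sa : self_adjoint dot A) (A_nonneg : nonnegative dot A)
    (A_coercive : 0 < rayleigh_inf dot A)
    (sqrtA_def : is_power dot A (2^-1) sqrtA)
    (gamma p : R) (gamma_gt0 : 0 < gamma) (p_ge0 : 0 <= p) (p_le1 : p <= 1)
    (u0 u1 : H) (u0_dom : dom A u0) (u1_dom : dom sqrtA u1)
    (u0_neq0 : sqrtA u0 <> 0) :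
  exists eps0 : R, 0 < eps0 /\
    (forall eps, 0 < eps -> eps < eps0 ->
       exists u, is_solution A sqrtA gamma p eps u0 u1 u /\
         forall v, is_solution A sqrtA gamma p eps u0 u1 v ->
           forall t, 0 <= t -> v t = u t) /\
    exists C1 C2 : R, 0 < C1 /\ 0 < C2 /\
      forall eps, 0 < eps -> eps < eps0 ->
      forall u, is_solution A sqrtA gamma p eps u0 u1 u ->
      forall t, 0 <= t ->
        [/\ C1 / (1 + t) `^ ((p + 1) / gamma) <= `|sqrtA (u t)| ^+ 2,
            `|sqrtA (u t)| ^+ 2 <= C2 / (1 + t) `^ ((p + 1) / gamma),
            C1 / (1 + t) `^ ((p + 1) / gamma) <= `|A (u t)| ^+ 2,
            `|A (u t)| ^+ 2 <= C2 / (1 + t) `^ ((p + 1) / gamma)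
          & `|deriv_ge0 u t| ^+ 2
              <= C2 / (1 + t) `^ (2 + (p + 1) / gamma)].
Proof.
have coercive := rayleigh_coercive A_nonneg.
move: (rayleigh_inf dot A) A_coercive coercive => nu nu0 coercive.
have [E [hA hB]] := sqrtA_def.
have [P tr] : exists P, sqrt_truncation dot A sqrtA P.
  by eexists; exact: (spectral_sqrt_truncation hdot A_sa A_nonneg hA hB).
have [e0 [C1 [C2 [C3 [C4 [d [n0 [[e00 C10 C20 C30 C40] [d0 ex]]]]]]]]] :=
  galerkin_existence hdot tr nu0 coercive gamma_gt0 p_ge0 p_le1 u0_dom u1_dom u0_neq0.
have sol eps : 0 < eps -> eps < e0 -> exists u, is_solution A sqrtA gamma p eps u0 u1 u /\ forall t, 0 <= t ->
  [/\ C1 <= `|sqrtA (u t)| ^+ 2 * (1 + t) `^ ((p + 1) / gamma),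
      `|sqrtA (u t)| ^+ 2 * (1 + t) `^ ((p + 1) / gamma) <= C2,
      `|A (u t)| ^+ 2 <= C3 * `|sqrtA (u t)| ^+ 2,
      nu * `|sqrtA (u t)| ^+ 2 <= `|A (u t)| ^+ 2
    & `|deriv_ge0 u t| ^+ 2 * (1 + t) ^+ 2 <= C4 * `|sqrtA (u t)| ^+ 2].
  move=> ep el.
  have /choice[U] : forall n, exists u, exists v, galerkin dot A sqrtA P gamma p u0 u1 eps C1 C2 C3 C4 d (n0 + n) u v.
    by move=> n; exact: (ex eps ep el (n0 + n)%N (leq_addr _ _)).
  move=> hU; have /choice[V gal] : forall n, exists v, galerkin dot A sqrtA P gamma p u0 u1 eps C1 C2 C3 C4 d (n0 + n) (U n) v.
    exact: hU.
  exact: (limit_solution hdot tr nu0 coercive gamma_gt0 p_ge0 u0_dom u1_dom ep C10 C30 d0 gal).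
have nz eps u : 0 < eps -> eps < e0 -> is_solution A sqrtA gamma p eps u0 u1 u ->
    (forall t, 0 <= t -> C1 <= `|sqrtA (u t)| ^+ 2 * (1 + t) `^ ((p + 1) / gamma)) ->
    forall z, is_solution A sqrtA gamma p eps u0 u1 z -> forall t, 0 <= t -> z t = u t.
  move=> ep el su lo z sz; apply: (uniqueness hdot tr nu0 coercive gamma_gt0 ep su sz) => t t0 B0.
  by have := lt_le_trans C10 (lo t t0); rewrite B0 normr0 expr0n mul0r ltxx.
exists e0; split => //; split.
  move=> eps ep el; have [u [su hu]] := sol eps ep el; exists u; split => // z sz.
  by apply: (nz eps u ep el su _ z sz) => t t0; have [] := hu t t0.
exists (C1 * (nu / (1 + nu))), (C2 * (1 + C3 + C4)); split.
  by rewrite mulr_gt0// divr_gt0// addr_gt0.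
split; first by rewrite mulr_gt0// addr_gt0// addr_gt0.
move=> eps ep el z sz t t0; have [u [su hu]] := sol eps ep el.
have zu : forall s, 0 <= s -> z s = u s.
  by apply: (nz eps u ep el su _ z sz) => s s0; have [] := hu s s0.
have Dz : deriv_ge0 z t = deriv_ge0 u t.
  have [_ _ q _ _] := solution_regularity hdot tr su t0.
  by apply: (deriv_ge0E t0); apply: quotient_cvg_eq q => // s s0; rewrite zu.
have [l1 l2 l3 l4 l5] := hu t t0; rewrite zu// Dz.
have t1 : 0 < 1 + t by lra.
have -> : (1 + t) `^ (2 + (p + 1) / gamma) = (1 + t) ^+ 2 * (1 + t) `^ ((p + 1) / gamma).
  by rewrite powRD ?(gt_eqF t1) ?implybT// powR_mulrn// ltW.
by apply: (decay_bounds C10 C20 C30 C40 nu0 _ t0 l1 l2 l3 l4 l5); rewrite powR_gt0.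
Qed.
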